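(* Let $2T\subset SU(2)$ be the binary tetrahedral group of order $24$. For the round binary tetrahedral space $SU(2)/2T$ with the trivial spin structure, the spectrum of the canonical Dirac operator $D$ is contained in the set $\{\pm(3/2+k) : k\in\mathbb{N}\}$. For every $k\in\{0,1,\dots,11\}$ and $t\in\mathbb{Z}$, the multiplicity of $3/2+k+12t$ (as an eigenvalue of $D$, with multiplicity $0$ meaning that it is not an eigenvalue) equals $P_k(3/2+k+12t)$, where $P_k(u)=0$ if $k$ is odd, and $$P_0(u)=\tfrac{7}{16}+\tfrac{11}{12}u+\tfrac1{12}u^2,\quad P_2(u)=-\tfrac{7}{48}-\tfrac{3}{12}u+\tfrac1{12}u^2,\quad P_4(u)=-\tfrac{11}{48}-\tfrac{5}{12}u+\tfrac1{12}u^2,$$ $$P_6(u)=\tfrac{9}{48}+\tfrac{5}{12}u+\tfrac1{12}u^2,\quad P_8(u)=\tfrac{5}{48}+\tfrac14u+\tfrac1{12}u^2,\quad P_{10}(u)=-\tfrac{23}{48}-\tfrac{11}{12}u+\tfrac1{12}u^2.$$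
   Context: $\mathbb{N}=\{0,1,2,\dots\}$. Identify $SU(2)$ with the unit quaternions; $2T$ is the group $\{\pm1,\pm i,\pm j,\pm k,\tfrac12(\pm1\pm i\pm j\pm k)\}$ (all sign combinations). In $\mathfrak{su}(2)$ let $I=\begin{pmatrix} i&0\\0&-i\end{pmatrix}$, $J=\begin{pmatrix}0&1\\-1&0\end{pmatrix}$, $K=\begin{pmatrix}0&i\\i&0\end{pmatrix}$ (corresponding to the quaternions $i,j,k$). For a finite subgroup $\Gamma\subset SU(2)$, the round metric on $SU(2)/\Gamma=\{g\Gamma\}$ is induced by the bi-invariant metric on $SU(2)\cong S^3$ for which $X_1=I,\ X_2=J,\ X_3=K$ is an orthonormal basis (the unit 3-sphere). The trivial spin structure is the one corresponding to the lift of the isotropy representation $\Gamma\to SO(3)$ given by the inclusion $\iota:\Gamma\to SU(2)\cong\mathrm{Spin}(3)$, i.e. $SU(2)\times_\iota\mathrm{Spin}(3)$ (equivalently, writing $\mathrm{Spin}(4)=SU(2)\times SU(2)$ with $\Gamma$ acting on $S^3$ through one factor, the lift $\gamma\mapsto(\gamma,1)$). Concretely, spinor fields are the functions $\psi:SU(2)\to\mathbb{C}^2$ with $\psi(g\gamma)=\gamma^{-1}\psi(g)$ for all $\gamma\in\Gamma$, and $$D\psi = I\,(X_1\psi)+J\,(X_2\psi)+K\,(X_3\psi)-\tfrac32\,\psi,$$ where $(X\psi)(g)=\frac{d}{dt}\big|_{t=0}\psi(g\exp(tX))$. *)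

(* Defs.v *)
From HB Require Import structures.
From mathcomp Require Import all_boot all_order all_algebra.
From mathcomp.real_closed Require Import complex.
From mathcomp Require Import ring.
From mathcomp Require Import all_classical all_reals all_analysis.
Import Order.TTheory GRing.Theory Num.Theory numFieldNormedType.Exports.

Set Implicit Arguments.
Unset Strict Implicit.
Unset Printing Implicit Defensive.

Local Open Scope classical_set_scope.
Local Open Scope complex_scope.
Local Open Scope ring_scope.

Definition mx22 (T : Type) (a b c d : T) : 'M[T]_2 :=
  \matrix_(i, j) if i == 0 then (if j == 0 then a else b)
                 else (if j == 0 then c else d).

Definition qI (R : rcfType) : 'M[R[i]]_2 := mx22 'i 0 0 (- 'i).
Definition qJ (R : rcfType) : 'M[R[i]]_2 := mx22 0 1 (- 1) 0.
Definition qK (R : rcfType) : 'M[R[i]]_2 := mx22 0 'i 'i 0.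

(* The left-invariant orthonormal frame (X_1, X_2, X_3) = (I, J, K). *)
Definition frame (R : rcfType) (k : 'I_3) : 'M[R[i]]_2 :=
  [:: qI R; qJ R; qK R]`_k.

Definition quat (R : rcfType) (a b c d : R) : 'M[R[i]]_2 :=
  a%:C *: 1%:M + b%:C *: qI R + c%:C *: qJ R + d%:C *: qK R.

Definition is_su2 (R : rcfType) (g : 'M[R[i]]_2) : bool :=
  (g *m (map_mx (@conjc R) g)^T == 1%:M) && (\det g == 1).

Definition SU2 (R : rcfType) : Type := {g : 'M[R[i]]_2 | is_su2 g}.

HB.instance Definition _ (R : rcfType) := SubChoice.on (SU2 R).

(* SU(2) carries the subspace topology of the space of complex matrices;
   [R[i]^o] is the type [R[i]] with its metric topology. *)
HB.instance Definition _ (R : rcfType) :=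
  Topological.copy (SU2 R)
    (initial_topology (fun g : SU2 R => (val g : 'M[R[i]^o]_2))).

Lemma is_su2_1 (R : rcfType) : is_su2 (1%:M : 'M[R[i]]_2).
Proof. by rewrite /is_su2 map_mx1 trmx1 mulmx1 det1 !eqxx. Qed.

Lemma is_su2_mul (R : rcfType) (g h : SU2 R) : is_su2 (val g *m val h).
Proof.
case: g => g /= /andP[/eqP gU /eqP gD]; case: h => h /= /andP[/eqP hU /eqP hD].
apply/andP; split; last by rewrite det_mulmx gD hD mulr1.
by rewrite map_mxM trmx_mul mulmxA -[g *m h *m _]mulmxA hU mulmx1 gU.
Qed.

Lemma quatE (R : rcfType) (a b c d : R) :
  quat a b c d = mx22 (a +i* b) (c +i* d) (- c +i* d) (a -i* b).
Proof.
apply/matrixP => i j; rewrite !mxE.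
by case: i => [[|[|//]] ?]; case: j => [[|[|//]] ?] /=; simpc.
Qed.

Lemma is_su2_quat (R : rcfType) (a b c d : R) :
  a ^+ 2 + b ^+ 2 + c ^+ 2 + d ^+ 2 = 1 -> is_su2 (quat a b c d).
Proof.
move=> h; rewrite quatE; apply/andP; split; apply/eqP; last first.
  rewrite (expand_det_row _ ord0) !big_ord_recl big_ord0 /cofactor !det_mx11.
  rewrite !mxE /=; simpc; apply/eqP; rewrite eq_complex /=; apply/andP; split.
    by apply/eqP; rewrite -h; ring.
  by apply/eqP; ring.
apply/matrixP => i j; rewrite !mxE !big_ord_recl big_ord0 !mxE.
case: i => [[|[|//]] ?]; case: j => [[|[|//]] ?] /=; simpc;
  apply/eqP; rewrite eq_complex /=; apply/andP; split; apply/eqP;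
  rewrite -?h; ring.
Qed.

Definition oneSU (R : rcfType) : SU2 R := Sub 1%:M (is_su2_1 R).

Definition mulSU (R : rcfType) (g h : SU2 R) : SU2 R :=
  Sub (val g *m val h) (is_su2_mul g h).

Lemma is_su2_exp (R : realType) (k : 'I_3) (t : R) :
  is_su2 ((cos t)%:C *: 1%:M + (sin t)%:C *: frame R k).
Proof.
have := cos2Dsin2 t => h.
case: k => [[|[|[|//]]] ?]; rewrite /frame /=.
- suff -> : (cos t)%:C *: 1%:M + (sin t)%:C *: qI R = quat (cos t) (sin t) 0 0.
    by apply: is_su2_quat; rewrite expr0n /= !addr0.
  by rewrite /quat !scale0r !addr0.
- suff -> : (cos t)%:C *: 1%:M + (sin t)%:C *: qJ R = quat (cos t) 0 (sin t) 0.
    by apply: is_su2_quat; rewrite expr0n /= !addr0.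
  by rewrite /quat !scale0r !addr0.
- suff -> : (cos t)%:C *: 1%:M + (sin t)%:C *: qK R = quat (cos t) 0 0 (sin t).
    by apply: is_su2_quat; rewrite expr0n /= !addr0.
  by rewrite /quat !scale0r !addr0.
Qed.

(* exp (t X_k): since X_k ^ 2 = -1, the exponential series sums to
   cos t + sin t X_k. *)
Definition expSU (R : realType) (k : 'I_3) (t : R) : SU2 R :=
  Sub ((cos t)%:C *: 1%:M + (sin t)%:C *: frame R k) (is_su2_exp k t).

Lemma frame_sqr (R : rcfType) (k : 'I_3) : frame R k *m frame R k = - 1%:M.
Proof.
apply/matrixP => i j; rewrite /frame !mxE !big_ord_recl big_ord0.
by case: k => [[|[|[|//]]] ?]; case: i => [[|[|//]] ?];
  case: j => [[|[|//]] ?]; rewrite !mxE /=; simpc; rewrite ?oppr0.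
Qed.

Lemma expSU_add (R : realType) (k : 'I_3) (s t : R) :
  expSU k (s + t) = mulSU (expSU k s) (expSU k t).
Proof.
apply/val_inj; rewrite /= mulmxDl !mulmxDr -!scalemxAl -!scalemxAr frame_sqr.
rewrite !mul1mx !mulmx1 cosD sinD !rmorphB !rmorphD !rmorphM /=.
apply/matrixP => i j; rewrite !mxE; ring.
Qed.

Definition binary_tetrahedral (R : rcfType) : set (SU2 R) :=
  [set g | (exists (s : bool), val g \in
              [seq (-1) ^+ s *: u | u <- [:: 1%:M; qI R; qJ R; qK R]])
        \/ (exists s0 s1 s2 s3 : bool, val g =
              2^-1 *: ((-1) ^+ s0 *: 1%:M + (-1) ^+ s1 *: qI R
                     + (-1) ^+ s2 *: qJ R + (-1) ^+ s3 *: qK R))].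

Definition spinor_fun (R : rcfType) : Type := SU2 R -> 'cV[R[i]]_2.

Definition curve_along (R : realType) (k : 'I_3) (psi : spinor_fun R)
    (g : SU2 R) (j : 'I_2) : R -> R[i] :=
  fun t => psi (mulSU g (expSU k t)) j 0.

Definition lie_derivable (R : realType) (k : 'I_3) (psi : spinor_fun R) : Prop :=
  forall g j,
    derivable (fun t => complex.Re (curve_along k psi g j t) : R) 0 1 /\
    derivable (fun t => complex.Im (curve_along k psi g j t) : R) 0 1.

Definition lieD (R : realType) (k : 'I_3) (psi : spinor_fun R) : spinor_fun R :=
  fun g => \col_j (derive1 (fun t => complex.Re (curve_along k psi g j t)) 0
                +i* derive1 (fun t => complex.Im (curve_along k psi g j t)) 0).

(* Class C^n.  The X_k are a frame of the tangent bundle, so psi is C^(n+1) iff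
   it is continuous and the X_k psi exist and are C^n. *)
Fixpoint class_C (R : realType) (n : nat) (psi : spinor_fun R) : Prop :=
  continuous (psi : SU2 R -> 'cV[R[i]^o]_2) /\
  if n is m.+1 then
    forall k, lie_derivable k psi /\ class_C m (lieD k psi)
  else True.

Definition smooth (R : realType) (psi : spinor_fun R) : Prop :=
  forall n, class_C n psi.

Definition spinor_field (R : realType) (Gamma : set (SU2 R)) :
    set (spinor_fun R) :=
  [set psi | smooth psi /\
     forall g gamma, Gamma gamma ->
       psi (mulSU g gamma) = invmx (val gamma) *m psi g].

Definition dirac_op (R : realType) (psi : spinor_fun R) : spinor_fun R :=
  fun g => \sum_(k < 3) frame R k *m lieD k psi g - (3 / 2) *: psi g.

Definition dirac_eigenspace (R : realType) (Gamma : set (SU2 R)) (lambda : R[i]) :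
    set (spinor_fun R) :=
  [set psi | spinor_field Gamma psi /\
     forall g, dirac_op psi g = lambda *: psi g].

Definition has_dim (R : realType) (E : set (spinor_fun R)) (n : nat) : Prop :=
  exists e : 'I_n -> spinor_fun R, (forall i, E (e i)) /\
    forall psi, E psi ->
      exists! c : 'rV[R[i]]_n, forall g, psi g = \sum_i c 0 i *: e i g.

Definition multiplicity_is (R : realType) (Gamma : set (SU2 R))
    (lambda : R[i]) (n : nat) : Prop :=
  has_dim (dirac_eigenspace Gamma lambda) n.

(* x/|x| in the unit sphere S^3 = SU(2); the value at x = 0 is irrelevant. *)
Definition radial (R : realType) (x0 x1 x2 x3 : R) : SU2 R :=
  let r := Num.sqrt (x0 ^+ 2 + x1 ^+ 2 + x2 ^+ 2 + x3 ^+ 2) in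
  insubd (oneSU R) (quat (x0 / r) (x1 / r) (x2 / r) (x3 / r)).

Definition normsq (R : realType) (v : 'cV[R[i]]_2) : R :=
  \sum_i (complex.Re (v i 0) ^+ 2 + complex.Im (v i 0) ^+ 2).

(* Squared L^2 norm for the volume of the unit 3-sphere, which is obtained from
   Lebesgue measure on the unit ball B of R^4 by integration in polar
   coordinates:  int_(S^3) f dvol = 4 int_B f(x/|x|) dx.
   For Gamma-equivariant psi the integral over SU(2)/Gamma is this number
   divided by the order of Gamma. *)
Definition L2normsq (R : realType) (psi : spinor_fun R) : \bar R :=
  let mu := @lebesgue_measure R in
  (4%:E * \int[mu]_x0 \int[mu]_x1 \int[mu]_x2
      \int[mu]_(x3 in [set x3 | (x0 ^+ 2 + x1 ^+ 2 + x2 ^+ 2 + x3 ^+ 2 < 1)%R])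
        (normsq (psi (radial x0 x1 x2 x3)))%:E)%E.

Definition dirac_shift (R : realType) (lambda : R[i]) (psi : spinor_fun R) :
    spinor_fun R :=
  fun g => dirac_op psi g - lambda *: psi g.

(* [lambda] is a regular value of the operator D with domain the smooth spinor
   fields in their L^2 completion: D - lambda has a bounded inverse on its
   range, and this range is dense.  As the smooth fields are dense in L^2,
   density is tested on them.  These are the regular values of the closure
   of D. *)
Definition regular_value (R : realType) (Gamma : set (SU2 R))
    (lambda : R[i]) : Prop :=
  (exists2 c : R, 0 < c & forall psi, spinor_field Gamma psi ->
     (c%:E * L2normsq psi <= L2normsq (dirac_shift lambda psi))%E) /\
  (forall phi, spinor_field Gamma phi -> forall eps : R, 0 < eps ->
     exists2 psi, spinor_field Gamma psi &
       (L2normsq (fun g => dirac_shift lambda psi g - phi g)%R < eps%:E)%E).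

Definition dirac_spectrum (R : realType) (Gamma : set (SU2 R)) : set R[i] :=
  [set lambda | ~ regular_value Gamma lambda].

Definition P2T (R : realType) (k : nat) (u : R) : R :=
  match k with
  | 0 => 7 / 16 + 11 / 12 * u + 1 / 12 * u ^+ 2
  | 2 => - (7 / 48) - 3 / 12 * u + 1 / 12 * u ^+ 2
  | 4 => - (11 / 48) - 5 / 12 * u + 1 / 12 * u ^+ 2
  | 6 => 9 / 48 + 5 / 12 * u + 1 / 12 * u ^+ 2
  | 8 => 5 / 48 + 1 / 4 * u + 1 / 12 * u ^+ 2
  | 10 => - (23 / 48) - 11 / 12 * u + 1 / 12 * u ^+ 2
  | _ => 0
  end.

(* Main.v *)
(* For g in SU(2) put A = g_00 X + g_10 and B = g_01 X + g_11.  The coefficients of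
   the polynomials q(A, B), for binary forms q of degree n, are the matrix
   coefficients of the n-th symmetric power, and two families of spinors built from
   them are eigenspinors of D: one of eigenvalue 3/2 + n, indexed by n + 2
   coefficients, and one of eigenvalue -(1/2 + n), indexed by n coefficients.  By a
   Clebsch-Gordan argument they span all polynomial spinors, which are uniformly
   dense by Stone-Weierstrass.  As D is symmetric for the integral over SU(2)
   (invariance of Lebesgue measure under right multiplication by exp(t X_k)), these
   families exhaust the spectrum.  Right translation by gamma acts on them through
   q |-> q o gamma, so the multiplicities on SU(2)/2T are (n + 2) m_n and n m_n,
   where m_n is the dimension of the space of 2T-invariant forms of degree n.  A
   form invariant under 2T that vanishes at (1, 0) is divisible by
   x y (x^4 - y^4); hence m_n = m_(n-6) + 1 if 4 divides n and n <> 4, and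
   m_n = m_(n-6) otherwise. *)
From HB Require Import structures.
Require Import Defs.
From mathcomp Require Import all_boot all_order all_algebra.
From mathcomp.real_closed Require Import complex.
From mathcomp Require Import ring lra zify.
From mathcomp Require Import all_classical all_reals all_analysis measurable_realfun.
Import Order.TTheory GRing.Theory Num.Theory numFieldNormedType.Exports.

Set Implicit Arguments.
Unset Strict Implicit.
Unset Printing Implicit Defensive.

Local Open Scope classical_set_scope.
Local Open Scope complex_scope.
Local Open Scope ring_scope.

(** * Lebesgue measure on R^4 *)

Section fubini_maps.
Context d1 d2 (T1 : measurableType d1) (T2 : measurableType d2) (R : realType).

(** The squared norm is an iterated Lebesgue integral over the unit ball of R^4, so what is known
    about the volume of S^3 has to come from Tonelli: right multiplication by exp(t X_k) rotates two
    coordinate planes, a rotation is a product of shears, and a shear is a translation on each line.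
    Invariance for small t > 0 already gives that X_k f integrates to zero. The scalar product on
    spinors is the real part of the Hermitian one, so complex statements are obtained by using i psi
    alongside psi. Regularity of lambda needs two estimates on all smooth fields, not only on
    polynomial ones. The lower bound for D - lambda is computed on finite sums of eigenspinors and
    transferred to arbitrary fields by duality. For the density of the range, a polynomial solution
    without symmetry is averaged over 2T; the average stays close to the target because the error
    bound is uniform in g, hence stable under convex combinations and under the group. *)

Lemma measurable_fun_pairl (U : T1 -> T1) : measurable_fun setT U ->
  measurable_fun setT (fun z : T1 * T2 => (U z.1, z.2)).
Proof.
by move=> mU; apply: measurable_fun_pair => //; exact: (measurableT_comp mU).
Qed.

Lemma measurable_fun_pairr (U : T2 -> T2) : measurable_fun setT U ->
  measurable_fun setT (fun z : T1 * T2 => (z.1, U z.2)).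
Proof.
by move=> mU; apply: measurable_fun_pair => //; exact: (measurableT_comp mU).
Qed.

Lemma measurable_fun_section4 (x : T1) : measurable_fun setT
  (fun w : (T1 * T1) * T1 => ((x, w.1.1), (w.1.2, w.2))).
Proof.
apply: measurable_fun_pair; apply: measurable_fun_pair => //;
  exact: measurableT_comp.
Qed.

Context (m1 : {sigma_finite_measure set T1 -> \bar R}).
Context (m2 : {sigma_finite_measure set T2 -> \bar R}).

Lemma ge0_integral_pairl (U : T1 -> T1) (f : T1 * T2 -> \bar R) :
  measurable_fun setT U ->
  (forall g, measurable_fun setT g -> (forall x, 0 <= g x)%E ->
    (\int[m1]_x g (U x) = \int[m1]_x g x)%E) ->
  measurable_fun setT f -> (forall x, 0 <= f x)%E ->
  (\int[(m1 \x m2)%E]_z f (U z.1, z.2) = \int[(m1 \x m2)%E]_z f z)%E.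
Proof.
move=> mU iU mf f0; have mg := measurableT_comp mf (measurable_fun_pairl mU).
rewrite (fubini_tonelli2 f mf f0) (fubini_tonelli2 (f \o _) mg (fun z => f0 _)).
apply: eq_integral => y _; apply: (iU (fun x => f (x, y))) => //.
exact: measurableT_comp.
Qed.

Lemma ge0_integral_pairr (U : T2 -> T2) (f : T1 * T2 -> \bar R) :
  measurable_fun setT U ->
  (forall g, measurable_fun setT g -> (forall x, 0 <= g x)%E ->
    (\int[m2]_x g (U x) = \int[m2]_x g x)%E) ->
  measurable_fun setT f -> (forall x, 0 <= f x)%E ->
  (\int[(m1 \x m2)%E]_z f (z.1, U z.2) = \int[(m1 \x m2)%E]_z f z)%E.
Proof.
move=> mU iU mf f0; have mg := measurableT_comp mf (measurable_fun_pairr mU).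
rewrite (fubini_tonelli1 f mf f0) (fubini_tonelli1 (f \o _) mg (fun z => f0 _)).
apply: eq_integral => x _; apply: (iU (fun y => f (x, y))) => //.
exact: measurableT_comp.
Qed.

End fubini_maps.

Section lebesgue_R4.
Context {R : realType}.
Notation mu := (@lebesgue_measure R).
Notation mR := (measurableTypeR R).
Notation plane := (mR * mR)%type.
Notation mu2 := (mu \x mu)%E.

Lemma measurable_shift (c : R) : measurable_fun setT (fun x : mR => x + c : mR).
Proof. by apply: measurable_funD => //; exact: measurable_cst. Qed.

(** Lebesgue measure is determined by its values on half-open intervals, so the pushforward has to
    be compared only on these. *)
Lemma lebesgue_shift (c : R) (A : set mR) : measurable A ->
  mu ((fun x => x + c) @^-1` A) = mu A.
Proof.
move=> mA.
pose f : {mfun mR >-> mR} := mfun_Sub (mem_set (measurable_shift c) : (_ \in mfun)).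
apply/esym; apply: (@lebesgue_measure_unique R (pushforward mu f)) => //.
move=> _ [[a b] /= ab <-]; rewrite /pushforward.
have -> : f @^-1` `]a, b] = `]a - c, b - c]%classic.
  by apply/seteqP; split => x /=; rewrite !in_itv /= ltrBlDr lerBrDr.
rewrite !lebesgue_measure_itv /= !lte_fin ltrD2r -!EFinB.
by case: ifP => // _; congr (_%:E); ring.
Qed.

Lemma ge0_integral_shift (c : R) (f : mR -> \bar R) :
  measurable_fun setT f -> (forall x, 0 <= f x)%E ->
  (\int[mu]_x f (x + c)%R = \int[mu]_x f x)%E.
Proof.
move=> mf f0.
pose s : {mfun mR >-> mR} := mfun_Sub (mem_set (measurable_shift c) : (_ \in mfun)).
have -> : (\int[mu]_x f (x + c)%R = \int[pushforward mu s]_x f x)%E.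
  by rewrite ge0_integral_pushforward.
by apply: eq_measure_integral => A mA _; exact: lebesgue_shift.
Qed.

Lemma measurable_plane_lin (a b : R) :
  measurable_fun setT (fun z : plane => a * z.1 + b * z.2 : mR).
Proof.
apply: measurable_funD; apply: measurable_funM => //.
Qed.

Lemma measurable_plane_map (a b c d : R) :
  measurable_fun setT (fun z : plane => (a * z.1 + b * z.2, c * z.1 + d * z.2) : plane).
Proof. by apply/measurable_fun_pairP; split; exact: measurable_plane_lin. Qed.

(** On each horizontal line the shear is the translation by [a * z.2], so Tonelli reduces the claim
    to the real line. *)
Lemma ge0_integral_shear1 (a : R) (f : plane -> \bar R) :
  measurable_fun setT f -> (forall x, 0 <= f x)%E ->
  (\int[mu2]_z f (z.1 + a * z.2, z.2)%R = \int[mu2]_z f z)%E.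
Proof.
move=> mf f0.
have mg : measurable_fun setT (fun z : plane => f (z.1 + a * z.2, z.2)).
  apply: (measurableT_comp mf); have := measurable_plane_map 1 a 0 1.
  by under eq_fun do rewrite !mul1r mul0r add0r.
rewrite (fubini_tonelli2 f mf f0) (fubini_tonelli2 _ mg (fun z => f0 _)).
apply: eq_integral => y _; rewrite /fubini_G /= (ge0_integral_shift (a * y) (f := fun x => f (x, y)))//.
exact: measurableT_comp.
Qed.

Lemma ge0_integral_shear2 (a : R) (f : plane -> \bar R) :
  measurable_fun setT f -> (forall x, 0 <= f x)%E ->
  (\int[mu2]_z f (z.1, z.2 + a * z.1)%R = \int[mu2]_z f z)%E.
Proof.
move=> mf f0.
have mg : measurable_fun setT (fun z : plane => f (z.1, z.2 + a * z.1)).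
  apply: (measurableT_comp mf); have := measurable_plane_map 1 0 a 1.
  by under eq_fun do rewrite !mul1r mul0r addr0 [_ * _ + _]addrC.
rewrite (fubini_tonelli1 f mf f0) (fubini_tonelli1 _ mg (fun z => f0 _)).
apply: eq_integral => x _; rewrite /fubini_F /= (ge0_integral_shift (a * x) (f := fun y => f (x, y)))//.
exact: measurableT_comp.
Qed.

(* A rotation by an angle with nonzero sine is a product of three shears. *)
Lemma ge0_integral_rot (c s : R) (f : plane -> \bar R) :
  c ^+ 2 + s ^+ 2 = 1 -> s != 0 ->
  measurable_fun setT f -> (forall x, 0 <= f x)%E ->
  (\int[mu2]_z f (c * z.1 - s * z.2, s * z.1 + c * z.2)%R = \int[mu2]_z f z)%E.
Proof.
(* For c = cos theta and s = sin theta this is - tan(theta / 2); the shears with slopes [a], [s],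
   [a] compose to the rotation. *)
move=> cs s0 mf f0; pose a := (c - 1) / s.
have as_ : a * s = c - 1 by rewrite /a mulfVK.
pose f1 z := f (z.1 + a * z.2, z.2).
have mf1 : measurable_fun setT f1.
  apply: (measurableT_comp mf); have := measurable_plane_map 1 a 0 1.
  by under eq_fun do rewrite !mul1r mul0r add0r.
pose f2 z := f1 (z.1, z.2 + s * z.1).
have mf2 : measurable_fun setT f2.
  apply: (measurableT_comp mf1); have := measurable_plane_map 1 0 s 1.
  by under eq_fun do rewrite !mul1r mul0r addr0 [_ * _ + _]addrC.
have f10 z : (0 <= f1 z)%E by exact: f0.
have f20 z : (0 <= f2 z)%E by exact: f0.
rewrite -(ge0_integral_shear1 a mf f0) -/f1 -(ge0_integral_shear2 s mf1 f10).
rewrite -(ge0_integral_shear1 a mf2 f20).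
apply: eq_integral => -[x y] _; rewrite /f2 /f1 /=.
have e2 : y + s * (x + a * y) = s * x + c * y.
  by rewrite mulrDr mulrA [s * a]mulrC as_; ring.
rewrite e2; congr (f (_, _)).
have -> : x + a * y + a * (s * x + c * y) = x + (a * s) * x + a * (1 + c) * y by ring.
have -> : a * (1 + c) = - s.
  apply: (mulIf s0); rewrite mulrAC as_ mulNr -expr2.
  have -> : (c - 1) * (1 + c) = c ^+ 2 - 1 by ring.
  by rewrite -cs; ring.
by rewrite as_; ring.
Qed.

Lemma measurable_plane_rot (c s : R) :
  measurable_fun setT (fun z : plane => (c * z.1 - s * z.2, s * z.1 + c * z.2) : plane).
Proof. by have := measurable_plane_map c (- s) s c; under eq_fun do rewrite mulNr. Qed.

Lemma ge0_integral_swap (f : plane -> \bar R) :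
  measurable_fun setT f -> (forall x, 0 <= f x)%E ->
  (\int[mu2]_z f (z.2, z.1) = \int[mu2]_z f z)%E.
Proof.
move=> mf f0.
have mg : measurable_fun setT (fun z : plane => f (z.2, z.1)).
  by apply: (measurableT_comp mf); exact: measurable_swap.
by rewrite fubini_tonelli2// fubini_tonelli1.
Qed.

Lemma sigma_finite_plane : sigma_finite setT (mu2 : set plane -> \bar R).
Proof.
have /sigma_finiteP[F [TF ndF Foo]] := sigma_finiteT mu.
exists (fun n => F n `*` F n).
  rewrite -setXTT TF predeqE => -[x y]; split => [[/= [n _ Fnx] [k _ Fky]]|].
    exists (maxn n k) => //; split => /=.
    - by move: x Fnx; exact/subsetPset/ndF/leq_maxl.
    - by move: y Fky; exact/subsetPset/ndF/leq_maxr.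
  by move=> [n _ [/= ? ?]]; split; exists n.
move=> k; have [? ?] := Foo k; split; first exact: measurableX.
by rewrite product_measure1E// lte_mul_pinfty// ge0_fin_numE.
Qed.

(* The library's canonical instance on products of measures is the one for
   subprobabilities, hence this named copy. *)
Definition plane_measure : set plane -> \bar R := mu2.
HB.instance Definition _ := Measure.on plane_measure.
HB.instance Definition _ :=
  Measure_isSigmaFinite.Build _ _ _ plane_measure sigma_finite_plane.
Notation space := (plane * plane)%type.

Lemma ge0_integral_R4 (f : space -> \bar R) :
  measurable_fun setT f -> (forall x, 0 <= f x)%E ->
  (\int[(plane_measure \x plane_measure)%E]_z f z =
   \int[mu]_x0 \int[mu]_x1 \int[mu]_x2 \int[mu]_x3 f ((x0, x1), (x2, x3)))%E.
Proof.
move=> mf f0; rewrite (fubini_tonelli1 (m1 := plane_measure) (m2 := plane_measure))//.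
rewrite fubini_tonelli1; last 2 first.
- exact: measurable_fun_fubini_tonelli_F.
- by move=> x; apply: integral_ge0.
apply: eq_integral => x0 _; apply: eq_integral => x1 _; rewrite /fubini_F.
rewrite fubini_tonelli1//; exact: measurableT_comp.
Qed.

Definition preserves_volume (T : space -> space) := measurable_fun setT T /\
  forall f : space -> \bar R, measurable_fun setT f -> (forall x, 0 <= f x)%E ->
    (\int[(plane_measure \x plane_measure)%E]_z f (T z)
     = \int[(plane_measure \x plane_measure)%E]_z f z)%E.

Lemma preserves_volume_comp T U : preserves_volume T -> preserves_volume U ->
  preserves_volume (T \o U).
Proof.
move=> [mT iT] [mU iU]; split=> [|f mf f0]; first exact: measurableT_comp.
rewrite -(iT f mf f0); apply: (iU (f \o T)) => [|x]; last exact: f0.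
exact: measurableT_comp.
Qed.

Lemma preserves_volume_outer (U : plane -> plane) : measurable_fun setT U ->
  (forall f : plane -> \bar R, measurable_fun setT f -> (forall x, 0 <= f x)%E ->
    (\int[mu2]_z f (U z) = \int[mu2]_z f z)%E) ->
  preserves_volume (fun z => (U z.1, z.2)).
Proof.
move=> mU iU; split=> [|f mf f0]; first exact: measurable_fun_pairl.
exact: (ge0_integral_pairl (m1 := plane_measure)).
Qed.

Lemma preserves_volume_inner (U : plane -> plane) : measurable_fun setT U ->
  (forall f : plane -> \bar R, measurable_fun setT f -> (forall x, 0 <= f x)%E ->
    (\int[mu2]_z f (U z) = \int[mu2]_z f z)%E) ->
  preserves_volume (fun z => (z.1, U z.2)).
Proof.
move=> mU iU; split=> [|f mf f0]; first exact: measurable_fun_pairr.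
exact: (ge0_integral_pairr plane_measure (m2 := plane_measure)).
Qed.

Lemma measurable_proj (z : space -> mR) : 
  z = (fun z => z.1.1) \/ z = (fun z => z.1.2) \/ z = (fun z => z.2.1) \/
  z = (fun z => z.2.2) -> measurable_fun setT z.
Proof.
by case=> [->|[->|[->|->]]]; apply: measurableT_comp.
Qed.

(** For fixed x_0 the integral over x_3 is a nonnegative measurable function of (x_1, x_2), and
    Tonelli exchanges these two variables. *)
Lemma preserves_volume_swap12 :
  preserves_volume (fun z => ((z.1.1, z.2.1), (z.1.2, z.2.2))).
Proof.
have mT : measurable_fun setT
    (fun z : space => ((z.1.1, z.2.1), (z.1.2, z.2.2)) : space).
  by apply/measurable_fun_pairP; split; apply/measurable_fun_pairP; split;
    apply: measurable_proj; tauto.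
split=> // f mf f0; rewrite (ge0_integral_R4 mf f0).
rewrite (ge0_integral_R4 (measurableT_comp mf mT) (fun z => f0 _)).
apply: eq_integral => x0 _ /=.
pose g (z : plane) := (\int[mu]_x3 f ((x0, z.1), (z.2, x3)))%E.
have mg : measurable_fun setT g.
  apply: (@measurable_fun_fubini_tonelli_F _ _ plane mR R mu
    (fun w => f ((x0, w.1.1), (w.1.2, w.2)))) => //.
  exact: (measurableT_comp mf (measurable_fun_section4 x0)).
have g0 z : (0 <= g z)%E by apply: integral_ge0.
exact/esym/(fubini_tonelli g mg g0).
Qed.

Lemma preserves_volume_swap23 :
  preserves_volume (fun z => (z.1, (z.2.2, z.2.1))).
Proof.
apply: (@preserves_volume_inner (fun z => (z.2, z.1))); first exact: measurable_swap.
exact: ge0_integral_swap.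
Qed.

Lemma preserves_volume_rot01 (c s : R) : c ^+ 2 + s ^+ 2 = 1 -> s != 0 ->
  preserves_volume
    (fun z => ((c * z.1.1 - s * z.1.2, s * z.1.1 + c * z.1.2), z.2)).
Proof.
move=> cs s0; apply: (@preserves_volume_outer
  (fun z => (c * z.1 - s * z.2, s * z.1 + c * z.2))).
  exact: measurable_plane_rot.
by move=> f mf f0; exact: ge0_integral_rot.
Qed.

Lemma preserves_volume_rot23 (c s : R) : c ^+ 2 + s ^+ 2 = 1 -> s != 0 ->
  preserves_volume
    (fun z => (z.1, (c * z.2.1 - s * z.2.2, s * z.2.1 + c * z.2.2))).
Proof.
move=> cs s0; apply: (@preserves_volume_inner
  (fun z => (c * z.1 - s * z.2, s * z.1 + c * z.2))).
  exact: measurable_plane_rot.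
by move=> f mf f0; exact: ge0_integral_rot.
Qed.

(* The quaternion product x * (c + s X_k). *)
Definition rmul_exp (k : 'I_3) (c s : R) (z : space) : space :=
  let: ((x0, x1), (x2, x3)) := z in
  match val k with
  | 0%N => ((c * x0 - s * x1, s * x0 + c * x1), (c * x2 + s * x3, c * x3 - s * x2))
  | 1%N => ((c * x0 - s * x2, c * x1 - s * x3), (s * x0 + c * x2, s * x1 + c * x3))
  | _ => ((c * x0 - s * x3, c * x1 + s * x2), (c * x2 - s * x1, s * x0 + c * x3))
  end.

(** Right multiplication by c + s X_k is a rotation in the plane of the coordinates 0 and k + 1
    together with a rotation by the same or the opposite angle in the complementary plane; permuting
    coordinates reduces all cases to the planes 01 and 23. *)
Lemma preserves_volume_rmul_exp (k : 'I_3) (c s : R) :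
  c ^+ 2 + s ^+ 2 = 1 -> s != 0 -> preserves_volume (rmul_exp k c s).
Proof.
move=> cs s0; have cs' : c ^+ 2 + (- s) ^+ 2 = 1 by rewrite sqrrN.
have s0' : - s != 0 by rewrite oppr_eq0.
have p01 := preserves_volume_rot01 cs s0.
have p23 := preserves_volume_rot23 cs s0.
have p23' := preserves_volume_rot23 cs' s0'.
have s12 := preserves_volume_swap12; have s23 := preserves_volume_swap23.
pose PC := preserves_volume_comp.
have [k0|[k1|k2]] : val k = 0%N \/ val k = 1%N \/ val k = 2%N.
  by case: k => [[|[|[|//]]] ?]; tauto.
- have := PC _ _ p01 p23'; congr preserves_volume; apply/funext.
  move=> -[[x0 x1] [x2 x3]]; rewrite /rmul_exp k0 /= !mulNr opprK.
  by rewrite [- _ + _]addrC.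
- have := PC _ _ s12 (PC _ _ (PC _ _ p01 p23) s12); congr preserves_volume.
  by apply/funext => -[[x0 x1] [x2 x3]]; rewrite /rmul_exp k1.
- have := PC _ _ (PC _ _ s23 s12) (PC _ _ (PC _ _ p01 p23') (PC _ _ s12 s23)).
  congr preserves_volume; apply/funext => -[[x0 x1] [x2 x3]].
  by rewrite /rmul_exp k2 /= !mulNr opprK [- _ + _]addrC.
Qed.

End lebesgue_R4.

(** * The topology of SU(2) *)

Section su2_topology.
Context {R : realType}.
Notation SU := (SU2 R).

Lemma Re_le_norm (x : R[i]) : `|complex.Re x|%:C <= `|x|.
Proof.
by case: x => a b; rewrite lecR -sqrtr_sqr ler_sqrt ?addr_ge0 ?sqr_ge0//= lerDl sqr_ge0.
Qed.

Lemma Im_le_norm (x : R[i]) : `|complex.Im x|%:C <= `|x|.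
Proof.
by case: x => a b; rewrite lecR -sqrtr_sqr ler_sqrt ?addr_ge0 ?sqr_ge0//= lerDr sqr_ge0.
Qed.

Lemma norm_le_ReIm (x : R[i]) : `|x| <= (`|complex.Re x| + `|complex.Im x|)%:C.
Proof.
case: x => a b; rewrite normc_def lecR /=.
have ab0 : 0 <= `|a| + `|b| by rewrite addr_ge0.
rewrite -[leRHS]ger0_norm// -sqrtr_sqr ler_sqrt ?sqr_ge0// sqrrD !real_normK ?num_real//.
by rewrite addrAC lerDl mulrn_wge0// mulr_ge0.
Qed.

Lemma nbhs_complexP (x : R[i]^o) (A : set R[i]^o) : nbhs x A <->
  exists2 e : R, 0 < e & forall y : R[i],
    `|complex.Re y - complex.Re x| < e -> `|complex.Im y - complex.Im x| < e -> A y.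
Proof.
split.
  case/nbhs_ballP => e /= e0 xeA.
  have eE : e = (complex.Re e)%:C by rewrite RRe_real ?gtr0_real.
  have e0' : 0 < complex.Re e by move: e0; rewrite eE ltcR.
  exists (complex.Re e / 2); first by rewrite divr_gt0.
  move=> y yr yi; apply: xeA; rewrite -ball_normE /= eE.
  apply: (le_lt_trans (norm_le_ReIm _)).
  have -> : complex.Re (x - y) = complex.Re x - complex.Re y by rewrite raddfB.
  have -> : complex.Im (x - y) = complex.Im x - complex.Im y by rewrite raddfB.
  rewrite ltcR distrC [X in _ + X]distrC; lra.
case=> e e0 h; apply/nbhs_ballP; exists e%:C => /=; first by rewrite ltcR.
move=> y; rewrite -ball_normE /= distrC => xy; apply: h.
  by rewrite -raddfB /= -ltcR; exact: le_lt_trans (Re_le_norm _) xy.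
by rewrite -raddfB /= -ltcR; exact: le_lt_trans (Im_le_norm _) xy.
Qed.

Lemma cvg_complexP (T : topologicalType) (f : T -> R[i]^o) (t : T) :
  (f x @[x --> t] --> f t) <->
  (complex.Re (f x) @[x --> t] --> complex.Re (f t)) /\
  (complex.Im (f x) @[x --> t] --> complex.Im (f t)).
Proof.
split=> [ft|[fr fi] A].
  split; apply/cvgrPdist_lt => e e0.
    apply: (ft [set y | `|complex.Re (f t) - complex.Re y| < e]).
    by apply/nbhs_complexP; exists e => //= y; rewrite distrC.
  apply: (ft [set y | `|complex.Im (f t) - complex.Im y| < e]).
  by apply/nbhs_complexP; exists e => //= y _; rewrite distrC.
case/nbhs_complexP => e e0 h.
move/cvgrPdist_lt/(_ e e0) : fr => fr; move/cvgrPdist_lt/(_ e e0) : fi => fi.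
near=> x; apply: h; rewrite distrC; near: x; [exact: fr|exact: fi].
Unshelve. all: by end_near. Qed.

Lemma cvg_mxP (T : topologicalType) (U : ptopologicalType) m n (f : T -> 'M[U]_(m, n))
    (t : T) : (f x @[x --> t] --> f t) <->
  (forall i j, f x i j @[x --> t] --> f t i j).
Proof.
split=> [ft i j A Ax|h A [P Px PA]].
  apply: (ft [set M | A (M i j)]).
  exists (fun k l => if (k == i) && (l == j) then A else setT) => [k l|M /(_ i j)].
    by case: ifP => [/andP[/eqP -> /eqP ->]//|_]; exact: filterT.
  by rewrite !eqxx.
have : \forall x \near t, forall ij : 'I_m * 'I_n, P ij.1 ij.2 (f x ij.1 ij.2).
  by apply: filter_forall => -[i j] /=; exact: (h i j _ (Px i j)).
by apply: filterS => x hx; apply: PA => i j; exact: (hx (i, j)).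
Qed.

Lemma ord2P (i : 'I_2) : i = 0 \/ i = 1.
Proof. by case: i => [[|[|//]] ?]; [left|right]; exact/val_inj. Qed.

(** Every index from 3 on denotes the fourth coordinate, so that statements about all [k] can be
    made without a bound. *)
Definition qcoord (k : nat) (g : SU) : R :=
  match k with
  | 0 => complex.Re (val g 0 0) | 1 => complex.Im (val g 0 0)
  | 2 => complex.Re (val g 0 1) | _ => complex.Im (val g 0 1)
  end.

(** Unitarity and determinant 1 identify the conjugate transpose with the adjugate, since both
    invert [g]; this expresses the second row through the first. *)
Lemma val_su2 (g : SU) :
  val g = quat (qcoord 0 g) (qcoord 1 g) (qcoord 2 g) (qcoord 3 g).
Proof.
case: g => g gP; rewrite /qcoord /=; move: (gP) => /andP[/eqP gU /eqP gD].
have gA : g *m (\adj g) = 1%:M by rewrite mul_mx_adj gD.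
have gH : (map_mx (@conjc R) g)^T = \adj g.
  have gu : g \in unitmx by rewrite unitmxE gD unitr1.
  by rewrite -[LHS](mulKmx gu) gU -gA mulKmx.
have e i j : (g j i)^* = \adj g i j by rewrite -gH !mxE.
have g11 := e 0 0; have g10 := e 0 1.
have c00 : cofactor g 0 0 = g 1 1.
  rewrite /cofactor det_mx11 !mxE /= expr0 mul1r; congr (g _ _); exact/val_inj.
have c10 : cofactor g 1 0 = - g 0 1.
  rewrite /cofactor det_mx11 !mxE /= expr1 mulN1r; congr (- g _ _); exact/val_inj.
rewrite [X in _ = X]mxE c00 in g11; rewrite [X in _ = X]mxE c10 in g10.
rewrite quatE; apply/matrixP => i j; rewrite mxE.
have [->|->] := ord2P i.
  have [->|->] := ord2P j.
  - by case: (g 0 0).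
  - by case: (g 0 1).
have [->|->] := ord2P j.
- have := congr1 (@conjc R) g10; rewrite conjcK => ->.
  by case: (g 0 1) => a b /=; rewrite opprK.
- by rewrite /= -g11; case: (g 0 0).
Qed.

Lemma qcoord_sum_sqr (g : SU) :
  qcoord 0 g ^+ 2 + qcoord 1 g ^+ 2 + qcoord 2 g ^+ 2 + qcoord 3 g ^+ 2 = 1.
Proof.
have : \det (val g) = 1 by case: g => g /= /andP[_ /eqP].
rewrite {1}(val_su2 g) quatE (expand_det_row _ 0) !big_ord_recl big_ord0.
rewrite /cofactor !det_mx11 !mxE /= expr0 expr1 => /(congr1 (@complex.Re R)).
by rewrite /qcoord /=; simpc => /= <-; ring.
Qed.
Lemma coord_quat (a b c d : R) (h : is_su2 (quat a b c d)) :
  let g : SU := Sub (quat a b c d) h in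
  [/\ qcoord 0 g = a, qcoord 1 g = b, qcoord 2 g = c & qcoord 3 g = d].
Proof. by rewrite /qcoord /= quatE !mxE. Qed.

Lemma su2_inj (g h : SU) : (forall k, (k < 4)%N -> qcoord k g = qcoord k h) -> g = h.
Proof. by move=> e; apply: val_inj; rewrite val_su2 [RHS]val_su2 !e. Qed.

Lemma abs_qcoord_le1 k g : `|qcoord k g| <= 1.
Proof.
have := qcoord_sum_sqr g; rewrite -[_ <= 1](@ler_sqr _ `|_|) ?nnegrE// real_normK ?num_real// expr1n => <-.
have := (sqr_ge0 (qcoord 0 g), sqr_ge0 (qcoord 1 g), sqr_ge0 (qcoord 2 g), sqr_ge0 (qcoord 3 g)).
by case: k => [|[|[|[|k]]]] [[[]]]; rewrite ?[qcoord k.+4 g]/(qcoord 3 g); lra.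
Qed.

Lemma val_continuous : continuous (fun g : SU => val g : 'M[R[i]^o]_2).
Proof. exact: initial_continuous. Qed.

Lemma su2_coord_continuous k : continuous (qcoord k).
Proof.
move=> g; have /cvg_mxP h := @val_continuous g.
have /cvg_complexP[a0 a1] := h 0 0; have /cvg_complexP[b0 b1] := h 0 1.
by case: k => [|[|[|k]]].
Qed.

Lemma nbhs_su2P (g : SU) (A : set SU) : nbhs g A <->
  exists2 e : R, 0 < e & forall h, (forall k, `|qcoord k h - qcoord k g| < e) -> A h.
Proof.
split=> [gA|[e e0 h]]; last first.
  have c k : \forall x \near g, `|qcoord k x - qcoord k g| < e.
    have /cvgrPdist_lt/(_ e e0) := @su2_coord_continuous k g.
    by apply: filterS => x; rewrite distrC.
  have c3 : \forall x \near g, forall k, `|qcoord k.+3 x - qcoord k.+3 g| < e.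
    by apply: filterS (c 3) => x hx k; exact: hx.
  apply: (filterS _ (filterI (c 0%N) (filterI (c 1%N) (filterI (c 2) c3)))).
  by move=> x [x0 [x1 [x2 x3]]]; apply: h => -[|[|[|k]]].
move: gA; rewrite nbhsE => -[B [[C Cop CB] Bg] BA].
have [P Pg PC] : nbhs (val g : 'M[R[i]^o]_2) C.
  by apply: open_nbhs_nbhs; split=> //; rewrite -CB in Bg.
have ex i j : exists2 e : R, 0 < e & forall y : R[i],
    `|complex.Re y - complex.Re (val g i j)| < e ->
    `|complex.Im y - complex.Im (val g i j)| < e -> P i j y.
  exact/nbhs_complexP/(Pg i j).
have [e00 p00 h00] := ex 0 0; have [e01 p01 h01] := ex 0 1.
have [e10 p10 h10] := ex 1 0; have [e11 p11 h11] := ex 1 1.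
exists (Num.min (Num.min e00 e01) (Num.min e10 e11)); first by rewrite !lt_min p00 p01 p10 p11.
move=> h hh; apply: BA; rewrite -CB; apply: PC => i j.
have h0 := hh 0%N; have h1 := hh 1%N; have h2 := hh 2; have h3 := hh 3.
rewrite !lt_min in h0 h1 h2 h3.
case/andP: h0 => /andP[h0 _] /andP[_ h0']; case/andP: h1 => /andP[h1 _] /andP[_ h1'].
case/andP: h2 => /andP[_ h2] /andP[h2' _]; case/andP: h3 => /andP[_ h3] /andP[h3' _].
have [->|->] := ord2P i; have [->|->] := ord2P j.
- by apply: h00; [exact: h0|exact: h1].
- by apply: h01; [exact: h2|exact: h3].
- apply: h10; rewrite !val_su2 !quatE !mxE /=; last exact: h3'.
  by rewrite -opprD normrN.
- apply: h11; rewrite !val_su2 !quatE !mxE /=; first exact: h0'.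
  by rewrite -opprD normrN.
Qed.

Lemma spinor_continuousP (psi : spinor_fun R) :
  continuous (psi : SU -> 'cV[R[i]^o]_2) <->
  forall j, continuous (fun g => complex.Re (psi g j 0)) /\
            continuous (fun g => complex.Im (psi g j 0)).
Proof.
split=> [h j|h g].
  by split=> g; have /cvg_mxP/(_ j 0)/cvg_complexP[] := h g.
apply/cvg_mxP => i j; rewrite (ord1 j); apply/cvg_complexP.
by have [hr hi] := h i; split; [exact: hr|exact: hi].
Qed.

Lemma su2_of_coords (a b c d : R) : a ^+ 2 + b ^+ 2 + c ^+ 2 + d ^+ 2 = 1 ->
  exists g : SU, [/\ qcoord 0 g = a, qcoord 1 g = b, qcoord 2 g = c & qcoord 3 g = d].
Proof. by move=> /is_su2_quat h; exists (Sub (quat a b c d) h); exact: coord_quat. Qed.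

(** The coordinates push a filter on SU(2) to one containing the unit sphere of R^4, which is closed
    and bounded. A cluster point there is the coordinate vector of a group element, and
    neighbourhoods in SU(2) are given by the coordinates. *)
Lemma su2_compact : compact [set: SU].
Proof.
pose K : set 'rV[R]_4 := [set x | \sum_i x 0 i ^+ 2 = 1].
have Kc : compact K.
  apply: bounded_closed_compact.
    exists 1; split; first exact: num_real.
    move=> M M1 x Kx; apply: (le_trans _ (ltW M1)); rewrite /K /= in Kx.
    rewrite [`|x|]mx_normrE; apply/bigmax_leP; split => //= -[i j] _ /=.
    rewrite -[_ <= 1](@ler_sqr _ `|_|) ?nnegrE// real_normK ?num_real// expr1n -Kx.
    rewrite (ord1 i) (bigD1 j)//= lerDl; apply: sumr_ge0 => k _; exact: sqr_ge0.
  apply: (@closed_comp _ _ (fun x : 'rV[R]_4 => \sum_i x 0 i ^+ 2) [set 1]) => [x _|].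
    have c i : continuous (fun x : 'rV[R]_4 => x 0 i ^+ 2).
      move=> y; have h := @matrix_normedtype.coord_continuous R 1 4 0 i y.
      exact: (cvgM h h).
    rewrite /continuous_at; under eq_fun do rewrite !big_ord_recr big_ord0 /= add0r.
    rewrite !big_ord_recr big_ord0 /= add0r.
    exact: (cvgD (cvgD (cvgD (c _ x) (c _ x)) (c _ x)) (c _ x)).
  exact: closed_eq.
move=> F FF _.
pose G : set_system 'rV[R]_4 := [set A | F [set g | A (\row_(i < 4) qcoord i g)]].
have GF : ProperFilter G.
  exact: (fmap_proper_filter (fun g : SU => \row_(i < 4) qcoord i g) FF).
have GK : G K.
  rewrite /G /=; apply: filterS filterT => g _; rewrite /K /= -(qcoord_sum_sqr g).
  by rewrite !big_ord_recr big_ord0 /= !mxE /= add0r.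
have [x [Kx Gx]] := Kc G GF GK.
move: Kx; rewrite /K /= !big_ord_recr big_ord0 /= add0r => /su2_of_coords[g [g0 g1 g2 g3]].
exists g; split=> // A B FA /nbhs_su2P[e e0 hB].
have [//||y [[h [Ah hy]] Bxy]] := Gx [set y | exists h, A h /\ y = \row_(i < 4) qcoord i h]
   [set y | forall i, `|x 0 i - y 0 i| < e].
- by rewrite /G /=; apply: filterS FA => h Ah; exists h.
- by apply/nbhs_ballP; exists e => //= y [_ hy] i; exact: (hy 0 i).
- exists h; split=> //; apply: hB => k.
  have hh i (i4 : (i < 4)%N) : `|qcoord i h - qcoord i g| < e.
    have := Bxy (Ordinal i4); rewrite hy mxE distrC.
    have <- : x 0 (Ordinal i4) = qcoord i g; last by [].
    case: i i4 => [|[|[|[|//]]]] i4; rewrite ?g0 ?g1 ?g2 ?g3; congr (x 0 _); exact/val_inj.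
  by case: k => [|[|[|k]]]; [exact: hh|exact: hh|exact: hh|exact: (hh 3)].
Qed.

End su2_topology.

(** * The Stone-Weierstrass theorem on SU(2) *)

Section stone_weierstrass.

(** Otherwise the complements of the sets satisfying [P] form a proper filter, and the local
    hypothesis fails at its cluster point. This takes the place of finite subcovers in what
    follows. *)
Lemma compact_induction (T : topologicalType) (P : set T -> Prop) :
  compact [set: T] -> P set0 ->
  (forall U V, U `<=` V -> P V -> P U) ->
  (forall U V, P U -> P V -> P (U `|` V)) ->
  (forall x : T, exists2 U, nbhs x U & P U) -> P setT.
Proof.
move=> Tc P0 PS PU Px; apply: contrapT => nP.
pose F : set_system T := [set A | P (~` A)].
have FF : ProperFilter F.
  split; first by rewrite /F /= setC0.
  split; rewrite /F /=.
  - by rewrite setCT.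
  - by move=> A B PA PB; rewrite /= setCI; exact: PU.
  - by move=> A B AB; apply: PS; exact: subsetC.
have FT : F setT by rewrite /F /= setCT.
have [x [_ Fx]] := Tc F FF FT.
have [U xU PU'] := Px x.
have FU : F (~` U) by rewrite /F /= setCK.
by have [y []] := Fx _ _ FU xU.
Qed.

Context {R : realType}.
Notation SU := (SU2 R).

Inductive rpoly : (SU -> R) -> Prop :=
| rpoly_coord k : rpoly (qcoord k)
| rpoly_cst a : rpoly (fun=> a)
| rpolyD f g : rpoly f -> rpoly g -> rpoly (fun x => f x + g x)
| rpolyM f g : rpoly f -> rpoly g -> rpoly (fun x => f x * g x).

Lemma continuous_csts (a : R) : continuous (fun _ : SU => a).
Proof. exact: cst_continuous. Qed.

Lemma continuousDs (f g : SU -> R) : continuous f -> continuous g ->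
  continuous (fun x => f x + g x).
Proof.
by move=> cf cg x; exact: (@cvgD _ R^o _ _ (nbhs_filter x) f g _ _ (cf x) (cg x)).
Qed.

Lemma continuousMs (f g : SU -> R) : continuous f -> continuous g ->
  continuous (fun x => f x * g x).
Proof.
by move=> cf cg x; exact: (@cvgM _ _ _ (nbhs_filter x) f g _ _ (cf x) (cg x)).
Qed.

Lemma continuousBs (f g : SU -> R) : continuous f -> continuous g ->
  continuous (fun x => f x - g x).
Proof.
by move=> cf cg x; exact: (@cvgB _ R^o _ _ (nbhs_filter x) f g _ _ (cf x) (cg x)).
Qed.

Lemma rpoly_continuous f : rpoly f -> continuous f.
Proof.
elim=> [k|a|p q _ cp _ cq|p q _ cp _ cq].
- exact: su2_coord_continuous.
- exact: continuous_csts.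
- exact: continuousDs.
- exact: continuousMs.
Qed.

Lemma su2_continuous_near (f : SU -> R) g (e : R) : continuous f -> 0 < e ->
  nbhs g [set h | `|f g - f h| < e].
Proof.
by move=> cf e0; move: (cf g); rewrite /continuous_at => /(@cvgrPdist_lt _ R^o _ _ (nbhs_filter g)); exact.
Qed.

Lemma su2_bounded (f : SU -> R) : continuous f ->
  exists2 M : R, 0 < M & forall g, `|f g| <= M.
Proof.
move=> cf; pose P (U : set SU) := exists2 M : R, 0 < M & forall g, U g -> `|f g| <= M.
have [||||M M0 fM] := compact_induction (P := P) su2_compact.
- by exists 1.
- by move=> U V UV [M M0 h]; exists M => // g /UV; exact: h.
- move=> U V [M M0 hM] [N N0 hN]; exists (M + N) => [|g [/hM|/hN]]; first exact: addr_gt0.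
    by move=> /le_trans; apply; rewrite lerDl ltW.
  by move=> /le_trans; apply; rewrite lerDr ltW.
- move=> x; exists [set h | `|f x - f h| < 1]; first exact: su2_continuous_near.
  exists (`|f x| + 1) => [|g /= h]; first by rewrite ltr_wpDl.
  rewrite -[f g](subKr (f x)); apply: (le_trans (ler_normB _ _)).
  by rewrite lerD2l ltW.
- by exists M => // g; exact: fM.
Qed.

Definition approximable (f : SU -> R) :=
  forall e : R, 0 < e -> exists2 p, rpoly p & forall g, `|f g - p g| < e.

Lemma approximable_poly p : rpoly p -> approximable p.
Proof. by move=> rp e e0; exists p => // g; rewrite subrr normr0. Qed.

Lemma approximable_lim f : (forall e : R, 0 < e ->
  exists2 h, approximable h & forall g, `|f g - h g| < e) -> approximable f.
Proof.
move=> hf e e0; have e20 : 0 < e / 2 by rewrite divr_gt0.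
have [h ah fh] := hf _ e20; have [p rp hp] := ah _ e20; exists p => // g.
have -> : f g - p g = (f g - h g) + (h g - p g) by ring.
rewrite [e]splitr; apply: (le_lt_trans (ler_normD _ _)); exact: ltrD.
Qed.

Lemma approximable_ext f g : f =1 g -> approximable f -> approximable g.
Proof. by move=> /funext ->. Qed.

Lemma approximableD f g : approximable f -> approximable g ->
  approximable (fun x => f x + g x).
Proof.
move=> af ag e e0; have e20 : 0 < e / 2 by rewrite divr_gt0.
have [p rp fp] := af _ e20; have [q rq gq] := ag _ e20.
exists (fun x => p x + q x) => [|x]; first exact: rpolyD.
have -> : f x + g x - (p x + q x) = (f x - p x) + (g x - q x) by ring.
rewrite [e]splitr; apply: (le_lt_trans (ler_normD _ _)); exact: ltrD.
Qed.

Lemma approximable_bounded f : approximable f ->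
  exists2 M : R, 0 < M & forall g, `|f g| <= M.
Proof.
move=> /(_ 1 ltr01)[p /rpoly_continuous /su2_bounded[M M0 pM] fp].
exists (M + 1) => [|g]; first by rewrite addr_gt0.
rewrite -[f g](subrK (p g)) addrC; apply: (le_trans (ler_normD _ _)).
by apply: lerD => //; exact: ltW.
Qed.

Lemma approximableM f g : approximable f -> approximable g ->
  approximable (fun x => f x * g x).
Proof.
move=> af ag; have [M M0 fM] := approximable_bounded af.
have [N N0 gN] := approximable_bounded ag => e e0.
(* The error is at most d N + M d + d; the last term bounds the product of the two errors by d
   because d <= 1. *)
pose d := Num.min 1 (e / (M + N + 1)).
have MN0 : 0 < M + N + 1 by rewrite !addr_gt0.
have d0 : 0 < d by rewrite /d lt_min ltr01 divr_gt0.
have [p rp fp] := af _ d0; have [q rq gq] := ag _ d0.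
exists (fun x => p x * q x) => [|x]; first exact: rpolyM.
have -> : f x * g x - p x * q x
  = (f x - p x) * g x + f x * (g x - q x) - (f x - p x) * (g x - q x) by ring.
apply: (@le_lt_trans _ _ (`|f x - p x| * N + M * `|g x - q x| + `|f x - p x|)).
  apply: (le_trans (ler_normB _ _)); apply: lerD.
    apply: (le_trans (ler_normD _ _)); rewrite !normrM; apply: lerD.
      exact: ler_wpM2l.
    exact: ler_wpM2r.
  rewrite normrM ler_piMr// ltW//; apply: (lt_le_trans (gq x)).
  by rewrite /d ge_min lexx.
have -> : e = (e / (M + N + 1)) * (M + N + 1) by rewrite divfK// gt_eqF.
have de : d <= e / (M + N + 1) by rewrite /d ge_min lexx orbT.
apply: (@lt_le_trans _ _ (d * (M + N + 1))); last by rewrite ler_pM2r.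
rewrite !mulrDr mulr1; apply: ltr_leD; last exact: ltW.
rewrite addrC [M * _]mulrC; apply: ltr_leD; first by rewrite ltr_pM2r.
by rewrite ler_pM2r// ltW.
Qed.

Lemma approximable_cst (a : R) : approximable (fun=> a).
Proof. exact/approximable_poly/rpoly_cst. Qed.

Lemma approximableZ a f : approximable f -> approximable (fun x => a * f x).
Proof. by move=> af; exact: approximableM (approximable_cst a) af. Qed.

(* Newton-like iteration q <- q + (t^2 - q^2)/2, increasing to |t| on [-1, 1]. *)
Fixpoint abs_iter (n : nat) (t : R) : R :=
  if n is m.+1 then abs_iter m t + (t ^+ 2 - abs_iter m t ^+ 2) / 2 else 0.

(** With s = |t| and q the current iterate, s - (q + (s^2 - q^2)/2) = (s - q)(1 - (s + q)/2), and
    the last factor is at most 1 - s/2. *)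
Lemma abs_iterP n (t : R) : `|t| <= 1 ->
  0 <= abs_iter n t <= `|t| /\ `|t| - abs_iter n t <= `|t| * (1 - `|t| / 2) ^+ n.
Proof.
move=> t1; have t0 := normr_ge0 t.
have t2 : t ^+ 2 = `|t| ^+ 2 by rewrite real_normK ?num_real.
elim: n => [|n [/andP[IH0 IH1] IH]] /=.
  by rewrite lexx t0 subr0 expr0 mulr1.
rewrite t2; set q := abs_iter n t in IH0 IH1 IH *; set s := `|t| in t1 t0 IH1 IH *.
split.
  apply/andP; split; first by nra.
  have : 0 <= (s - q) * (2 - s - q) by apply: mulr_ge0; lra.
  nra.
have -> : s - (q + (s ^+ 2 - q ^+ 2) / 2) = (s - q) * (1 - (s + q) / 2) by field.
apply: (@le_trans _ _ ((s - q) * (1 - s / 2))).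
  by apply: ler_wpM2l; lra.
by rewrite exprSr mulrA; apply: ler_wpM2r => //; lra.
Qed.

(** The rate 1 - s/2 degenerates as s tends to 0, but the Bernoulli-type inequality (1 - y)^n (1 + n
    y) <= 1 with y = s/2 makes the error at most 2/n uniformly in s. *)
Lemma mul_exp_le (s : R) n : 0 <= s <= 1 -> s * (1 - s / 2) ^+ n * n%:R <= 2.
Proof.
move=> /andP[s0 s1]; set y := s / 2.
have y0 : 0 <= y by rewrite divr_ge0.
have y1 : y <= 1 / 2 by rewrite /y ler_pM2r.
have b : (1 - y) ^+ n * (1 + n%:R * y) <= 1.
  elim: n => [|n IH]; first by rewrite expr0 mul0r addr0 mulr1.
  apply: le_trans IH; rewrite exprSr -mulrA ler_wpM2l ?exprn_ge0//; first by lra.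
  have n0 : 0 <= n%:R :> R by [].
  rewrite -natr1; nra.
have -> : s = 2 * y by rewrite /y; field.
have p0 : 0 <= (1 - y) ^+ n by rewrite exprn_ge0//; lra.
by nra.
Qed.

(** Scaled into [-1, 1], [f] is fed into [abs_iter], whose iterates are polynomials in their
    argument; more than 2/e iterations give accuracy e. *)
Lemma approximable_abs f : approximable f -> approximable (fun x => `|f x|).
Proof.
move=> af; have [M M0 fM] := approximable_bounded af.
pose h x := M^-1 * f x.
have ah : approximable h by exact: approximableZ.
have h1 x : `|h x| <= 1.
  by rewrite /h normrM gtr0_norm ?invr_gt0// mulrC ler_pdivrMr// mul1r.
suff : approximable (fun x => `|h x|).
  move/(approximableZ M); apply: approximable_ext => x.
  by rewrite /h normrM gtr0_norm ?invr_gt0// mulrA divff ?mul1r// gt_eqF.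
apply: approximable_lim => e e0.
pose n := (Num.trunc (2 / e)).+1.
exists (fun x => abs_iter n (h x)).
  elim: n => [|n IH] /=; first exact: approximable_cst.
  apply: approximableD => //; under eq_fun do rewrite mulrC.
  apply: approximableZ; apply: approximableD; first exact: (approximableM ah ah).
  under eq_fun do rewrite -mulN1r.
  exact: approximableZ (approximableM IH IH).
move=> x; have [/andP[q0 q1] q2] := abs_iterP n (h1 x).
rewrite ger0_norm ?subr_ge0//; apply: (le_lt_trans q2).
have n0 : (0 : R) < n%:R by rewrite ltr0n.
rewrite -(ltr_pM2r n0); apply: (@le_lt_trans _ _ 2).
  by apply: mul_exp_le; rewrite normr_ge0 h1.
rewrite mulrC -ltr_pdivrMr//; apply: truncnS_gt.
Qed.

Lemma approximable_max f g : approximable f -> approximable g ->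
  approximable (fun x => Num.max (f x) (g x)).
Proof.
move=> af ag; under eq_fun do rewrite maxr_absE mulrC.
apply: approximableZ; apply: approximableD; first exact: approximableD.
apply: approximable_abs; apply: approximableD => //.
by under eq_fun do rewrite -mulN1r; exact: approximableZ.
Qed.

Lemma approximable_min f g : approximable f -> approximable g ->
  approximable (fun x => Num.min (f x) (g x)).
Proof.
move=> af ag; under eq_fun do rewrite minr_absE mulrC.
apply: approximableZ; apply: approximableD; first exact: approximableD.
under eq_fun do rewrite -mulN1r; apply: approximableZ.
apply: approximable_abs; apply: approximableD => //.
by under eq_fun do rewrite -mulN1r; exact: approximableZ.
Qed.

Lemma approximable_continuous_near f g (e : R) : approximable f -> 0 < e ->
  nbhs g [set h | `|f g - f h| < e].
Proof.
move=> af e0; have e30 : 0 < e / 3 by rewrite divr_gt0.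
have [p rp fp] := af _ e30.
have := su2_continuous_near g (rpoly_continuous rp) e30.
apply: filterS => h /= ph.
have -> : f g - f h = (f g - p g) + (p g - p h) - (f h - p h) by ring.
have -> : e = e / 3 + e / 3 + e / 3 by field.
apply: (le_lt_trans (ler_normB _ _)); apply: ltrD => //.
by apply: (le_lt_trans (ler_normD _ _)); apply: ltrD.
Qed.

(** Distinct points are separated by some coordinate, and an affine function of it takes the two
    values. *)
Lemma approximable_interp (x y : SU) (a b : R) : (x = y -> a = b) ->
  exists2 h, approximable h & h x = a /\ h y = b.
Proof.
move=> ab; have [xy|xy] := pselect (x = y).
  by exists (fun=> a); [exact: approximable_cst|split=> //; exact: ab].
have [k kxy] : exists k, qcoord k x != qcoord k y.
  apply: contrapT => nk; apply: xy; apply: su2_inj => k _.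
  by apply/eqP/negP => /negP kxy; apply: nk; exists k.
have d0 : qcoord k y - qcoord k x != 0 by rewrite subr_eq0 eq_sym.
exists (fun z => a + (b - a) / (qcoord k y - qcoord k x) * (qcoord k z - qcoord k x)).
  apply: approximableD; first exact: approximable_cst.
  apply: approximableZ; apply: approximableD; last exact: approximable_cst.
  exact/approximable_poly/rpoly_coord.
by rewrite subrr mulr0 addr0 divfK// addrC subrK.
Qed.

(** The lattice proof: for fixed x, a minimum over finitely many y of interpolating functions stays
    below f + e and agrees with f at x; a maximum of such functions over finitely many x is also
    above f - e. *)
Lemma stone_weierstrass (f : SU -> R) : continuous f -> approximable f.
Proof.
move=> cf; apply: approximable_lim => e e0.
have e20 : 0 < e / 2 by rewrite divr_gt0.
have step1 x : exists2 h, approximable h & h x = f x /\ forall z, h z < f z + e.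
  pose P (U : set SU) := exists2 h, approximable h &
    h x = f x /\ forall z, U z -> h z < f z + e.
  have [||||h ah [hx hz]] := compact_induction (P := P) su2_compact.
  - by exists (fun=> f x); [exact: approximable_cst|].
  - by move=> U V UV [h ah [hx hz]]; exists h => //; split=> // z /UV; exact: hz.
  - move=> U V [h ah [hx hz]] [k ak [kx kz]].
    exists (fun z => Num.min (h z) (k z)); first exact: approximable_min.
    split=> [|z [/hz|/kz] h1]; first by rewrite hx kx minxx.
      by rewrite gt_min h1.
    by rewrite gt_min h1 orbT.
  - move=> y; have [h ah [hx hy]] := @approximable_interp x y (f x) (f y) (@congr1 _ _ f x y).
    exists ([set z | `|h y - h z| < e / 2] `&` [set z | `|f y - f z| < e / 2]).
      apply: filterI; first exact: approximable_continuous_near.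
      exact: su2_continuous_near.
    exists h => //; split=> // z /= [h1 f1]; rewrite hy in h1.
    move: h1 f1; rewrite !ltr_norml => /andP[h1 _] /andP[_ f1]; lra.
  by exists h => //; split=> // z; exact: hz.
pose P (U : set SU) := exists2 h, approximable h &
  (forall z, h z < f z + e) /\ forall z, U z -> f z - e < h z.
have [||||h ah [h1 h2]] := compact_induction (P := P) su2_compact.
(* The empty set asks only for some function below f + e; the unit element is an arbitrary base
   point. *)
- have [h ah [_ h1]] := step1 (oneSU R); by exists h.
- by move=> U V UV [h ah [hx hz]]; exists h => //; split=> // z /UV; exact: hz.
- move=> U V [h ah [h1 h2]] [k ak [k1 k2]].
  exists (fun z => Num.max (h z) (k z)); first exact: approximable_max.
  split=> [z|z [/h2|/k2] h3]; first by rewrite gt_max h1 k1.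
    by rewrite lt_max h3.
  by rewrite lt_max h3 orbT.
- move=> y; have [h ah [hy h1]] := step1 y.
  exists ([set z | `|h y - h z| < e / 2] `&` [set z | `|f y - f z| < e / 2]).
    apply: filterI; first exact: approximable_continuous_near.
    exact: su2_continuous_near.
  exists h => //; split=> // z /= [h2 f1]; rewrite hy in h2.
  move: h2 f1; rewrite !ltr_norml => /andP[_ h2] /andP[f1 _]; lra.
exists h => // g; have := h1 g; have := h2 g I.
by rewrite ltr_norml => ? ?; apply/andP; split; lra.
Qed.

End stone_weierstrass.

(** * Integration over SU(2) *)

Lemma measurable_EFinS d (T : measurableType d) (R : realType) (D : set T)
    (h : T -> R) : measurable_fun setT h -> measurable_fun D (fun x => (h x)%:E).
Proof. by move=> mh; apply/measurable_EFinP; exact: measurable_funTS. Qed.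

Lemma measurable_EFin_restrict d (T : measurableType d) (R : realType) (D : set T)
    (h : T -> R) : measurable D -> measurable_fun setT h ->
  measurable_fun setT ((EFin \o h) \_ D).
Proof.
move=> mD mh; apply/(measurable_restrictT _ mD).
by apply/measurable_EFinP; exact: measurable_funTS.
Qed.

Section su2_integral.
Context {R : realType}.
Notation SU := (SU2 R).
Notation mu := (@lebesgue_measure R).
Notation mR := (measurableTypeR R).
Notation space := ((mR * mR) * (mR * mR))%type.
Notation mu4 := (plane_measure \x plane_measure)%E.

Definition sqnorm4 (z : space) : R :=
  z.1.1 ^+ 2 + z.1.2 ^+ 2 + z.2.1 ^+ 2 + z.2.2 ^+ 2.

Definition radial4 (z : space) : SU := radial z.1.1 z.1.2 z.2.1 z.2.2.

Definition proj4 (k : nat) (z : space) : R :=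
  match k with 0 => z.1.1 | 1 => z.1.2 | 2 => z.2.1 | _ => z.2.2 end.

Lemma measurable_proj4 k : measurable_fun setT (proj4 k : space -> mR).
Proof. by apply: measurable_proj; case: k => [|[|[|k]]]; tauto. Qed.

Lemma sqnorm4_ge0 z : 0 <= sqnorm4 z.
Proof. by rewrite /sqnorm4 !addr_ge0 ?sqr_ge0. Qed.

Lemma sqnorm4E z : sqnorm4 z =
  proj4 0 z ^+ 2 + proj4 1 z ^+ 2 + proj4 2 z ^+ 2 + proj4 3 z ^+ 2.
Proof. by []. Qed.

Lemma sqnorm4_eq0 z : sqnorm4 z = 0 -> forall k, proj4 k z = 0.
Proof.
rewrite /sqnorm4 => h k; apply/eqP; rewrite -sqrf_eq0; apply/eqP.
have := (sqr_ge0 (z.1.1 : R), sqr_ge0 (z.1.2 : R), sqr_ge0 (z.2.1 : R), sqr_ge0 (z.2.2 : R)).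
by case: k => [|[|[|k]]] [[[]]] /=; lra.
Qed.

Lemma measurable_sqnorm4 : measurable_fun setT (sqnorm4 : space -> mR).
Proof.
have m k : measurable_fun setT (fun z : space => proj4 k z ^+ 2 : mR).
  by apply: measurable_funM; exact: measurable_proj4.
by apply: measurable_funD; [apply: measurable_funD; [apply: measurable_funD|]|];
  [exact: (m 0%N)|exact: (m 1%N)|exact: (m 2)|exact: (m 3)].
Qed.

Lemma su2_radial (a b c d : R) :
  let r := Num.sqrt (a ^+ 2 + b ^+ 2 + c ^+ 2 + d ^+ 2) in
  0 < a ^+ 2 + b ^+ 2 + c ^+ 2 + d ^+ 2 ->
  val (radial a b c d) = quat (a / r) (b / r) (c / r) (d / r).
Proof.
move=> r n0; rewrite /radial -/r val_insubd is_su2_quat//.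
have r2 : r ^+ 2 = a ^+ 2 + b ^+ 2 + c ^+ 2 + d ^+ 2 by rewrite sqr_sqrtr ?ltW.
by rewrite !expr_div_n -!mulrDl -r2 divff// r2 gt_eqF.
Qed.

Lemma qcoord_val (g : SU) (a b c d : R) : val g = quat a b c d ->
  [/\ qcoord 0 g = a, qcoord 1 g = b, qcoord 2 g = c & qcoord 3 g = d].
Proof. by rewrite /qcoord quatE => ->; rewrite !mxE. Qed.

Lemma qcoord_radial4 k z : 0 < sqnorm4 z ->
  qcoord k (radial4 z) = proj4 k z / Num.sqrt (sqnorm4 z).
Proof.
move=> /su2_radial/qcoord_val[h0 h1 h2 h3].
by case: k => [|[|[|k]]]; [exact: h0|exact: h1|exact: h2|exact: h3].
Qed.

(** Division by 0 gives 0, so the quaternion is 0; it does not lie in SU(2) and [insubd] returns its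
    default. *)
Lemma radial4_0 z : sqnorm4 z = 0 -> radial4 z = oneSU R.
Proof.
move=> z0; have := sqnorm4_eq0 z0 => h; rewrite /radial4 /radial.
have := (h 0%N, h 1%N, h 2, h 3) => -[[[]]] /= -> -> -> ->.
apply: val_inj; rewrite val_insubd !mul0r; case: ifP => //.
rewrite /is_su2 quatE => /andP[_ /eqP].
rewrite (expand_det_row _ 0) !big_ord_recl big_ord0 !mxE /= oppr0.
by rewrite complexr0 !mul0r !addr0 => /eqP; rewrite eq_sym oner_eq0.
Qed.

Lemma measurable_rpoly_radial p : rpoly p -> measurable_fun setT (p \o radial4 : space -> mR).
Proof.
elim=> [k|a|f g _ mf _ mg|f g _ mf _ mg]; last 2 first.
- exact: measurable_funD.
- exact: measurable_funM.
(* At the origin the value is that of the default element; elsewhere 1 / sqrt N is written as a real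
   power, whose measurability is available. *)
- rewrite (_ : _ \o _ = fun z => if sqnorm4 z == 0 then qcoord k (oneSU R) else
      proj4 k z * (sqnorm4 z `^ 2^-1) `^ (-1)).
    apply: measurable_fun_ifT.
    - apply: (measurable_fun_bool true); rewrite setTI.
      rewrite (_ : _ @^-1` _ = sqnorm4 @^-1` [set 0]); last first.
        by apply/seteqP; split=> z /eqP.
      by rewrite -[X in measurable X]setTI; exact: measurable_sqnorm4.
    - exact: measurable_cst.
    - apply: measurable_funM; first exact: measurable_proj4.
      by do 2 (apply: (measurableT_comp (measurable_powR _))); exact: measurable_sqnorm4.
  apply/funext => z /=; case: eqP => [/radial4_0 -> //|/eqP z0].
  rewrite powR12_sqrt ?sqnorm4_ge0// powR_inv1 ?sqrtr_ge0//.
  by rewrite qcoord_radial4// lt_neqAle eq_sym z0 sqnorm4_ge0.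
- exact: measurable_cst.
Qed.

(** By Stone-Weierstrass [f] is a pointwise limit of polynomials, for which measurability is
    explicit. *)
Lemma measurable_radial f : continuous f -> measurable_fun setT (f \o radial4 : space -> mR).
Proof.
move=> /stone_weierstrass af.
have h n : exists p, rpoly p /\ forall g, `|f g - p g| < n.+1%:R^-1.
  by have [|p rp fp] := af n.+1%:R^-1; [rewrite invr_gt0|exists p].
pose p n := projT1 (cid (h n)).
have rp n : rpoly (p n) by rewrite /p; case: cid => q [].
have fp n g : `|f g - p n g| < n.+1%:R^-1 by rewrite /p; case: cid => q [].
apply: (@measurable_fun_cvg _ _ _ _ (fun n => p n \o radial4)) => [n|z _].
  exact: measurable_rpoly_radial.
apply/cvgrPdist_lt => e e0; near=> n; apply: (lt_trans (fp _ _)).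
near: n; exact: near_infty_natSinv_lt (PosNum e0).
Unshelve. all: by end_near. Qed.

Lemma measurable_radial_EFin (D : set space) (f : SU -> R) : continuous f ->
  measurable_fun D (fun z => (f (radial4 z))%:E).
Proof.
by move=> cf; exact: (@measurable_EFinS _ _ R D (f \o radial4) (measurable_radial cf)).
Qed.

(** The origin is removed because [radial4] has a default value there and does not commute with
    right multiplication. *)
Definition punctured_ball : set space := [set z | 0 < sqnorm4 z < 1].

Lemma measurable_punctured_ball : measurable punctured_ball.
Proof.
rewrite (_ : punctured_ball = setT `&` sqnorm4 @^-1` `]0, 1[); last first.
  by apply/seteqP; split => z /=; rewrite in_itv /=; tauto.
exact: measurable_sqnorm4.
Qed.

Definition cube4 (a : nat -> R) (d : R) : set space :=
  (`]a 0%N - d, a 0%N + d[ `*` `]a 1%N - d, a 1%N + d[) `*`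
  (`]a 2 - d, a 2 + d[ `*` `]a 3 - d, a 3 + d[).

Lemma measurable_cube4 a d : measurable (cube4 a d).
Proof. by apply: measurableX; apply: measurableX; exact: measurable_itv. Qed.

Lemma measure_cube4 a d : 0 < d -> mu4 (cube4 a d) = ((d *+ 2) ^+ 4)%:E.
Proof.
move=> d0.
have m1 b : mu `]b - d, b + d[%classic = (d *+ 2)%:E.
  rewrite lebesgue_measure_itv /= lte_fin ltrBlDr -addrA ltrDl addr_gt0//.
  by rewrite -EFinB; congr (_%:E); ring.
rewrite product_measure1E; [|by apply: measurableX..].
have m2 (A B : set mR) : measurable A -> measurable B ->
    plane_measure (A `*` B) = (mu A * mu B)%E by exact: product_measure1E.
transitivity ((d *+ 2)%:E * (d *+ 2)%:E * ((d *+ 2)%:E * (d *+ 2)%:E))%E.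
  have m3 b c : plane_measure (`]b - d, b + d[ `*` `]c - d, c + d[) =
      ((d *+ 2)%:E * (d *+ 2)%:E)%E.
    by rewrite m2 ?m1//; exact: measurable_itv.
  by congr (_ * _)%E; exact: m3.
rewrite -!EFinM.
by congr (_%:E); ring.
Qed.

Lemma punctured_ball_lty : (mu4 punctured_ball < +oo)%E.
Proof.
apply: (@le_lt_trans _ _ (mu4 (cube4 (fun=> 0) 1))).
  apply: le_measure; rewrite ?inE; [exact: measurable_punctured_ball|exact: measurable_cube4|].
  have a (x : R) : x ^+ 2 < 1 -> x \in `]0 - 1, 0 + 1[.
    by move=> x1'; rewrite in_itv /=; apply/andP; split; nra.
  have b (x y z t : R) : x ^+ 2 + y ^+ 2 + z ^+ 2 + t ^+ 2 < 1 ->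
      [/\ x ^+ 2 < 1, y ^+ 2 < 1, z ^+ 2 < 1 & t ^+ 2 < 1].
    have := (sqr_ge0 x, sqr_ge0 y, sqr_ge0 z, sqr_ge0 t).
    by move=> [[[h0 h1] h2] h3] h; split; lra.
  move=> [[x0 x1] [x2 x3]] /andP[_] /b[h0 h1 h2 h3].
  by split; split; apply: a.
by rewrite measure_cube4 ?ltr01// ltry.
Qed.

(** A quarter of the integral over the unit 3-sphere; the factor 4 of polar coordinates reappears in
    [L2normsqE]. *)
Definition su2_int (f : SU -> R) : R :=
  \int[mu4]_(z in punctured_ball) f (radial4 z).

Lemma integrable_radial (f : SU -> R) : continuous f ->
  mu4.-integrable punctured_ball (EFin \o (f \o radial4)).
Proof.
move=> cf; apply: measurable_bounded_integrable.
- exact: measurable_punctured_ball.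
- exact: punctured_ball_lty.
- exact: measurable_funTS (measurable_radial cf).
- have [M M0 fM] := su2_bounded cf.
  exists M; split; first exact: num_real.
  by move=> N MN z _ /=; rewrite (le_trans (fM _))// ltW.
Qed.

Lemma su2_intD (f g : SU -> R) : continuous f -> continuous g ->
  su2_int (fun x => f x + g x) = su2_int f + su2_int g.
Proof.
move=> cf cg; apply: RintegralD; first exact: measurable_punctured_ball.
- exact: integrable_radial.
- exact: integrable_radial.
Qed.

Lemma su2_intZ a (f : SU -> R) : continuous f -> su2_int (fun x => a * f x) = a * su2_int f.
Proof.
move=> cf; apply: RintegralZl; first exact: measurable_punctured_ball.
exact: integrable_radial.
Qed.

Lemma su2_int_le (f g : SU -> R) : continuous f -> continuous g -> (forall x, f x <= g x) ->
  su2_int f <= su2_int g.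
Proof.
move=> cf cg fg; apply: le_Rintegral => //; first exact: measurable_punctured_ball.
- exact: integrable_radial.
- exact: integrable_radial.
Qed.

Lemma su2_int_ge0 f : (forall x, 0 <= f x) -> 0 <= su2_int f.
Proof. by move=> f0; apply: Rintegral_ge0. Qed.

Lemma su2_int_fin (f : SU -> R) : continuous f ->
  (\int[mu4]_(z in punctured_ball) (f (radial4 z))%:E = (su2_int f)%:E)%E.
Proof.
move=> cf; rewrite /su2_int /Rintegral fineK//.
apply: integrable_fin_num; first exact: measurable_punctured_ball.
exact: integrable_radial.
Qed.

Definition expmul (k : 'I_3) (t : R) (g : SU) : SU := mulSU g (expSU k t).

Lemma sqnorm4_rmul k c s z : c ^+ 2 + s ^+ 2 = 1 -> sqnorm4 (rmul_exp k c s z) = sqnorm4 z.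
Proof.
move=> cs; rewrite -[RHS]mul1r -cs; case: z => -[x0 x1] [x2 x3].
by rewrite /rmul_exp /sqnorm4; case: (val k) => [|[|n]] /=; ring.
Qed.

Lemma frameE (k : 'I_3) : frame R k = match val k with 0 => qI R | 1 => qJ R | _ => qK R end.
Proof. by case: k => [[|[|[|//]]] ?]. Qed.

Lemma mx22M (a b c d a' b' c' d' : R[i]) : mx22 a b c d *m mx22 a' b' c' d' =
  mx22 (a * a' + b * c') (a * b' + b * d') (c * a' + d * c') (c * b' + d * d').
Proof.
apply/matrixP => i j; rewrite !mxE !big_ord_recl big_ord0 !mxE /= addr0.
by case: (i == 0); case: (j == 0).
Qed.

Lemma mx22D (a b c d a' b' c' d' : R[i]) : mx22 a b c d + mx22 a' b' c' d' =
  mx22 (a + a') (b + b') (c + c') (d + d').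
Proof. by apply/matrixP => i j; rewrite !mxE; case: ifP; case: ifP. Qed.

Lemma mx22Z (e a b c d : R[i]) : e *: mx22 a b c d = mx22 (e * a) (e * b) (e * c) (e * d).
Proof. by apply/matrixP => i j; rewrite !mxE; case: ifP; case: ifP. Qed.

Lemma quat_exp (a b c d : R) (k : 'I_3) t :
  quat a b c d *m ((cos t)%:C *: 1%:M + (sin t)%:C *: frame R k) =
  let z := rmul_exp k (cos t) (sin t) ((a, b), (c, d)) in
  quat z.1.1 z.1.2 z.2.1 z.2.2.
Proof.
rewrite frameE mulmxDr -!scalemxAr mulmx1 /rmul_exp.
have -> : quat a b c d *m (match val k with 0 => qI R | 1 => qJ R | _ => qK R end) =
    match val k with
    | 0 => quat (- b) a d (- c) | 1 => quat (- c) (- d) a b | _ => quat (- d) c (- b) a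
    end.
  case: (val k) => [|[|n]]; rewrite ?/qI ?/qJ ?/qK !quatE mx22M;
    congr mx22; simpc; congr Complex; ring.
by case: (val k) => [|[|n]] /=; rewrite !quatE !mx22Z mx22D;
  congr mx22; simpc; congr Complex; ring.
Qed.

Lemma val_radial4 z : 0 < sqnorm4 z -> let r := Num.sqrt (sqnorm4 z) in
  val (radial4 z) = quat (proj4 0 z / r) (proj4 1 z / r) (proj4 2 z / r) (proj4 3 z / r).
Proof. exact: su2_radial. Qed.

Lemma radial4_rmul k t z : 0 < sqnorm4 z ->
  radial4 (rmul_exp k (cos t) (sin t) z) = expmul k t (radial4 z).
Proof.
move=> z0; have cs := cos2Dsin2 t; apply: val_inj => /=.
rewrite [in RHS](val_radial4 z0) val_radial4 ?sqnorm4_rmul// quat_exp.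
move: (Num.sqrt _) => r; case: z z0 => -[x0 x1] [x2 x3] _ {cs}.
have dB (x y a b : R) : (a * x - b * y) / r = a * (x / r) - b * (y / r).
  by rewrite mulrBl !mulrA.
have dD (x y a b : R) : (a * x + b * y) / r = a * (x / r) + b * (y / r).
  by rewrite mulrDl !mulrA.
move: (cos t) (sin t) => c s.
by rewrite /rmul_exp; case: (val k) => [|[|n]] /=; rewrite !(dB, dD).
Qed.

Lemma approximable_continuous (f : SU -> R) : approximable f -> continuous f.
Proof.
move=> af g; rewrite /continuous_at.
apply/(@cvgrPdist_lt _ R^o _ _ (nbhs_filter g)) => e e0.
exact: (approximable_continuous_near g af e0).
Qed.

Lemma qcoord_expmul j k t g : qcoord j (expmul k t g) =
  proj4 j (rmul_exp k (cos t) (sin t)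
    ((qcoord 0 g, qcoord 1 g), (qcoord 2 g, qcoord 3 g))).
Proof.
have := congr1 id (quat_exp (qcoord 0 g) (qcoord 1 g) (qcoord 2 g) (qcoord 3 g) k t).
rewrite /= -val_su2 => h; have [] := @qcoord_val (expmul k t g) _ _ _ _ h.
by case: j => [|[|[|j]]].
Qed.

Lemma rpoly_lin (a b : R) i j :
  rpoly (fun g : SU => a * qcoord i g + b * qcoord j g).
Proof.
by apply: rpolyD; (apply: rpolyM; [exact: rpoly_cst|exact: rpoly_coord]).
Qed.

Lemma rpoly_expmul p k t : rpoly p -> rpoly (p \o expmul k t).
Proof.
elim=> [j|a|q r _ cq _ cr|q r _ cq _ cr].
- have [a [b [i [l e]]]] : exists a b i l, qcoord j \o expmul k t =
      fun g => a * qcoord i g + b * qcoord l g.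
    exists (cos t).
    have [e|e|e] : [\/ val k = 0, val k = 1 | val k = 2]%N.
      by case: k => [[|[|[|//]]] ?]; [constructor 1|constructor 2|constructor 3].
    - case: j => [|[|[|j]]].
      + exists (- sin t), 0%N, 1%N; apply/funext => g.
        by rewrite [LHS]qcoord_expmul /rmul_exp e /= mulNr.
      + exists (sin t), 1%N, 0%N; apply/funext => g.
        by rewrite [LHS]qcoord_expmul /rmul_exp e /= addrC.
      + exists (sin t), 2, 3; apply/funext => g.
        by rewrite [LHS]qcoord_expmul /rmul_exp e /=.
      + exists (- sin t), 3, 2; apply/funext => g.
        by rewrite [LHS]qcoord_expmul /rmul_exp e /= mulNr.
    - case: j => [|[|[|j]]].
      + exists (- sin t), 0%N, 2; apply/funext => g.
        by rewrite [LHS]qcoord_expmul /rmul_exp e /= mulNr.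
      + exists (- sin t), 1%N, 3; apply/funext => g.
        by rewrite [LHS]qcoord_expmul /rmul_exp e /= mulNr.
      + exists (sin t), 2, 0%N; apply/funext => g.
        by rewrite [LHS]qcoord_expmul /rmul_exp e /= addrC.
      + exists (sin t), 3, 1%N; apply/funext => g.
        by rewrite [LHS]qcoord_expmul /rmul_exp e /= addrC.
    - case: j => [|[|[|j]]].
      + exists (- sin t), 0%N, 3; apply/funext => g.
        by rewrite [LHS]qcoord_expmul /rmul_exp e /= mulNr.
      + exists (sin t), 1%N, 2; apply/funext => g.
        by rewrite [LHS]qcoord_expmul /rmul_exp e /=.
      + exists (- sin t), 2, 1%N; apply/funext => g.
        by rewrite [LHS]qcoord_expmul /rmul_exp e /= mulNr.
      + exists (sin t), 3, 0%N; apply/funext => g.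
        by rewrite [LHS]qcoord_expmul /rmul_exp e /= addrC.
  by rewrite e; exact: rpoly_lin.
- exact: rpoly_cst.
- exact: rpolyD.
- exact: rpolyM.
Qed.

(** Right translation maps polynomials to polynomials and preserves uniform distances, so
    approximability passes to the translate. *)
Lemma continuous_expmul k t (f : SU -> R) : continuous f -> continuous (f \o expmul k t).
Proof.
move=> /stone_weierstrass af; apply: approximable_continuous => e /af[p rp fp].
by exists (p \o expmul k t) => [|g]; [exact: rpoly_expmul|exact: fp].
Qed.

(** For nonnegative functions this is preservation of volume, as the ball is invariant and [radial4]
    intertwines the two multiplications; adding a constant that bounds |f| gives the general case.
    The condition on sin t comes from the decomposition into shears. *)
Lemma su2_int_expmul k t (f : SU -> R) : continuous f -> sin t != 0 ->
  su2_int (f \o expmul k t) = su2_int f.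
Proof.
move=> cf s0.
have ge0case (h : SU -> R) : continuous h -> (forall x, 0 <= h x) ->
    su2_int (h \o expmul k t) = su2_int h.
  move=> ch h0; apply: EFin_inj; rewrite -!su2_int_fin//; last exact: continuous_expmul.
  have cs := cos2Dsin2 t.
  have [mT iT] := preserves_volume_rmul_exp k cs s0.
  rewrite [LHS]integral_mkcond [RHS]integral_mkcond.
  pose F : space -> \bar R := (fun z => (h (radial4 z))%:E) \_ punctured_ball.
  have mF : measurable_fun setT F.
    exact: (measurable_EFin_restrict measurable_punctured_ball (measurable_radial ch)).
  have F0 x : (0 <= F x)%E by rewrite /F; apply: erestrict_ge0 => y _; rewrite lee_fin.
  rewrite -(iT F mF F0); apply: eq_integral => z _.
  rewrite /F /patch; have -> : (rmul_exp k (cos t) (sin t) z \in punctured_ball) =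
      (z \in punctured_ball).
    by apply/idP/idP; rewrite !inE /punctured_ball /= sqnorm4_rmul.
  case: ifPn => // /set_mem /andP[z0 _].
  by rewrite radial4_rmul.
have [M M0 fM] := su2_bounded cf.
have cM := @continuous_csts R M.
have := ge0case (fun x => f x + M) (continuousDs cf cM).
have fM0 x : 0 <= f x + M by rewrite -lerBlDr sub0r; have := fM x; rewrite ler_norml => /andP[].
move=> /(_ fM0); rewrite (su2_intD cf cM) => h.
apply: (@addIr _ (su2_int (fun=> M))); rewrite -h.
rewrite -(su2_intD (f := f \o expmul k t))//; exact: continuous_expmul.
Qed.

(* Near g/2 the radial projection stays close to g, so f is bounded below on a
   whole cube of the punctured ball. *)
Lemma radial4_near_half (g : SU) (e : R) : 0 < e -> exists2 d : R, 0 < d &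
  forall z, cube4 (fun k => qcoord k g / 2) d z -> punctured_ball z /\
    forall k, `|qcoord k (radial4 z) - qcoord k g| < e.
Proof.
move=> e0; pose d := Num.min (1 / 100) (e / 100).
have d0 : 0 < d by rewrite lt_min !divr_gt0.
have d1 : d <= 1 / 100 by rewrite /d ge_min lexx.
have de : d <= e / 100 by rewrite /d ge_min lexx orbT.
have g1 k : - 1 <= qcoord k g <= 1 by rewrite -ler_norml abs_qcoord_le1.
clearbody d.
exists d => // z zd.
have zk k : - d < proj4 k z - qcoord k g / 2 < d.
  case: z zd => -[x0 x1] [x2 x3] [[]] /=; rewrite !in_itv /= => h0 h1 [h2 h3].
  have u (x a : R) : a - d < x < a + d -> - d < x - a < d.
    by move=> /andP[? ?]; apply/andP; split; lra.
  by case: k => [|[|[|k]]] /=; exact: u.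
have n2 : `|sqnorm4 z - 1 / 4| <= 5 * d.
  rewrite sqnorm4E; have gs := qcoord_sum_sqr g.
  have u k : exists2 v, proj4 k z = qcoord k g / 2 + v & - d <= v <= d.
    exists (proj4 k z - qcoord k g / 2); first by ring.
    by have /andP[? ?] := zk k; apply/andP; split; exact: ltW.
  have [v0 -> b0] := u 0%N; have [v1 -> b1] := u 1%N.
  have [v2 -> b2] := u 2%N; have [v3 -> b3] := u 3%N.
  have w k v : - d <= v <= d -> `|qcoord k g * v + v ^+ 2| <= 5 / 4 * d.
    move=> /andP[v0' v1']; have /andP[c0 c1] := g1 k.
    by rewrite ler_norml; apply/andP; split; nra.
  rewrite (_ : _ - _ = (qcoord 0 g * v0 + v0 ^+ 2) + (qcoord 1 g * v1 + v1 ^+ 2)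
    + (qcoord 2 g * v2 + v2 ^+ 2) + (qcoord 3 g * v3 + v3 ^+ 2)); last first.
    by move: gs; move: (qcoord 0 g) (qcoord 1 g) (qcoord 2 g) (qcoord 3 g) => a0 a1 a2 a3; lra.
  have := (w 0%N _ b0, w 1%N _ b1, w 2%N _ b2, w 3%N _ b3) => -[[[w0 w1] w2] w3].
  apply: (le_trans (ler_normD _ _)); apply: (@le_trans _ _ ((5 / 4 + 5 / 4 + 5 / 4) * d + 5 / 4 * d)); last by lra.
  apply: lerD => //; rewrite 2!mulrDl; apply: (le_trans (ler_normD _ _)); apply: lerD => //.
  by apply: (le_trans (ler_normD _ _)); apply: lerD.
move: n2; rewrite ler_norml => /andP[n2a n2b].
have n0 : 0 < sqnorm4 z by lra.
split; first by apply/andP; split => //; lra.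
move=> k; rewrite qcoord_radial4//; set r := Num.sqrt _.
have r0 : 0 <= r by exact: sqrtr_ge0.
have r2 : r ^+ 2 = sqnorm4 z by rewrite /r sqr_sqrtr// ltW.
have r4 : 1 / 4 <= r by nra.
have rp : 0 < r by lra.
have rr : - (20 * d) <= r - 1 / 2 <= 20 * d.
  have h : (r - 1 / 2) * (r + 1 / 2) = sqnorm4 z - 1 / 4 by rewrite -r2; field.
  by apply/andP; split; nra.
have -> : proj4 k z / r - qcoord k g = (proj4 k z - qcoord k g * r) / r.
  by field; exact: lt0r_neq0.
rewrite normrM [`|r^-1|]gtr0_norm ?invr_gt0// ltr_pdivrMr//.
have /andP[a0 a1] := zk k; have /andP[c0 c1] := g1 k; have /andP[b0 b1] := rr.
apply: (@lt_le_trans _ _ (e / 4)); last by nra.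
have : `|qcoord k g * (r - 1 / 2)| <= 20 * d.
  rewrite normrM; apply: (@le_trans _ _ (1 * `|r - 1 / 2|)).
    by apply: ler_wpM2r => //; exact: abs_qcoord_le1.
  by rewrite mul1r ler_norml rr.
rewrite ler_norml ltr_norml => /andP[m0 m1]; apply/andP; split; lra.
Qed.

Lemma su2_int_eq0 (f : SU -> R) : continuous f -> (forall x, 0 <= f x) ->
  su2_int f = 0 -> forall g, f g = 0.
Proof.
move=> cf f0 If g; apply/eqP; rewrite eq_le f0 andbT leNgt; apply/negP => fg.
have c0 : 0 < f g / 2 by rewrite divr_gt0.
have /nbhs_su2P[e e0 he] := su2_continuous_near g cf c0.
have [d d0 hd] := radial4_near_half g e0.
pose c : nat -> R := fun k => qcoord k g / 2.
have sub : cube4 c d `<=` punctured_ball.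
  by move=> z /hd[].
have : ((f g / 2)%:E * mu4 (cube4 c d) <= 0)%E.
  rewrite -integral_cst; last exact: measurable_cube4.
  apply: (@le_trans _ _ (\int[mu4]_(z in cube4 c d)
      (f (radial4 z))%:E)%E).
    apply: ge0_le_integral => //.
    - exact: measurable_cube4.
    - by move=> z _; rewrite lee_fin ltW.
    - exact: measurable_radial_EFin.
    - move=> z /hd[_ hz]; rewrite lee_fin.
      have := he _ hz; rewrite /= ltr_norml => /andP[_ h]; lra.
  rewrite -[X in (_ <= X)%E]/(0%:E) -If -su2_int_fin//.
  apply: ge0_subset_integral => //.
  - exact: measurable_cube4.
  - exact: measurable_punctured_ball.
  - exact: measurable_radial_EFin.
  - by move=> z _; rewrite lee_fin.
rewrite measure_cube4// -EFinM lee_fin leNgt => /negP; apply.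
by rewrite mulr_gt0// exprn_gt0// mulrn_wgt0.
Qed.

Definition origin : set space := ([set 0] `*` [set 0]) `*` ([set 0] `*` [set 0]).

Lemma measure_origin : measurable origin /\ mu4 origin = 0%E.
Proof.
pose z0 : set mR := [set 0].
have mz : measurable z0 by exact: measurable_set1.
have mzz : measurable (z0 `*` z0) by exact: measurableX.
split; first exact: measurableX.
have n0 : plane_measure (z0 `*` z0) = 0%E.
  transitivity (mu z0 * mu z0)%E; first exact: product_measure1E.
  by rewrite /z0 lebesgue_measure_set1 mul0e.
transitivity (plane_measure (z0 `*` z0) * plane_measure (z0 `*` z0))%E.
  exact: product_measure1E.
by rewrite n0 mul0e.
Qed.

Lemma continuous_normsq (psi : spinor_fun R) :
  continuous (psi : SU -> 'cV[R[i]^o]_2) -> continuous (fun g => normsq (psi g)).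
Proof.
move=> /spinor_continuousP h; rewrite /normsq.
under eq_fun do rewrite big_ord_recl big_ord_recl big_ord0 addr0.
have [r0 i0] := h 0; have [r1 i1] := h (lift ord0 ord0).
by apply: continuousDs; apply: continuousDs; exact: continuousMs.
Qed.

Lemma normsq_ge0 (v : 'cV[R[i]]_2) : 0 <= normsq v.
Proof. by apply: sumr_ge0 => i _; rewrite addr_ge0 ?sqr_ge0. Qed.

(** Tonelli turns the iterated integral into one over the product, and the origin, by which the two
    domains differ, is a null set. *)
Lemma L2normsqE (psi : spinor_fun R) :
  continuous (psi : SU -> 'cV[R[i]^o]_2) ->
  L2normsq psi = (4 * su2_int (fun g => normsq (psi g)))%:E.
Proof.
move=> cpsi; have cn := continuous_normsq cpsi.
rewrite EFinM -su2_int_fin//; congr (_ * _)%E.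
pose ball : set space := [set z | sqnorm4 z < 1].
have mball : measurable ball.
  rewrite (_ : ball = setT `&` sqnorm4 @^-1` `]-oo, 1[); last first.
    by apply/seteqP; split => z /=; rewrite in_itv /=; tauto.
  exact: measurable_sqnorm4.
pose h z := normsq (psi (radial4 z)).
have mh : measurable_fun setT (h : space -> mR) := measurable_radial cn.
have h0 z : (0 <= (h z)%:E)%E by rewrite lee_fin normsq_ge0.
pose F : space -> \bar R := (EFin \o h) \_ ball.
have mF : measurable_fun setT F.
  exact: (measurable_EFin_restrict mball mh).
have F0 x : (0 <= F x)%E by rewrite /F; apply: erestrict_ge0 => y _; exact: h0.
transitivity (\int[mu4]_z F z)%E.
  rewrite (ge0_integral_R4 mF F0).
  apply: eq_integral => x0 _; apply: eq_integral => x1 _; apply: eq_integral => x2 _.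
  rewrite integral_mkcond; apply: eq_integral => x3 _; rewrite /F /patch.
  have -> : (x3 \in [set x3 | x0 ^+ 2 + x1 ^+ 2 + x2 ^+ 2 + x3 ^+ 2 < 1]) =
     ((x0, x1, (x2, x3)) \in ball) by apply/idP/idP; rewrite !inE.
  by [].
rewrite /F -integral_mkcond.
have [mN N0] := measure_origin.
rewrite (ge0_negligible_integral mN mball (@measurable_radial_EFin ball _ cn) (fun z _ => h0 z) N0).
congr integral; apply/seteqP; rewrite /origin; split => [[[x0 x1] [x2 x3]] [b nN]|z /andP[z0 z1]].
  apply/andP; split => //; rewrite lt_neqAle sqnorm4_ge0 andbT eq_sym.
  apply/eqP => /sqnorm4_eq0 zk; apply: nN.
  by have := (zk 0%N, zk 1%N, zk 2, zk 3) => -[[[]]] /= -> -> -> ->.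
split => // -[[/= e0 e1] [/= e2 e3]]; move: z0.
by rewrite /sqnorm4 e0 e1 e2 e3 expr0n /= !addr0 ltxx.
Qed.
End su2_integral.

(** * Derivatives along the frame and their integrals *)

Section lie_derivatives.
Context {R : realType}.
Notation SU := (SU2 R).

Definition is_lder (k : 'I_3) (f f' : SU -> R) : Prop :=
  forall g : SU, is_derive (0 : R) (1 : R) (fun t : R => f (expmul k t g)) (f' g).

Lemma expmul0 k (g : SU) : expmul k 0 g = g.
Proof.
by apply: val_inj; rewrite /= cos0 sin0 scale0r addr0 scale1r mulmx1.
Qed.

Lemma expmulD k s t (g : SU) : expmul k (s + t) g = expmul k t (expmul k s g).
Proof.
rewrite /expmul expSU_add; apply: val_inj.
by rewrite -[RHS]/(val g *m val (expSU k s) *m val (expSU k t)) -mulmxA.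
Qed.

Lemma is_lder_flow k f f' t g : is_lder k f f' ->
  is_derive (t : R) (1 : R) (fun s : R => f (expmul k s g)) (f' (expmul k t g)).
Proof.
move=> h; have h1 := h (expmul k t g).
have e : (fun s : R => f (expmul k s g)) =
    (fun s => f (expmul k s (expmul k t g))) \o (fun s => s - t).
  by apply/funext => s /=; rewrite -expmulD addrC subrK.
have s0 : is_derive (t : R) (1 : R) (fun s : R => s - t) 1.
  by apply: is_derive_eq; rewrite subr0.
rewrite -[f' _]mulr1 e; have h2 : is_derive (t - t : R) (1 : R) (fun s : R => f (expmul k s (expmul k t g)))
  (f' (expmul k t g)) by rewrite subrr.
exact: (@is_derive1_comp _ (fun s : R => f (expmul k s (expmul k t g))) (fun s => s - t) t _ _ h2 s0).
Qed.

Lemma is_lder_mvt k f f' t g : is_lder k f f' -> 0 < t ->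
  exists2 c, 0 < c < t & f (expmul k t g) - f g = t * f' (expmul k c g).
Proof.
move=> h t0.
have [||c ct] := @MVT R (fun s => f (expmul k s g)) (fun s => f' (expmul k s g)) 0 t t0.
- by move=> x _; exact: is_lder_flow.
- apply: continuous_subspaceT => x.
  apply: differentiable_continuous; apply/derivable1_diffP.
  by have := is_lder_flow x g h; case.
by rewrite expmul0 subr0 mulrC => ->; exists c.
Qed.

Lemma qcoord_expmul_dist j k t (g : SU) :
  `|qcoord j (expmul k t g) - qcoord j g| <= `|cos t - 1| + `|sin t|.
Proof.
have [x [y [e x1 y1]]] : exists x y, [/\ qcoord j (expmul k t g) - qcoord j g =
    (cos t - 1) * x + sin t * y, `|x| <= 1 & `|y| <= 1].
  exists (qcoord j g).
  pose s (b : bool) i := if b then - qcoord i g else qcoord i g.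
  suff [b [i ->]] : exists b i, qcoord j (expmul k t g) = cos t * qcoord j g + sin t * s b i.
    exists (s b i); split; [by ring|exact: abs_qcoord_le1|].
    by rewrite /s; case: b; rewrite ?normrN abs_qcoord_le1.
  have [e|e|e] : [\/ val k = 0, val k = 1 | val k = 2]%N.
    by case: k => [[|[|[|//]]] ?]; [constructor 1|constructor 2|constructor 3].
  - rewrite qcoord_expmul /rmul_exp e; case: j => [|[|[|j]]] /=.
    + by exists true, 1%N; rewrite /s mulrN.
    + by exists false, 0%N; rewrite addrC.
    + by exists false, 3%N.
    + by exists true, 2%N; rewrite /s mulrN.
  - rewrite qcoord_expmul /rmul_exp e; case: j => [|[|[|j]]] /=.
    + by exists true, 2%N; rewrite /s mulrN.
    + by exists true, 3%N; rewrite /s mulrN.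
    + by exists false, 0%N; rewrite addrC.
    + by exists false, 1%N; rewrite addrC.
  - rewrite qcoord_expmul /rmul_exp e; case: j => [|[|[|j]]] /=.
    + by exists true, 3%N; rewrite /s mulrN.
    + by exists false, 2%N.
    + by exists true, 1%N; rewrite /s mulrN.
    + by exists false, 0%N; rewrite addrC.
rewrite e; apply: (le_trans (ler_normD _ _)); rewrite !normrM.
by apply: lerD; rewrite ler_piMr.
Qed.

Definition flow_uniform k (f : SU -> R) := forall e : R, 0 < e ->
  exists2 d : R, 0 < d & forall t g, `|t| < d -> `|f (expmul k t g) - f g| < e.

Lemma flow_uniform_rpoly k p : rpoly p -> flow_uniform k p.
Proof.
elim=> [j|a|p1 p2 _ h1 _ h2|p1 p2 r1 h1 r2 h2] e e0.
- have e20 : 0 < e / 2 by rewrite divr_gt0.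
  have := @continuous_cos R 0; rewrite /continuous_at cos0 => /cvgrPdist_lt/(_ _ e20).
  move=> /nbhs_ballP[d1 /= d10 h1].
  have := @continuous_sin R 0; rewrite /continuous_at sin0 => /cvgrPdist_lt/(_ _ e20).
  move=> /nbhs_ballP[d2 /= d20 h2].
  exists (Num.min d1 d2); first by rewrite lt_min d10.
  move=> t g; rewrite lt_min => /andP[t1 t2].
  apply: (le_lt_trans (qcoord_expmul_dist _ _ _ _)); rewrite [e]splitr; apply: ltrD.
    by rewrite distrC; apply: h1; rewrite -ball_normE /= sub0r normrN.
  by have := h2 t; rewrite sub0r normrN; apply; rewrite -ball_normE /= sub0r normrN.
- by exists 1 => // t g _; rewrite subrr normr0.
- have e20 : 0 < e / 2 by rewrite divr_gt0.
  have [d1 d10 k1] := h1 _ e20; have [d2 d20 k2] := h2 _ e20.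
  exists (Num.min d1 d2); first by rewrite lt_min d10.
  move=> t g; rewrite lt_min => /andP[t1 t2].
  have -> : p1 (expmul k t g) + p2 (expmul k t g) - (p1 g + p2 g) =
    (p1 (expmul k t g) - p1 g) + (p2 (expmul k t g) - p2 g) by ring.
  rewrite [e]splitr; apply: (le_lt_trans (ler_normD _ _)); apply: ltrD; [exact: k1|exact: k2].
- have [M1 M10 b1] := su2_bounded (rpoly_continuous r1).
  have [M2 M20 b2] := su2_bounded (rpoly_continuous r2).
  have e1 : 0 < e / 2 / M2 by rewrite !divr_gt0.
  have e2 : 0 < e / 2 / M1 by rewrite !divr_gt0.
  have [d1 d10 k1] := h1 _ e1; have [d2 d20 k2] := h2 _ e2.
  exists (Num.min d1 d2); first by rewrite lt_min d10.
  move=> t g; rewrite lt_min => /andP[t1 t2].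
  have -> : p1 (expmul k t g) * p2 (expmul k t g) - p1 g * p2 g =
    (p1 (expmul k t g) - p1 g) * p2 (expmul k t g) +
    p1 g * (p2 (expmul k t g) - p2 g) by ring.
  rewrite [e]splitr; apply: (le_lt_trans (ler_normD _ _)); rewrite !normrM; apply: ltrD.
    rewrite -[ltRHS](@divfK _ M2) ?gt_eqF//.
    apply: (@le_lt_trans _ _ (`|p1 (expmul k t g) - p1 g| * M2)); first exact: ler_wpM2l.
    by rewrite ltr_pM2r//; exact: k1.
  rewrite -[ltRHS](@divfK _ M1) ?gt_eqF// mulrC.
  apply: (@le_lt_trans _ _ (`|p2 (expmul k t g) - p2 g| * M1)); first exact: ler_wpM2l.
  by rewrite ltr_pM2r//; exact: k2.
Qed.

(** Clear for coordinates, preserved by sums and by products of bounded functions, and passed to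
    continuous functions by uniform approximation. *)
Lemma flow_uniform_continuous k f : continuous f -> flow_uniform k f.
Proof.
move=> /stone_weierstrass af e e0; have e30 : 0 < e / 3 by rewrite divr_gt0.
have [p rp fp] := af _ e30; have [d d0 h] := flow_uniform_rpoly k rp e30.
exists d => // t g td.
have -> : f (expmul k t g) - f g = (f (expmul k t g) - p (expmul k t g))
  + (p (expmul k t g) - p g) - (f g - p g) by ring.
have -> : e = e / 3 + e / 3 + e / 3 by field.
apply: (le_lt_trans (ler_normB _ _)); apply: ltrD; last exact: fp.
by apply: (le_lt_trans (ler_normD _ _)); apply: ltrD; [exact: fp|exact: h].
Qed.

Lemma su2_intB (f g : SU -> R) : continuous f -> continuous g ->
  su2_int (fun x => f x - g x) = su2_int f - su2_int g.
Proof.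
move=> cf cg; have c1 : continuous (fun x => - 1 * g x).
  by apply: continuousMs => //; exact: continuous_csts.
have -> : (fun x => f x - g x) = (fun x => f x + - 1 * g x).
  by apply/funext => x; rewrite mulN1r.
by rewrite su2_intD// su2_intZ// mulN1r.
Qed.

Lemma su2_int_norm_le (f : SU -> R) e : continuous f -> (forall g, `|f g| <= e) ->
  `|su2_int f| <= e * su2_int (fun=> 1).
Proof.
move=> cf fe; have c1 := @continuous_csts R 1.
rewrite ler_norml -mulNr -!su2_intZ//; apply/andP; split; apply: su2_int_le => //.
- by apply: continuousMs => //; exact: continuous_csts.
- by move=> x; have := fe x; rewrite mulr1 ler_norml => /andP[].
- by apply: continuousMs => //; exact: continuous_csts.
- by move=> x; have := fe x; rewrite mulr1 ler_norml => /andP[].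
Qed.

(** Invariance makes the integral of f(g exp(t X_k)) - f(g) - t f'(g) equal to -t times the integral
    of f'. By the mean value theorem this integrand is t (f'(g exp(c X_k)) - f'(g)) with 0 < c < t,
    hence o(t) uniformly in g. *)
Lemma su2_int_lder k (f f' : SU -> R) : continuous f -> continuous f' -> is_lder k f f' ->
  su2_int f' = 0.
Proof.
move=> cf cf' h; pose V : R := su2_int (fun _ : SU => 1).
have V0 : 0 <= V by exact: su2_int_ge0.
suff small (e : R) : 0 < e -> `|su2_int f'| <= e * V.
  apply/eqP; rewrite -normr_le0; apply/ler_addgt0Pr => e e0; rewrite add0r.
  have V1 : 0 < V + 1 by rewrite ltr_wpDl.
  have := small (e / (V + 1)); rewrite divr_gt0// => /(_ isT) /le_trans; apply.
  by rewrite -mulrA ger_pMr// mulrC ler_pdivrMr// mul1r lerDl.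
move=> e0; have [d d0 hd] := flow_uniform_continuous k cf' e0.
(* The bound t <= 1 < pi keeps sin t nonzero, as invariance requires. *)
pose t := Num.min (d / 2) 1.
have t0 : 0 < t by rewrite lt_min divr_gt0//=.
have td : t < d by rewrite gt_min; apply/orP; left; lra.
have st : sin t != 0.
  rewrite gt_eqF// sin_gt0_pi// t0/=; apply: (@le_lt_trans _ _ 1).
    by rewrite ge_min lexx orbT.
  by apply: (lt_le_trans _ (pi_ge2 R)); rewrite ltr1n.
pose F g := f (expmul k t g) - f g - t * f' g.
have cfe : continuous (f \o expmul k t) by exact: continuous_expmul.
have ctf : continuous (fun g => t * f' g).
  by apply: continuousMs => //; exact: continuous_csts.
have cF : continuous F by do 2 apply: continuousBs => //.
have Fe g : `|F g| <= t * e.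
  rewrite /F; have [c /andP[c0 ct] ->] := is_lder_mvt g h t0.
  rewrite -mulrBr normrM gtr0_norm// ler_pM2l// ltW// hd// gtr0_norm//.
  exact: lt_trans ct td.
have := su2_int_norm_le cF Fe.
rewrite /F su2_intB//; last exact: continuousBs.
rewrite (su2_intB (f := f \o expmul k t))// su2_int_expmul// subrr sub0r normrN.
by rewrite su2_intZ// normrM gtr0_norm// -mulrA ler_pM2l.
Qed.

End lie_derivatives.

(** * Symmetry of the Dirac operator *)

Section dirac_symmetric.
Context {R : realType}.
Notation SU := (SU2 R).
Notation CV := 'cV[R[i]]_2.

(** The real part of the Hermitian product, with C^2 viewed as R^4. Complex statements are obtained
    by testing also against i times a spinor. *)
Definition rdot (v w : CV) : R :=
  \sum_i (complex.Re (v i 0) * complex.Re (w i 0) + complex.Im (v i 0) * complex.Im (w i 0)).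

Lemma rdotvv v : rdot v v = normsq v.
Proof. by apply: eq_bigr => i _; rewrite !expr2. Qed.

Lemma rdotC v w : rdot v w = rdot w v.
Proof. by apply: eq_bigr => i _; congr (_ + _); rewrite mulrC. Qed.

Lemma rdotDl u v w : rdot (u + v) w = rdot u w + rdot v w.
Proof.
rewrite -big_split; apply: eq_bigr => i _ /=; rewrite mxE.
by case: (u i 0) (v i 0) => a b [c d] /=; ring.
Qed.

Lemma rdotZl (a : R) v w : rdot (a%:C *: v) w = a * rdot v w.
Proof.
rewrite mulr_sumr; apply: eq_bigr => i _ /=; rewrite mxE.
by case: (v i 0) => c d /=; simpc => /=; ring.
Qed.

Lemma rdotNl v w : rdot (- v) w = - rdot v w.
Proof.
by have := rdotZl (-1) v w; rewrite rmorphN rmorph1 scaleN1r mulN1r.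
Qed.

Lemma rdotDr u v w : rdot u (v + w) = rdot u v + rdot u w.
Proof. by rewrite rdotC rdotDl !(rdotC u). Qed.

Lemma rdotZr (a : R) v w : rdot v (a%:C *: w) = a * rdot v w.
Proof. by rewrite rdotC rdotZl rdotC. Qed.

Lemma rdotZ_conj (a : R[i]) v w : rdot (a *: v) w = rdot v (a^* *: w).
Proof.
apply: eq_bigr => i _ /=; rewrite !mxE.
by case: a (v i 0) (w i 0) => a b [c d] [e f] /=; simpc => /=; ring.
Qed.

Lemma rdot_frame k v w : rdot (frame R k *m v) w = - rdot v (frame R k *m w).
Proof.
rewrite /rdot !big_ord_recl !big_ord0 !addr0 frameE.
rewrite !mxE !big_ord_recl !big_ord0 !addr0.
set v0 := v ord0 0; set w0 := w ord0 0.
set v1 := v _ 0; set w1 := w _ 0.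
move: v0 w0 v1 w1 => [a b] [c d] [e f] [g h].
by case: (val k) => [|[|n]]; rewrite !mxE /=; ring.
Qed.

Definition is_clder k (f f' : SU -> R[i]) :=
  is_lder k (fun g => complex.Re (f g)) (fun g => complex.Re (f' g)) /\
  is_lder k (fun g => complex.Im (f g)) (fun g => complex.Im (f' g)).

Definition is_slder k (psi psi' : spinor_fun R) :=
  forall j, is_clder k (fun g => psi g j 0) (fun g => psi' g j 0).

Lemma is_lderD k (f f' h h' : SU -> R) : is_lder k f f' -> is_lder k h h' ->
  is_lder k (fun g => f g + h g) (fun g => f' g + h' g).
Proof. by move=> hf hh g; have := hf g; have := hh g => h1 h2; exact: is_deriveD. Qed.

Lemma is_lderB k (f f' h h' : SU -> R) : is_lder k f f' -> is_lder k h h' ->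
  is_lder k (fun g => f g - h g) (fun g => f' g - h' g).
Proof. by move=> hf hh g; have := hf g; have := hh g => h1 h2; exact: is_deriveB. Qed.

Lemma is_lderM k (f f' h h' : SU -> R) : is_lder k f f' -> is_lder k h h' ->
  is_lder k (fun g => f g * h g) (fun g => f' g * h g + f g * h' g).
Proof.
move=> hf hh g; have h1 := hf g; have h2 := hh g.
apply: (is_derive_eq (is_deriveM h1 h2)).
by rewrite !expmul0 /GRing.scale /= addrC [f' g * _]mulrC.
Qed.

Lemma is_lder_cst k (a : R) : is_lder k (fun _ : SU => a) (fun=> 0).
Proof. by move=> g; exact: is_derive_cst. Qed.

Lemma is_clder_cst k (a : R[i]) : is_clder k (fun _ : SU => a) (fun=> 0).
Proof. by split; exact: is_lder_cst. Qed.

Lemma is_clderD k (f f' h h' : SU -> R[i]) : is_clder k f f' -> is_clder k h h' ->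
  is_clder k (fun g => f g + h g) (fun g => f' g + h' g).
Proof.
move=> [f1 f2] [h1 h2]; split.
  have := is_lderD f1 h1; congr is_lder; apply/funext => g;
  by [case: (f g) (h g) => a b []|case: (f' g) (h' g) => a b []].
have := is_lderD f2 h2; congr is_lder; apply/funext => g;
  by [case: (f g) (h g) => a b []|case: (f' g) (h' g) => a b []].
Qed.

Lemma is_clderM k (f f' h h' : SU -> R[i]) : is_clder k f f' -> is_clder k h h' ->
  is_clder k (fun g => f g * h g) (fun g => f' g * h g + f g * h' g).
Proof.
move=> [f1 f2] [h1 h2]; split.
  have := is_lderB (is_lderM f1 h1) (is_lderM f2 h2); congr is_lder; apply/funext => g.
    by case: (f g) (h g) => a b [].
  case: (f' g) (h' g) (f g) (h g) => a b [c d] [x y] [z t] /=; ring.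
have := is_lderD (is_lderM f1 h2) (is_lderM f2 h1); congr is_lder; apply/funext => g.
  case: (f g) (h g) => a b [c d] /=; ring.
case: (f' g) (h' g) (f g) (h g) => a b [c d] [x y] [z t] /=; ring.
Qed.

Lemma is_clderZ k (a : R[i]) (f f' : SU -> R[i]) : is_clder k f f' ->
  is_clder k (fun g => a * f g) (fun g => a * f' g).
Proof.
move=> hf; have := is_clderM (is_clder_cst k a) hf; congr is_clder.
by apply/funext => g; rewrite mul0r add0r.
Qed.

Lemma is_slder_lieD k psi psi' : is_slder k psi psi' ->
  lie_derivable k psi /\ lieD k psi = psi'.
Proof.
move=> h; split=> [g j|].
  by have [hr hi] := h j; split; [have := hr g|have := hi g]; case.
apply/funext => g; apply/matrixP => i j; rewrite (ord1 j) mxE.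
have [/(_ g)[_ hr] /(_ g)[_ hi]] := h i.
by rewrite !derive1E [X in X +i* _]hr [X in _ +i* X]hi; case: (psi' g i 0).
Qed.

Lemma lie_derivable_slder k psi : lie_derivable k psi -> is_slder k psi (lieD k psi).
Proof.
move=> h j; split=> g; have [hr hi] := h g j; rewrite mxE /= derive1E; exact: derivableP.
Qed.

Lemma is_slderD k psi psi' phi phi' : is_slder k psi psi' -> is_slder k phi phi' ->
  is_slder k (fun g => psi g + phi g) (fun g => psi' g + phi' g).
Proof.
move=> h1 h2 j; have := is_clderD (h1 j) (h2 j).
by congr is_clder; apply/funext => g; rewrite mxE.
Qed.

Lemma is_slderZ k (a : R[i]) psi psi' : is_slder k psi psi' ->
  is_slder k (fun g => a *: psi g) (fun g => a *: psi' g).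
Proof.
move=> h1 j; have := is_clderZ a (h1 j).
by congr is_clder; apply/funext => g; rewrite mxE.
Qed.

Lemma is_slderM k (A : 'M[R[i]]_2) psi psi' : is_slder k psi psi' ->
  is_slder k (fun g => A *m psi g) (fun g => A *m psi' g).
Proof.
move=> h j; have := is_clderD (is_clderZ (A j 0) (h 0)) (is_clderZ (A j 1) (h 1)).
congr is_clder; apply/funext => g; rewrite mxE !big_ord_recl big_ord0 addr0;
  by congr (_ + _ * _); [congr (A _ _)|congr (_ _ _)]; exact/val_inj.
Qed.

Definition class1 (psi : spinor_fun R) :=
  (forall j, continuous (fun g => complex.Re (psi g j 0)) /\
             continuous (fun g => complex.Im (psi g j 0))) /\
  forall k, exists psi', is_slder k psi psi' /\
    forall j, continuous (fun g => complex.Re (psi' g j 0)) /\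
              continuous (fun g => complex.Im (psi' g j 0)).

Lemma class_C1 psi : class_C 1 psi -> class1 psi.
Proof.
move=> [/spinor_continuousP cpsi h]; split=> // k; have [hd [hc _]] := h k.
exists (lieD k psi); split; first exact: lie_derivable_slder.
exact/spinor_continuousP.
Qed.

Definition ccont (f : SU -> R[i]) :=
  continuous (fun g => complex.Re (f g)) /\ continuous (fun g => complex.Im (f g)).

Lemma continuous_eqs (f h : SU -> R) : f =1 h -> continuous f -> continuous h.
Proof. by move=> /funext ->. Qed.

Lemma ccont_cst a : ccont (fun _ => a).
Proof. by split; exact: continuous_csts. Qed.

Lemma ccontD f h : ccont f -> ccont h -> ccont (fun g => f g + h g).
Proof.
move=> [f1 f2] [h1 h2]; split.
  apply: continuous_eqs (continuousDs f1 h1) => g.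
  by case: (f g) (h g) => a b [].
apply: continuous_eqs (continuousDs f2 h2) => g.
by case: (f g) (h g) => a b [].
Qed.

Lemma ccontM f h : ccont f -> ccont h -> ccont (fun g => f g * h g).
Proof.
move=> [f1 f2] [h1 h2]; split.
  apply: continuous_eqs (continuousBs (continuousMs f1 h1) (continuousMs f2 h2)) => g.
  by case: (f g) (h g) => a b [].
apply: continuous_eqs (continuousDs (continuousMs f1 h2) (continuousMs f2 h1)) => g.
  by case: (f g) (h g) => a b [].
Qed.

Definition scont (psi : spinor_fun R) := forall j, ccont (fun g => psi g j 0).

Lemma scontD psi phi : scont psi -> scont phi -> scont (fun g => psi g + phi g).
Proof.
move=> h1 h2 j; have := ccontD (h1 j) (h2 j).
by congr ccont; apply/funext => g; rewrite mxE.
Qed.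

Lemma scontZ a psi : scont psi -> scont (fun g => a *: psi g).
Proof.
move=> h1 j; have := ccontM (ccont_cst a) (h1 j).
by congr ccont; apply/funext => g; rewrite mxE.
Qed.

Lemma scontM (A : 'M[R[i]]_2) psi : scont psi -> scont (fun g => A *m psi g).
Proof.
move=> h j; have := ccontD (ccontM (ccont_cst (A j 0)) (h 0)) (ccontM (ccont_cst (A j 1)) (h 1)).
congr ccont; apply/funext => g; rewrite mxE !big_ord_recl big_ord0 addr0;
  by congr (_ + _ * _); [congr (A _ _)|congr (_ _ _)]; exact/val_inj.
Qed.

Lemma class1_cont psi : class1 psi -> scont psi.
Proof. by case. Qed.

Lemma class1_lieD k psi : class1 psi ->
  [/\ is_slder k psi (lieD k psi) & scont (lieD k psi)].
Proof.
by move=> [_ /(_ k)[psi' [h c]]]; have [_ e] := is_slder_lieD h; rewrite e.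
Qed.

Lemma class1D psi phi : class1 psi -> class1 phi -> class1 (fun g => psi g + phi g).
Proof.
move=> [c1 h1] [c2 h2]; split=> [|k]; first exact: scontD.
have [psi' [d1 e1]] := h1 k; have [phi' [d2 e2]] := h2 k.
by exists (fun g => psi' g + phi' g); split; [exact: is_slderD|exact: scontD].
Qed.

Lemma class1Z a psi : class1 psi -> class1 (fun g => a *: psi g).
Proof.
move=> [c1 h1]; split=> [|k]; first exact: scontZ.
have [psi' [d1 e1]] := h1 k.
by exists (fun g => a *: psi' g); split; [exact: is_slderZ|exact: scontZ].
Qed.

Lemma dirac_opD psi phi : class1 psi -> class1 phi ->
  dirac_op (fun g => psi g + phi g) = (fun g => dirac_op psi g + dirac_op phi g).
Proof.
move=> h1 h2; apply/funext => g; rewrite /dirac_op.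
have e k : lieD k (fun g => psi g + phi g) = fun g => lieD k psi g + lieD k phi g.
  have [d1 _] := class1_lieD k h1; have [d2 _] := class1_lieD k h2.
  by have [_ ->] := is_slder_lieD (is_slderD d1 d2).
under eq_bigr do rewrite e mulmxDr.
by rewrite big_split /= scalerDr opprD addrACA.
Qed.

Lemma dirac_opZ a psi : class1 psi ->
  dirac_op (fun g => a *: psi g) = (fun g => a *: dirac_op psi g).
Proof.
move=> h1; apply/funext => g; rewrite /dirac_op.
have e k : lieD k (fun g => a *: psi g) = fun g => a *: lieD k psi g.
  have [d1 _] := class1_lieD k h1.
  by have [_ ->] := is_slder_lieD (is_slderZ a d1).
under eq_bigr do rewrite e -scalemxAr.
by rewrite -scaler_sumr scalerBr !scalerA [a * _]mulrC.
Qed.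

Lemma continuous_rdot psi phi : scont psi -> scont phi ->
  continuous (fun g => rdot (psi g) (phi g)).
Proof.
move=> h1 h2; rewrite /rdot.
under eq_fun do rewrite big_ord_recl big_ord_recl big_ord0 addr0.
have [a0 a1] := h1 0; have [a2 a3] := h1 (lift ord0 ord0).
have [b0 b1] := h2 0; have [b2 b3] := h2 (lift ord0 ord0).
by apply: continuousDs; apply: continuousDs; exact: continuousMs.
Qed.

Definition spinor_dot (psi phi : spinor_fun R) : R :=
  su2_int (fun g => rdot (psi g) (phi g)).

Lemma spinor_dotC psi phi : spinor_dot psi phi = spinor_dot phi psi.
Proof. by congr su2_int; apply/funext => g; exact: rdotC. Qed.

Lemma spinor_dotDl psi1 psi2 phi : scont psi1 -> scont psi2 -> scont phi ->
  spinor_dot (fun g => psi1 g + psi2 g) phi = spinor_dot psi1 phi + spinor_dot psi2 phi.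
Proof.
move=> h1 h2 h; rewrite -su2_intD; [|exact: continuous_rdot..].
by congr su2_int; apply/funext => g; exact: rdotDl.
Qed.

Lemma spinor_dotZl (a : R) psi phi : scont psi -> scont phi ->
  spinor_dot (fun g => a%:C *: psi g) phi = a * spinor_dot psi phi.
Proof.
move=> h1 h; rewrite -su2_intZ; last exact: continuous_rdot.
by congr su2_int; apply/funext => g; exact: rdotZl.
Qed.

Lemma spinor_dotZ_conj (a : R[i]) psi phi :
  spinor_dot (fun g => a *: psi g) phi = spinor_dot psi (fun g => a^* *: phi g).
Proof. by congr su2_int; apply/funext => g; exact: rdotZ_conj. Qed.

Lemma spinor_dot_frame k psi phi : scont psi -> scont phi ->
  spinor_dot (fun g => frame R k *m psi g) phi = - spinor_dot psi (fun g => frame R k *m phi g).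
Proof.
move=> h1 h2; rewrite -mulN1r -su2_intZ; last first.
  by apply: continuous_rdot => //; exact: scontM.
by congr su2_int; apply/funext => g; rewrite mulN1r; exact: rdot_frame.
Qed.

(** The product rule, together with the vanishing of the integral of a derivative along X_k. *)
Lemma spinor_dot_lieD k psi phi : class1 psi -> class1 phi ->
  spinor_dot (lieD k psi) phi = - spinor_dot psi (lieD k phi).
Proof.
move=> h1 h2; have [d1 c1'] := class1_lieD k h1; have [d2 c2'] := class1_lieD k h2.
have c1 := class1_cont h1; have c2 := class1_cont h2.
apply/eqP; rewrite -subr_eq0 opprK; apply/eqP.
rewrite -su2_intD; [|exact: continuous_rdot..].
apply: (@su2_int_lder _ k (fun g => rdot (psi g) (phi g))).
- exact: continuous_rdot.
- by apply: continuousDs; exact: continuous_rdot.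
have [a0 a1] := d1 0; have [a2 a3] := d1 (lift ord0 ord0).
have [b0 b1] := d2 0; have [b2 b3] := d2 (lift ord0 ord0).
have := is_lderD (is_lderD (is_lderM a0 b0) (is_lderM a1 b1))
   (is_lderD (is_lderM a2 b2) (is_lderM a3 b3)).
congr is_lder; apply/funext => g; rewrite /rdot !big_ord_recl !big_ord0 !addr0//.
ring.
Qed.

Lemma scont_dirac psi : class1 psi -> scont (dirac_op psi).
Proof.
move=> h; have c k : scont (fun g => frame R k *m lieD k psi g).
  by apply: scontM; have [] := class1_lieD k h.
have := scontD (scontD (scontD (c ord0) (c (lift ord0 ord0)))
  (c (lift ord0 (lift ord0 ord0)))) (scontZ (- (3 / 2)) (class1_cont h)).
congr scont; apply/funext => g; rewrite /dirac_op !big_ord_recl big_ord0 addr0.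
by rewrite scaleNr !addrA.
Qed.

(** X_k is skew under the integral and the constant matrix [frame R k] is skew pointwise; they
    commute, so their composite is symmetric. *)
Lemma dirac_symmetric psi phi : class1 psi -> class1 phi ->
  spinor_dot (dirac_op psi) phi = spinor_dot psi (dirac_op phi).
Proof.
move=> h1 h2; have c1 := class1_cont h1; have c2 := class1_cont h2.
have cl1 k : scont (lieD k psi) by have [] := class1_lieD k h1.
have cl2 k : scont (lieD k phi) by have [] := class1_lieD k h2.
have cf1 k : scont (fun g => frame R k *m lieD k psi g) by exact: scontM.
have cf2 k : scont (fun g => frame R k *m lieD k phi g) by exact: scontM.
have s k : spinor_dot (fun g => frame R k *m lieD k psi g) phi =
    spinor_dot psi (fun g => frame R k *m lieD k phi g).
  have hf : class1 (fun g => frame R k *m phi g).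
    split=> [|l]; first exact: scontM.
    have [d c] := class1_lieD l h2; exists (fun g => frame R k *m lieD l phi g).
    by split; [exact: is_slderM|exact: scontM].
  rewrite spinor_dot_frame// spinor_dot_lieD// opprK; congr spinor_dot.
  have [d _] := class1_lieD k h2.
  by have [_ ->] := is_slder_lieD (is_slderM (frame R k) d).
pose k0 : 'I_3 := ord0; pose k1 : 'I_3 := lift ord0 ord0.
pose k2 : 'I_3 := lift ord0 (lift ord0 ord0).
have e (chi : spinor_fun R) : dirac_op chi = fun g => (frame R k0 *m lieD k0 chi g +
   frame R k1 *m lieD k1 chi g + frame R k2 *m lieD k2 chi g) + (- (3 / 2))%:C *: chi g.
  apply/funext => g; rewrite /dirac_op !big_ord_recl big_ord0 addr0 !addrA.
  congr (_ + _); rewrite -scaleNr; congr (_ *: _).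
  by rewrite rmorphN rmorphM fmorphV !rmorph_nat.
have cN c (chi : spinor_fun R) : scont chi -> scont (fun g => c%:C *: chi g).
  exact: scontZ.
have D4 (F0 F1 F2 F3 w : spinor_fun R) (c : R) : scont F0 -> scont F1 -> scont F2 ->
    scont F3 -> scont w ->
    spinor_dot (fun g => F0 g + F1 g + F2 g + c%:C *: F3 g) w =
    spinor_dot F0 w + spinor_dot F1 w + spinor_dot F2 w + c * spinor_dot F3 w.
  move=> h0 h1' h2' h3 hw.
  rewrite (spinor_dotDl (scontD (scontD h0 h1') h2') (cN c _ h3) hw).
  by rewrite (spinor_dotDl (scontD h0 h1') h2' hw) (spinor_dotDl h0 h1' hw) spinor_dotZl.
rewrite !e [RHS]spinor_dotC.
rewrite (D4 _ _ _ _ _ _ (cf1 k0) (cf1 k1) (cf1 k2) c1 c2).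
rewrite (D4 _ _ _ _ _ _ (cf2 k0) (cf2 k1) (cf2 k2) c2 c1).
congr (_ + _ + _ + _ * _); last exact: spinor_dotC.
- exact: (etrans (s k0) (spinor_dotC _ _)).
- exact: (etrans (s k1) (spinor_dotC _ _)).
- exact: (etrans (s k2) (spinor_dotC _ _)).
Qed.

End dirac_symmetric.

(** * Eigenspinors from binary forms *)

Section eigenspinors.
Context {R : realType}.
Notation SU := (SU2 R).
Notation C := R[i].
Notation PC := {poly R[i]}.

Lemma su2_det (g : SU) : val g 0 0 * val g 1 1 - val g 0 1 * val g 1 0 = 1.
Proof.
have : \det (val g) = 1 by case: g => g /= /andP[_ /eqP].
rewrite (expand_det_row _ 0) !big_ord_recl big_ord0 /cofactor !det_mx11 !mxE /=.
move=> <-; rewrite expr0 expr1 mul1r mulN1r mulrN addr0.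
by congr (_ * val g _ _ - val g _ _ * val g _ _); exact/val_inj.
Qed.

Lemma su2_unitmx (g : SU) : val g \in unitmx.
Proof. by rewrite unitmxE; case: g => x /= /andP[_ /eqP ->]; rewrite unitr1. Qed.

Lemma mx22E (A : 'M[C]_2) : A = mx22 (A 0 0) (A 0 1) (A 1 0) (A 1 1).
Proof.
by apply/matrixP => i j; rewrite mxE; have [->|->] := ord2P i; have [->|->] := ord2P j.
Qed.

Lemma su2_inv (g : SU) :
  invmx (val g) = mx22 (val g 1 1) (- val g 0 1) (- val g 1 0) (val g 0 0).
Proof.
rewrite -[LHS]mulmx1; apply: (canLR (mulKmx (su2_unitmx g))).
have d := su2_det g; rewrite [X in _ = X *m _]mx22E mx22M.
by rewrite [LHS]mx22E !mxE /=; congr mx22; rewrite -?d; ring.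
Qed.

Lemma eq_coef (P Q : PC) i : P = Q -> P`_i = Q`_i.
Proof. by move=> ->. Qed.

Definition rowA (M : 'M[C]_2) : PC := (M 0 0)%:P * 'X + (M 1 0)%:P.
Definition rowB (M : 'M[C]_2) : PC := (M 0 1)%:P * 'X + (M 1 1)%:P.

(** [val g 0 0] and [val g 0 1] are the derivatives of A = [rowA] and B = [rowB], so this is their
    Wronskian, equal to det g. It removes the entries of [g] from the computations below. *)
Lemma row_wronskian (g : SU) :
  (val g 0 0)%:P * rowB (val g) - (val g 0 1)%:P * rowA (val g) = 1.
Proof.
have /(congr1 polyC) := su2_det g; rewrite polyCB !polyCM polyC1 => d.
by rewrite -d /rowA /rowB; ring.
Qed.

(* The value at (a, b) of the binary form of degree n with dehomogenization Q. *)
Definition hform n (Q : PC) (a b : PC) : PC :=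
  \sum_(j < n.+1) (Q`_j)%:P * (a ^+ j * b ^+ (n - j)).

Lemma hformXn n j a b : (j <= n)%N -> hform n 'X^j a b = a ^+ j * b ^+ (n - j).
Proof.
move=> jn; have jn' : (j < n.+1)%N by [].
rewrite /hform (bigD1 (Ordinal jn')) //= coefXn eqxx mul1r big1 ?addr0// => i ij.
rewrite coefXn; case: eqP => [e|]; last by rewrite mul0r.
by case/eqP: ij; exact/val_inj.
Qed.

Lemma hformD n P Q a b : hform n (P + Q) a b = hform n P a b + hform n Q a b.
Proof. by rewrite -big_split; apply: eq_bigr => j _; rewrite coefD polyCD mulrDl. Qed.

Lemma hformZ n c P a b : hform n (c *: P) a b = c%:P * hform n P a b.
Proof.
by rewrite /hform mulr_sumr; apply: eq_bigr => j _; rewrite coefZ polyCM -mulrA.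
Qed.

Definition rowform n Q (M : 'M[C]_2) : PC := hform n Q (rowA M) (rowB M).

(* The spinor fields [coef_i (eta^# q(eta))] (eigenvalue 3/2 + n) and
   [coef_i (grad q)(eta)] (eigenvalue -(1/2 + n)), where eta = (X, 1) g and q is
   the binary form of degree n with coefficients Q; multiplied by g they only
   involve the coefficients of q(eta). *)
Definition espinor (b : bool) n i Q : spinor_fun R := fun g =>
  let G := rowform n Q (val g) in
  invmx (val g) *m \col_k
    if b then (if k == 0 then - G`_i else ('X * G)`_i)
    else (if k == 0 then (G^`())`_i else (n%:R%:P * G - 'X * G^`())`_i).

Definition eigval (b : bool) (n : nat) : R := if b then 3 / 2 + n%:R else - (1 / 2 + n%:R).

Lemma mx22_col (a b c d : C) (x : 'cV[C]_2) : mx22 a b c d *m x =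
  \col_k if k == 0 then a * x 0 0 + b * x 1 0 else c * x 0 0 + d * x 1 0.
Proof.
apply/matrixP => i j; rewrite (ord1 j) !mxE !big_ord_recl big_ord0 addr0 !mxE /=.
have -> : lift ord0 ord0 = 1 :> 'I_2 by exact/val_inj.
by case: (i == 0).
Qed.

Lemma espinor_plusE n i Q g : espinor true n i Q g = \col_k
  if k == 0 then (- (rowB (val g) * rowform n Q (val g)))`_i
  else (rowA (val g) * rowform n Q (val g))`_i.
Proof.
rewrite /espinor su2_inv mx22_col; apply/matrixP => k l; rewrite !mxE /=.
set G := rowform _ _ _; case: (k == 0); rewrite /rowA /rowB -?coefN -!coefCM -coefD;
  apply: eq_coef; rewrite ?polyCN; ring.
Qed.

Lemma espinor_minusE n i Q g : espinor false n i Q g = \col_k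
  let G := rowform n Q (val g) in
  if k == 0 then (rowB (val g) * G^`() - (n%:R * val g 0 1)%:P * G)`_i
  else ((n%:R * val g 0 0)%:P * G - rowA (val g) * G^`())`_i.
Proof.
rewrite /espinor su2_inv mx22_col; apply/matrixP => k l; rewrite !mxE /=.
set G := rowform _ _ _; case: (k == 0); rewrite /rowA /rowB -?coefN -!coefCM -coefD;
  apply: eq_coef; rewrite ?polyCN !polyCM; ring.
Qed.

Lemma deriv_rowA M : (rowA M)^`() = (M 0 0)%:P.
Proof. by rewrite /rowA derivD derivC addr0 derivM derivC mul0r add0r derivX mulr1. Qed.

Lemma deriv_rowB M : (rowB M)^`() = (M 0 1)%:P.
Proof. by rewrite /rowB derivD derivC addr0 derivM derivC mul0r add0r derivX mulr1. Qed.

(** The factor j takes care of j = 0, where [j.-1] is 0 as well. *)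
Lemma natr_exp_pred (a : PC) j : j%:R * (a * a ^+ j.-1) = j%:R * a ^+ j.
Proof. by case: j => [|j]; [rewrite !mul0r|rewrite -exprS]. Qed.

Lemma deriv_mono M j m : (rowA M ^+ j * rowB M ^+ m)^`() =
  j%:R * rowA M ^+ j.-1 * (M 0 0)%:P * rowB M ^+ m +
  rowA M ^+ j * (m%:R * rowB M ^+ m.-1 * (M 0 1)%:P).
Proof.
rewrite derivM !deriv_exp deriv_rowA deriv_rowB.
rewrite -(mulr_natl (_ * rowA M ^+ _)) -(mulr_natl (_ * rowB M ^+ _)).
move: (rowA M ^+ j.-1) (rowB M ^+ m.-1) (rowA M ^+ j) (rowB M ^+ m) => a' b' a b.
by move: (M 0 0)%:P (M 0 1)%:P (j%:R) (m%:R) => z w x y; ring.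
Qed.

(** The components are the partial derivatives of x^j y^m at (A, B). In B G' - n w G, with G = A^j
    B^m and w the derivative of B, the derivative in y cancels and the derivative in x is multiplied
    by the Wronskian; the other component is similar. *)
Lemma espinor_minus_mono j m i g : espinor false (j + m) i 'X^j g = \col_k
  if k == 0 then (j%:R * rowA (val g) ^+ j.-1 * rowB (val g) ^+ m)`_i
  else (m%:R * rowA (val g) ^+ j * rowB (val g) ^+ m.-1)`_i.
Proof.
rewrite espinor_minusE; apply/matrixP => k l; rewrite !mxE /= /rowform.
rewrite hformXn ?leq_addr// addKn deriv_mono.
have W := row_wronskian g; have eA := natr_exp_pred (rowA (val g)) j.
have eB := natr_exp_pred (rowB (val g)) m.
rewrite !polyCM polyC_natr natrD.
move: (rowA _) (rowB _) (val g 0 0)%:P (val g 0 1)%:P W eA eB => A B z w W.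
move: (A ^+ j) (A ^+ j.-1) (B ^+ m) (B ^+ m.-1) => a a' b b'.
move: (j%:R) (m%:R) => x y eA eB.
case: (k == 0); apply: eq_coef.
  (* The summands isolate the Wronskian and the relations [eA], [eB] as factors that can be
     rewritten. *)
  transitivity ((x * a' * b) * (z * B - w * A) + w * a * (y * (B * b') - y * b)
     + w * b * (x * (A * a') - x * a)); first by ring.
  by rewrite W eA eB; ring.
transitivity ((y * a * b') * (z * B - w * A) - z * a * (y * (B * b') - y * b)
   - z * b * (x * (A * a') - x * a)); first by ring.
by rewrite W eA eB; ring.
Qed.

Definition is_pder k (F F' : SU -> PC) :=
  forall i, is_clder k (fun g => (F g)`_i) (fun g => (F' g)`_i).

Lemma is_clder_ext k (f f' h h' : SU -> C) : f =1 h -> f' =1 h' ->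
  is_clder k f f' -> is_clder k h h'.
Proof. by move=> /funext -> /funext ->. Qed.

Lemma is_clder_sum k n (f f' : nat -> SU -> C) : (forall i, is_clder k (f i) (f' i)) ->
  is_clder k (fun g => \sum_(i < n) f i g) (fun g => \sum_(i < n) f' i g).
Proof.
move=> h; elim: n => [|n IH].
  by apply: is_clder_ext (is_clder_cst k 0) => g; rewrite big_ord0.
by apply: is_clder_ext (is_clderD IH (h n)) => g; rewrite big_ord_recr.
Qed.

Lemma is_pderD k F F' H H' : is_pder k F F' -> is_pder k H H' ->
  is_pder k (fun g => F g + H g) (fun g => F' g + H' g).
Proof.
by move=> h1 h2 i; apply: is_clder_ext (is_clderD (h1 i) (h2 i)) => g; rewrite coefD.
Qed.

Lemma is_pderM k F F' H H' : is_pder k F F' -> is_pder k H H' ->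
  is_pder k (fun g => F g * H g) (fun g => F' g * H g + F g * H' g).
Proof.
move=> h1 h2 i.
have := @is_clder_sum k i.+1 (fun j g => (F g)`_j * (H g)`_(i - j)) _
  (fun j => is_clderM (h1 j) (h2 (i - j)%N)).
by apply: is_clder_ext => g; rewrite ?coefD !coefM ?big_split.
Qed.

Lemma is_pder_cst k P : is_pder k (fun=> P) (fun=> 0).
Proof. by move=> i; apply: is_clder_ext (is_clder_cst k P`_i) => g //; rewrite coef0. Qed.

Lemma is_pderX k F F' n : is_pder k F F' ->
  is_pder k (fun g => F g ^+ n) (fun g => n%:R * F g ^+ n.-1 * F' g).
Proof.
move=> h; elim: n => [|n IH].
  have := is_pder_cst k 1; congr is_pder; apply/funext => g; by rewrite !mul0r.
have := is_pderM h IH; congr is_pder; apply/funext => g; first by rewrite exprS.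
case: n {IH} => [|n] /=; first by rewrite !mul0r mulr0 addr0 expr0 !(mulr1, mul1r).
rewrite !exprS -[n.+2%:R]natr1.
by move: (F g ^+ n) (F g) (F' g) (n.+1%:R) => a b c d; ring.
Qed.

Lemma is_clder_entry k i j : is_clder k (fun g : SU => val g i j)
  (fun g => (val g *m frame R k) i j).
Proof.
have e (t : R) (g : SU) : val (expmul k t g) i j =
   (cos t)%:C * val g i j + (sin t)%:C * (val g *m frame R k) i j.
  by rewrite /= mulmxDr -!scalemxAr mulmx1 !mxE.
have dc (a b : R) : is_derive (0 : R) (1 : R) (fun t : R => cos t * a + sin t * b) b.
  have h1 := @is_derive_cos R 0; have h2 := @is_derive_sin R 0.
  have ha := @is_derive_cst R R R a 0 1; have hb := @is_derive_cst R R R b 0 1.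
  have := is_deriveD (is_deriveM h1 ha) (is_deriveM h2 hb).
  move=> h; apply: (is_derive_eq h).
  by rewrite sin0 cos0 /GRing.scale /=; ring.
split=> g.
  rewrite (_ : (fun t : R => _) = (fun t : R => cos t * complex.Re (val g i j)
     + sin t * complex.Re ((val g *m frame R k) i j))); first exact: dc.
  apply/funext => t; rewrite e; case: (val g i j) (mulmx _ _ i j) => a b [c d] /=.
  by ring.
rewrite (_ : (fun t : R => _) = (fun t : R => cos t * complex.Im (val g i j)
     + sin t * complex.Im ((val g *m frame R k) i j))); first exact: dc.
apply/funext => t; rewrite e; case: (val g i j) (mulmx _ _ i j) => a b [c d] /=.
by ring.
Qed.

(** Right multiplication by [frame R k] is a linear substitution of the pair (A, B), so the
    polynomials in A and B of a fixed degree are stable under X_k. *)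
Lemma is_pder_row k (j : 'I_2) : is_pder k
  (fun g => (val g 0 j)%:P * 'X + (val g 1 j)%:P)
  (fun g => (frame R k 0 j)%:P * rowA (val g) + (frame R k 1 j)%:P * rowB (val g)).
Proof.
have c (f f' : SU -> C) : is_clder k f f' -> is_pder k (fun g => (f g)%:P) (fun g => (f' g)%:P).
  move=> h [|i]; first by apply: is_clder_ext h => g; rewrite coefC.
  by apply: is_clder_ext (is_clder_cst k 0) => g; rewrite coefC.
have := is_pderD (is_pderM (c _ _ (is_clder_entry k 0 j)) (is_pder_cst k 'X))
  (c _ _ (is_clder_entry k 1 j)).
congr is_pder; apply/funext => g.
rewrite mulr0 addr0 !mxE !big_ord_recl !big_ord0 !addr0 !polyCD !polyCM /rowA /rowB.
have -> : lift ord0 ord0 = 1 :> 'I_2 by exact/val_inj.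
have -> : ord0 = 0 :> 'I_2 by [].
ring.
Qed.

Lemma is_pder_rowA k : is_pder k (fun g => rowA (val g))
  (fun g => (frame R k 0 0)%:P * rowA (val g) + (frame R k 1 0)%:P * rowB (val g)).
Proof. exact: is_pder_row. Qed.

Lemma is_pder_rowB k : is_pder k (fun g => rowB (val g))
  (fun g => (frame R k 0 1)%:P * rowA (val g) + (frame R k 1 1)%:P * rowB (val g)).
Proof. exact: is_pder_row. Qed.

Lemma is_pderZ k c F F' : is_pder k F F' -> is_pder k (fun g => c * F g) (fun g => c * F' g).
Proof.
move=> h; have := is_pderM (is_pder_cst k c) h; congr is_pder.
by apply/funext => g; rewrite mul0r add0r.
Qed.

Definition coef_spinor i (F0 F1 : SU -> PC) : spinor_fun R := fun g =>
  \col_(k < 2) if k == 0 then (F0 g)`_i else (F1 g)`_i.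

Lemma is_slder_coef k i F0 F0' F1 F1' : is_pder k F0 F0' -> is_pder k F1 F1' ->
  is_slder k (coef_spinor i F0 F1) (coef_spinor i F0' F1').
Proof.
move=> h0 h1 j; have [->|->] := ord2P j.
  by apply: is_clder_ext (h0 i) => g; rewrite mxE.
by apply: is_clder_ext (h1 i) => g; rewrite mxE.
Qed.

(** The summand -3/2 of D is moved to the other side: the matrix part, the sum of the [frame R k]
    X_k, must have eigenvalue c + 3/2. *)
Lemma dirac_coef i (c : R) F0 F1 (F0' F1' : 'I_3 -> SU -> PC) :
  (forall k, is_pder k F0 (F0' k)) -> (forall k, is_pder k F1 (F1' k)) ->
  (forall g, \sum_k ((frame R k 0 0)%:P * F0' k g + (frame R k 0 1)%:P * F1' k g) =
     ((c + 3 / 2)%:C)%:P * F0 g) ->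
  (forall g, \sum_k ((frame R k 1 0)%:P * F0' k g + (frame R k 1 1)%:P * F1' k g) =
     ((c + 3 / 2)%:C)%:P * F1 g) ->
  forall g, dirac_op (coef_spinor i F0 F1) g = c%:C *: coef_spinor i F0 F1 g.
Proof.
move=> d0 d1 e0 e1 g; rewrite /dirac_op.
have e k : lieD k (coef_spinor i F0 F1) = coef_spinor i (F0' k) (F1' k).
  by have [_ ->] := is_slder_lieD (is_slder_coef i (d0 k) (d1 k)).
have -> : 3 / 2 = (3 / 2 : R)%:C by rewrite rmorphM fmorphV !rmorph_nat.
apply/eqP; rewrite subr_eq -scalerDl -rmorphD; apply/eqP.
apply/matrixP => j l; rewrite (ord1 l) summxE mxE.
under eq_bigr do rewrite e mxE !big_ord_recl big_ord0 addr0.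
have l1 : lift ord0 ord0 = 1 :> 'I_2 by exact/val_inj.
have [->|->] := ord2P j; rewrite mxE /= -coefCM.
  by rewrite -e0 coef_sum; apply: eq_bigr => k _; rewrite coefD !coefCM !mxE l1.
by rewrite -e1 coef_sum; apply: eq_bigr => k _; rewrite coefD !coefCM !mxE l1.
Qed.

Lemma imag_polyC_sqr : ('i%C : C)%:P * ('i%C)%:P = -1.
Proof. by rewrite -polyCM -expr2 sqr_i polyCN polyC1. Qed.
End eigenspinors.

(** * The eigenvalue equation on monomials *)

Section eigenspinor_equation.
Context {R : realType}.
Notation SU := (SU2 R).
Notation C := R[i].
Notation PC := {poly R[i]}.

Lemma is_pder_ext k (F F' H H' : SU -> PC) : F =1 H -> F' =1 H' ->
  is_pder k F F' -> is_pder k H H'.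
Proof. by move=> /funext -> /funext ->. Qed.

Lemma is_pder_mono k j m : is_pder k
  (fun g : SU => rowA (val g) ^+ j * rowB (val g) ^+ m)
  (fun g => let A := rowA (val g) in let B := rowB (val g) in
    j%:R * A ^+ j.-1 * B ^+ m * ((frame R k 0 0)%:P * A + (frame R k 1 0)%:P * B) +
    m%:R * A ^+ j * B ^+ m.-1 * ((frame R k 0 1)%:P * A + (frame R k 1 1)%:P * B)).
Proof.
apply: is_pder_ext (is_pderM (is_pderX j (is_pder_rowA k)) (is_pderX m (is_pder_rowB k))) => g //=.
move: (rowA (val g) ^+ _) (rowA (val g) ^+ _) (rowB (val g) ^+ _) (rowB (val g) ^+ _).
move=> a' a b' b; move: (rowA (val g)) (rowB (val g)) => A B.
move: (j%:R) (m%:R) (frame R k 0 0)%:P (frame R k 0 1)%:P (frame R k 1 0)%:P (frame R k 1 1)%:P.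
by move=> x y c00 c01 c10 c11; ring.
Qed.

Lemma frame_entries k : frame R k = match val k with
  | 0 => mx22 'i 0 0 (- 'i) | 1 => mx22 0 1 (- 1) 0 | _ => mx22 0 'i 'i 0 end.
Proof. exact: frameE. Qed.

Lemma real_complex_natD (n : nat) : ((n%:R : R)%:C)%:P = n%:R :> PC.
Proof. by rewrite rmorph_nat polyC_natr. Qed.

Lemma real_complexB_polyC (a b : R) : ((a - b)%:C)%:P = (a%:C)%:P - (b%:C)%:P :> PC.
Proof. by rewrite -polyCB; congr polyC; exact: rmorphB. Qed.

Lemma espinor_plus_mono j m i g : espinor true (j + m) i 'X^j g = coef_spinor i
  (fun g : SU => - 1%:P * (rowA (val g) ^+ j * rowB (val g) ^+ m.+1))
  (fun g : SU => rowA (val g) ^+ j.+1 * rowB (val g) ^+ m) g.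
Proof.
rewrite espinor_plusE; apply/matrixP => k l; rewrite !mxE /rowform.
rewrite hformXn ?leq_addr// addKn !exprS.
move: (rowA (val g) ^+ _) (rowB (val g) ^+ _) => a b; move: (rowA _) (rowB _) => A B.
by case: (k == 0); apply: eq_coef; rewrite ?polyC1; ring.
Qed.

Lemma dirac_espinor_plus_mono j m i g :
  dirac_op (espinor true (j + m) i 'X^j) g =
  (eigval true (j + m) : R)%:C *: espinor true (j + m) i ('X^j : PC) g.
Proof.
have -> : espinor true (j + m) i ('X^j : PC) = coef_spinor i
  (fun g : SU => - 1%:P * (rowA (val g) ^+ j * rowB (val g) ^+ m.+1))
  (fun g : SU => rowA (val g) ^+ j.+1 * rowB (val g) ^+ m).
  by apply/funext => h; exact: espinor_plus_mono.
have ce : ((eigval true (j + m) + 3 / 2)%:C)%:P = 3 + j%:R + m%:R :> PC.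
  rewrite (_ : eigval true (j + m) + 3 / 2 = (3 + j + m)%:R :> R) ?real_complex_natD ?natrD//.
  by rewrite /eigval !natrD; field.
have hJ := @imag_polyC_sqr R.
apply: dirac_coef => [k|k|{}g|{}g].
- by apply: is_pderZ; exact: is_pder_mono.
- exact: is_pder_mono.
- rewrite ce; move: (val g) => M; rewrite !big_ord_recl big_ord0 addr0 !frame_entries /= !mxE /=.
  have eA := natr_exp_pred (rowA M) j; have eB := natr_exp_pred (rowB M) m.
  move: hJ eA eB; rewrite !(polyC0, polyCN, polyC1) !exprS -[m.+1%:R]natr1 -[j.+1%:R]natr1.
  move: (rowA M ^+ j) (rowA M ^+ j.-1) (rowB M ^+ m) (rowB M ^+ m.-1) => a a' b b'.
  move: (rowA M) (rowB M) (j%:R) (m%:R) ('i%C)%:P => A B x y J {}hJ eA eB.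
  by ring: hJ eA eB.
- rewrite ce; move: (val g) => M; rewrite !big_ord_recl big_ord0 addr0 !frame_entries /= !mxE /=.
  have eA := natr_exp_pred (rowA M) j; have eB := natr_exp_pred (rowB M) m.
  move: hJ eA eB; rewrite !(polyC0, polyCN, polyC1) !exprS -[m.+1%:R]natr1 -[j.+1%:R]natr1.
  move: (rowA M ^+ j) (rowA M ^+ j.-1) (rowB M ^+ m) (rowB M ^+ m.-1) => a a' b b'.
  move: (rowA M) (rowB M) (j%:R) (m%:R) ('i%C)%:P => A B x y J {}hJ eA eB.
  by ring: hJ eA eB.
Qed.

Lemma dirac_espinor_minus_mono j m i g : (0 < j + m)%N ->
  dirac_op (espinor false (j + m) i 'X^j) g =
  (eigval false (j + m) : R)%:C *: espinor false (j + m) i ('X^j : PC) g.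
Proof.
move=> jm0.
have -> : espinor false (j + m) i ('X^j : PC) = coef_spinor i
  (fun g : SU => j%:R * (rowA (val g) ^+ j.-1 * rowB (val g) ^+ m))
  (fun g : SU => m%:R * (rowA (val g) ^+ j * rowB (val g) ^+ m.-1)).
  apply/funext => h; rewrite espinor_minus_mono; apply/matrixP => k l; rewrite !mxE.
  by rewrite !mulrA.
have ce : ((eigval false (j + m) + 3 / 2)%:C)%:P = 1 - j%:R - m%:R :> PC.
  rewrite (_ : eigval false (j + m) + 3 / 2 = 1 - j%:R - m%:R :> R).
    by rewrite !real_complexB_polyC (real_complex_natD 1) !real_complex_natD.
  by rewrite /eigval !natrD; field.
have hJ := @imag_polyC_sqr R.
have pp (x : PC) n : n%:R * n.-1%:R * (x * x ^+ n.-2) = n%:R * (n%:R - 1) * x ^+ n.-1.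
  rewrite -mulrA natr_exp_pred; case: n => [|n]; first by rewrite !mul0r.
  by rewrite /= -[in X in X - 1]natr1 addrK mulrA.
apply: dirac_coef => [k|k|{}g|{}g].
- by apply: is_pderZ; exact: is_pder_mono.
- by apply: is_pderZ; exact: is_pder_mono.
- rewrite ce; move: (val g) => M; rewrite !big_ord_recl big_ord0 addr0 !frame_entries /= !mxE /=.
  have eA := natr_exp_pred (rowA M) j; have eB := natr_exp_pred (rowB M) m.
  have eAA := pp (rowA M) j.
  move: hJ eA eB eAA; rewrite !(polyC0, polyCN, polyC1).
  move: (rowA M ^+ j) (rowA M ^+ j.-1) (rowA M ^+ j.-2) => a a' a2.
  move: (rowB M ^+ m) (rowB M ^+ m.-1) => b b'.
  move: (rowA M) (rowB M) => A B; move: (j.-1%:R) (m.-1%:R) (j%:R) (m%:R) (B ^+ m.-2) => x' y' x y b2.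
  move: ('i%C)%:P => J {}hJ eA eB eAA.
  (* The second derivative in y enters with the factor 1 + J^2 = 0; [eAA] treats the one in x. *)
  transitivity ((J * J) * (x * x' * (A * a2)) * b - (J * J) * x * a' * (y * (B * b'))
    - x * a' * (y * (B * b')) + y * y' * a * b2 * A * (1 + J * J)
    + (J * J) * x * a' * (y * (B * b'))); first by ring.
  by rewrite hJ eB eAA; ring.
- rewrite ce; move: (val g) => M; rewrite !big_ord_recl big_ord0 addr0 !frame_entries /= !mxE /=.
  have eA := natr_exp_pred (rowA M) j; have eB := natr_exp_pred (rowB M) m.
  have eBB := pp (rowB M) m.
  move: hJ eA eB eBB; rewrite !(polyC0, polyCN, polyC1).
  move: (rowA M ^+ j) (rowA M ^+ j.-1) => a a'.
  move: (rowB M ^+ m) (rowB M ^+ m.-1) (rowB M ^+ m.-2) => b b' b2.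
  move: (rowA M) (rowB M) => A B; move: (m.-1%:R) (j.-1%:R) (j%:R) (m%:R) (A ^+ j.-2) => y' x' x y a2.
  move: ('i%C)%:P => J {}hJ eA eB eBB.
  transitivity (- (J * J) * y * b' * (x * (A * a')) + (J * J) * (y * y' * (B * b2)) * a
    + x * x' * a2 * b * B * (1 + J * J) - y * b' * (x * (A * a'))
    + (J * J) * y * b' * (x * (A * a'))); first by ring.
  by rewrite hJ eA eBB; ring.
Qed.
End eigenspinor_equation.

(** * Polynomial spinors *)

Section polynomial_spinors.
Context {R : realType}.
Notation SU := (SU2 R).
Notation C := R[i].
Notation PC := {poly R[i]}.

Inductive cpoly : (SU -> C) -> Prop :=
| cpoly_cst a : cpoly (fun=> a)
| cpoly_entry i j : cpoly (fun g => val g i j)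
| cpolyD f h : cpoly f -> cpoly h -> cpoly (fun g => f g + h g)
| cpolyM f h : cpoly f -> cpoly h -> cpoly (fun g => f g * h g).

Lemma cpoly_ext f h : f =1 h -> cpoly f -> cpoly h.
Proof. by move=> /funext ->. Qed.

Lemma cpoly_sum n (f : nat -> SU -> C) : (forall i, cpoly (f i)) ->
  cpoly (fun g => \sum_(i < n) f i g).
Proof.
move=> h; elim: n => [|n IH].
  by apply: cpoly_ext (cpoly_cst 0) => g; rewrite big_ord0.
by apply: cpoly_ext (cpolyD IH (h n)) => g; rewrite big_ord_recr.
Qed.

Lemma cpoly_der k f : cpoly f -> exists2 f', is_clder k f f' & cpoly f'.
Proof.
elim=> [a|i j|h1 h2 _ [d1 e1 c1] _ [d2 e2 c2]|h1 h2 p1 [d1 e1 c1] p2 [d2 e2 c2]].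
- by exists (fun=> 0); [exact: is_clder_cst|exact: cpoly_cst].
- exists (fun g => (val g *m frame R k) i j); first exact: is_clder_entry.
  have := cpolyD (cpolyM (cpoly_entry i 0) (cpoly_cst (frame R k 0 j)))
    (cpolyM (cpoly_entry i 1) (cpoly_cst (frame R k 1 j))).
  apply: cpoly_ext => g; rewrite mxE !big_ord_recl big_ord0 addr0.
  by have -> : lift ord0 ord0 = 1 :> 'I_2 by exact/val_inj.
- by exists (fun g => d1 g + d2 g); [exact: is_clderD|exact: cpolyD].
- exists (fun g => d1 g * h2 g + h1 g * d2 g); first exact: is_clderM.
  by apply: cpolyD; exact: cpolyM.
Qed.

Lemma ccont_entry i j : ccont (fun g : SU => val g i j).
Proof.
have h := fun g => (cvg_mxP (fun g : SU => val g : 'M[R[i]^o]_2) g).1 (@val_continuous R g) i j.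
by split=> g; have [] := (cvg_complexP (fun g : SU => val g i j : R[i]^o) g).1 (h g).
Qed.

Lemma cpoly_cont f : cpoly f -> ccont f.
Proof.
elim=> [a|i j|h1 h2 _ c1 _ c2|h1 h2 _ c1 _ c2].
- exact: ccont_cst.
- exact: ccont_entry.
- exact: ccontD.
- exact: ccontM.
Qed.

Definition spoly (psi : spinor_fun R) := forall j, cpoly (fun g => psi g j 0).

Lemma spoly_der k psi : spoly psi -> exists2 psi', is_slder k psi psi' & spoly psi'.
Proof.
move=> h; have [d0 e0 p0] := cpoly_der k (h 0); have [d1 e1 p1] := cpoly_der k (h 1).
exists (fun g => \col_j if j == 0 then d0 g else d1 g) => j; have [->|->] := ord2P j.
- by apply: is_clder_ext e0 => g //; rewrite mxE.
- by apply: is_clder_ext e1 => g //; rewrite mxE.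
- by apply: cpoly_ext p0 => g; rewrite mxE.
- by apply: cpoly_ext p1 => g; rewrite mxE.
Qed.

Lemma spoly_smooth psi : spoly psi -> smooth psi.
Proof.
move=> h n; elim: n psi h => [|n IH] psi h; (split; first by apply/spinor_continuousP => j;
  exact: cpoly_cont) => //.
move=> k; have [psi' d p] := spoly_der k h; have [hd e] := is_slder_lieD d.
by split=> //; rewrite e; exact: IH.
Qed.

Lemma spoly_class1 psi : spoly psi -> class1 psi.
Proof. by move=> /spoly_smooth /(_ 1%N); exact: class_C1. Qed.

Lemma smooth_class1 (psi : spinor_fun R) : smooth psi -> class1 psi.
Proof. by move=> /(_ 1%N); exact: class_C1. Qed.

Definition ppoly (F : SU -> PC) := forall i, cpoly (fun g => (F g)`_i).

Lemma ppoly_ext F H : F =1 H -> ppoly F -> ppoly H.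
Proof. by move=> /funext ->. Qed.

Lemma ppoly_cst P : ppoly (fun=> P).
Proof. by move=> i; exact: cpoly_cst. Qed.

Lemma ppolyD F H : ppoly F -> ppoly H -> ppoly (fun g => F g + H g).
Proof. by move=> h1 h2 i; apply: cpoly_ext (cpolyD (h1 i) (h2 i)) => g; rewrite coefD. Qed.

Lemma ppolyM F H : ppoly F -> ppoly H -> ppoly (fun g => F g * H g).
Proof.
move=> h1 h2 i; have := @cpoly_sum i.+1 _ (fun j => cpolyM (h1 j) (h2 (i - j)%N)).
by apply: cpoly_ext => g; rewrite coefM.
Qed.

Lemma ppolyX F n : ppoly F -> ppoly (fun g => F g ^+ n).
Proof.
move=> h; elim: n => [|n IH]; first exact: ppoly_cst.
by apply: ppoly_ext (ppolyM h IH) => g; rewrite exprS.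
Qed.

Lemma ppoly_row (j : 'I_2) :
  ppoly (fun g => (val g 0 j)%:P * 'X + (val g 1 j)%:P).
Proof.
have c i : ppoly (fun g : SU => (val g i j)%:P).
  move=> [|l]; first by apply: cpoly_ext (cpoly_entry i j) => g; rewrite coefC.
  by apply: cpoly_ext (cpoly_cst 0) => g; rewrite coefC.
by apply: ppolyD => //; apply: ppolyM => //; exact: ppoly_cst.
Qed.

Lemma ppoly_rowform n Q : ppoly (fun g => rowform n Q (val g)).
Proof.
suff h k m : ppoly (fun g => \sum_(j < k)
    (Q`_j)%:P * (rowA (val g) ^+ j * rowB (val g) ^+ (m - j))) by exact: h.
elim: k => [|k IH].
  by apply: ppoly_ext (ppoly_cst 0) => g; rewrite big_ord0.
have := ppolyD IH (ppolyM (ppoly_cst (Q`_k)%:P)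
  (ppolyM (ppolyX k (ppoly_row 0)) (ppolyX (m - k) (ppoly_row 1)))).
by apply: ppoly_ext => g; rewrite big_ord_recr.
Qed.

Lemma spoly_espinor b n i Q : spoly (espinor b n i Q).
Proof.
have cG := ppoly_rowform n Q.
have cN f : cpoly f -> cpoly (fun g => - f g).
  by move=> h; apply: cpoly_ext (cpolyM (cpoly_cst (-1)) h) => g; rewrite mulN1r.
have [f0 [f1 [p0 p1 e]]] : exists f0 f1, [/\ cpoly f0, cpoly f1 &
    forall g, espinor b n i Q g = invmx (val g) *m \col_k if k == 0 then f0 g else f1 g].
  case: b.
    exists (fun g => - (rowform n Q (val g))`_i), (fun g => ('X * rowform n Q (val g))`_i).
    by split=> //; [exact: cN|exact: (ppolyM (ppoly_cst 'X) cG)].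
  have cD : ppoly (fun g => (rowform n Q (val g))^`()).
    move=> l; apply: cpoly_ext (cpolyM (cG l.+1) (cpoly_cst l.+1%:R)) => g.
    by rewrite coef_deriv mulr_natr.
  exists (fun g => ((rowform n Q (val g))^`())`_i).
  exists (fun g => (n%:R%:P * rowform n Q (val g) - 'X * (rowform n Q (val g))^`())`_i).
  split=> //; have := ppolyD (ppolyM (ppoly_cst n%:R%:P) cG) (ppolyM (ppoly_cst (- 'X)) cD).
  by move/(_ i); apply: cpoly_ext => g; rewrite mulNr.
have h x y : cpoly x -> cpoly y -> cpoly (fun g => x g * f0 g + y g * f1 g).
  by move=> hx hy; apply: cpolyD; exact: cpolyM.
move=> j; have [->|->] := ord2P j.
  apply: cpoly_ext (h _ _ (cpoly_entry 1 1) (cN _ (cpoly_entry 0 1))) => g.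
  by rewrite e su2_inv mx22_col !mxE.
apply: cpoly_ext (h _ _ (cN _ (cpoly_entry 1 0)) (cpoly_entry 0 0)) => g.
by rewrite e su2_inv mx22_col !mxE.
Qed.

(* Clebsch-Gordan: the coefficients of A^j B^m span a space stable under
   multiplication by the entries of g, because (A^(j+1) B^m)' and
   (j + m + 1) z A^j B^m differ by a multiple of A^j B^(m-1). *)
Inductive fspan : (SU -> C) -> Prop :=
| fspan0 : fspan (fun=> 0)
| fspan_add c j m i f : fspan f ->
    fspan (fun g => c * (rowA (val g) ^+ j * rowB (val g) ^+ m)`_i + f g).

Lemma fspan_ext f h : f =1 h -> fspan f -> fspan h.
Proof. by move=> /funext ->. Qed.

Lemma fspanD f h : fspan f -> fspan h -> fspan (fun g => f g + h g).
Proof.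
move=> hf hh; elim: hf => [|c j m i f' _ IH].
  by apply: fspan_ext hh => g; rewrite add0r.
by apply: fspan_ext (fspan_add c j m i IH) => g; rewrite addrA.
Qed.

Lemma fspanZ c f : fspan f -> fspan (fun g => c * f g).
Proof.
elim=> [|d j m i f' _ IH]; first by apply: fspan_ext fspan0 => g; rewrite mulr0.
by apply: fspan_ext (fspan_add (c * d) j m i IH) => g; rewrite mulrDr mulrA.
Qed.

Lemma fspan_gen j m i : fspan (fun g => (rowA (val g) ^+ j * rowB (val g) ^+ m)`_i).
Proof.
by apply: fspan_ext (fspan_add 1 j m i fspan0) => g; rewrite mul1r addr0.
Qed.

Lemma mono_mulz (g : SU) j m :
  let A := rowA (val g) in let B := rowB (val g) in
  (j + m).+1%:R * ((val g 0 0)%:P * (A ^+ j * B ^+ m)) =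
  (A ^+ j.+1 * B ^+ m)^`() + m%:R * (A ^+ j * B ^+ m.-1).
Proof.
move=> A B; rewrite deriv_mono -/A -/B /= -natr1 natrD.
have W : _ = 1 := row_wronskian g; have eB := natr_exp_pred B m.
rewrite -/A -/B in W; rewrite exprS -[j.+1%:R]natr1.
move: (val g 0 0)%:P (val g 0 1)%:P W eB => z w.
move: (A ^+ j) (B ^+ m) (B ^+ m.-1) (j%:R) (m%:R) => a b b' x y; move: A B => A B W eB.
transitivity ((x + 1) * a * z * b + z * a * (y * b)); first by ring.
rewrite -eB; transitivity ((x + 1) * a * z * b + a * A * y * b' * w + y * a * b' * (z * B - w * A)).
  by ring.
by rewrite W; ring.
Qed.

Lemma mono_mulw (g : SU) j m :
  let A := rowA (val g) in let B := rowB (val g) in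
  (j + m).+1%:R * ((val g 0 1)%:P * (A ^+ j * B ^+ m)) =
  (A ^+ j * B ^+ m.+1)^`() - j%:R * (A ^+ j.-1 * B ^+ m).
Proof.
move=> A B; rewrite deriv_mono -/A -/B /= -natr1 natrD.
have W : _ = 1 := row_wronskian g; have eA := natr_exp_pred A j.
rewrite -/A -/B in W; rewrite exprS -[m.+1%:R]natr1.
move: (val g 0 0)%:P (val g 0 1)%:P W eA => z w.
move: (A ^+ j) (A ^+ j.-1) (B ^+ m) (j%:R) (m%:R) => a a' b x y; move: A B => A B W eA.
transitivity (w * b * (x * a) + (y + 1) * w * a * b); first by ring.
rewrite -eA; transitivity (x * a' * z * (B * b) + a * ((y + 1) * b * w) - x * a' * b * (z * B - w * A)).
  by ring.
by rewrite W; ring.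
Qed.

Lemma fspan_deriv j m i :
  fspan (fun g => ((rowA (val g) ^+ j * rowB (val g) ^+ m)^`())`_i).
Proof.
apply: fspan_ext (fspanZ i.+1%:R (fspan_gen j m i.+1)) => g.
by rewrite coef_deriv mulr_natl.
Qed.

Lemma natr_neq0 n : n.+1%:R != 0 :> C.
Proof. by rewrite pnatr_eq0. Qed.

Lemma fspan_mul_first (b : 'I_2) j m i :
  fspan (fun g => val g 0 b * (rowA (val g) ^+ j * rowB (val g) ^+ m)`_i).
Proof.
have [->|->] := ord2P b.
  have := fspanZ (j + m).+1%:R^-1
    (fspanD (fspan_deriv j.+1 m i) (fspanZ m%:R (fspan_gen j m.-1 i))).
  apply: fspan_ext => g; apply: (canLR (mulKf (natr_neq0 _))).
  have := congr1 (fun P : PC => P`_i) (mono_mulz g j m).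
  by rewrite -(polyC_natr _ (j + m).+1) -(polyC_natr _ m) coefD !coefCM => ->.
have := fspanZ (j + m).+1%:R^-1
  (fspanD (fspan_deriv j m.+1 i) (fspanZ (- j%:R) (fspan_gen j.-1 m i))).
apply: fspan_ext => g; apply: (canLR (mulKf (natr_neq0 _))).
have := congr1 (fun P : PC => P`_i) (mono_mulw g j m).
by rewrite -(polyC_natr _ (j + m).+1) -(polyC_natr _ j) coefB !coefCM mulNr => ->.
Qed.

(** The definition of A gives g_10 = A - g_00 X, and likewise for B, so the product reduces to a
    generator and to a first-row product with the coefficient index lowered by one. *)
Lemma fspan_mul_second (b : 'I_2) j m i :
  fspan (fun g => val g 1 b * (rowA (val g) ^+ j * rowB (val g) ^+ m)`_i).
Proof.
have h : fspan (fun g => - (if i is l.+1 then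
    val g 0 b * (rowA (val g) ^+ j * rowB (val g) ^+ m)`_l else 0)).
  case: i => [|l]; first by apply: fspan_ext fspan0 => g; rewrite oppr0.
  by apply: fspan_ext (fspanZ (-1) (fspan_mul_first b j m l)) => g; rewrite mulN1r.
have e (g : SU) : (if i is l.+1 then
    val g 0 b * (rowA (val g) ^+ j * rowB (val g) ^+ m)`_l else 0) =
    ((val g 0 b)%:P * 'X * (rowA (val g) ^+ j * rowB (val g) ^+ m))`_i.
  by rewrite -mulrA coefCM coefXM; case: i {h} => [|l]; rewrite ?mulr0.
have [e0|e1] := ord2P b; subst b.
  apply: fspan_ext (fspanD (fspan_gen j.+1 m i) h) => g; rewrite e -coefN -coefD -coefCM.
  apply: eq_coef; rewrite exprS; move: (rowA _ ^+ j) (rowB _ ^+ m) => x y.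
  by rewrite /rowA; ring.
apply: fspan_ext (fspanD (fspan_gen j m.+1 i) h) => g; rewrite e -coefN -coefD -coefCM.
apply: eq_coef; rewrite exprS; move: (rowA _ ^+ j) (rowB _ ^+ m) => x y.
by rewrite /rowB; ring.
Qed.

Lemma cpoly_fspan_mul f h : cpoly f -> fspan h -> fspan (fun g => f g * h g).
Proof.
move=> cf; elim: cf h => [a|a b|f1 f2 _ h1 _ h2|f1 f2 _ h1 _ h2] h sh.
- exact: fspanZ.
- elim: sh => [|c j m i f0 _ IH]; first by apply: fspan_ext fspan0 => g; rewrite mulr0.
  have s : fspan (fun g => val g a b * (rowA (val g) ^+ j * rowB (val g) ^+ m)`_i).
    by have [->|->] := ord2P a; [exact: fspan_mul_first|exact: fspan_mul_second].
  by apply: fspan_ext (fspanD (fspanZ c s) IH) => g; rewrite mulrDr mulrCA.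
- by apply: fspan_ext (fspanD (h1 _ sh) (h2 _ sh)) => g; rewrite mulrDl.
- by apply: fspan_ext (h1 _ (h2 _ sh)) => g; rewrite mulrA.
Qed.

Lemma cpoly_fspan f : cpoly f -> fspan f.
Proof.
move=> cf; have := cpoly_fspan_mul cf (fspan_gen 0 0 0).
by apply: fspan_ext => g; rewrite !expr0 mulr1 coefC mulr1.
Qed.

(** q(A, B) times a linear form has degree at most n + 1, a gradient has degree at most n - 1; for n
    = 0 the second family is empty. *)
Definition edim (b : bool) n := if b then n.+2 else n.

Inductive tspan : spinor_fun R -> Prop :=
| tspan0 : tspan (fun=> 0)
| tspan_add c b n i j psi : (j <= n)%N -> (i < edim b n)%N -> tspan psi ->
    tspan (fun g => c *: espinor b n i 'X^j g + psi g).

Lemma tspan_ext psi phi : psi =1 phi -> tspan psi -> tspan phi.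
Proof. by move=> /funext ->. Qed.

Lemma tspanD psi phi : tspan psi -> tspan phi -> tspan (fun g => psi g + phi g).
Proof.
move=> h1 h2; elim: h1 => [|c b n i j f jn ie _ IH].
  by apply: tspan_ext h2 => g; rewrite add0r.
by apply: tspan_ext (tspan_add c jn ie IH) => g; rewrite addrA.
Qed.

Lemma tspanZ c psi : tspan psi -> tspan (fun g => c *: psi g).
Proof.
elim=> [|d b n i j f jn ie _ IH]; first by apply: tspan_ext tspan0 => g; rewrite scaler0.
by apply: tspan_ext (tspan_add (c * d) jn ie IH) => g; rewrite scalerDr scalerA.
Qed.

Lemma tspan_gen b n i j : (j <= n)%N -> (i < edim b n)%N -> tspan (espinor b n i 'X^j).
Proof.
by move=> jn ie; apply: tspan_ext (tspan_add 1 jn ie tspan0) => g; rewrite scale1r addr0.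
Qed.

Lemma size_row_mono (M : 'M[C]_2) j m : (size (rowA M ^+ j * rowB M ^+ m)%R <= (j + m).+1)%N.
Proof.
have s1 (a b : C) : (size (a%:P * 'X + b%:P : PC)%R <= 2)%N.
  by rewrite size_MXaddC; case: ifP => // _; rewrite ltnS size_polyC_leq1.
have se (P : PC) n : (size P <= 2)%N -> (size (P ^+ n)%R <= n.+1)%N.
  move=> sP; apply: (leq_trans (size_poly_exp_leq _ _)); rewrite ltnS.
  by case: (size P) sP => [|[|[|]]] //= _; rewrite ?mul0n ?mul1n.
apply: (leq_trans (size_polyMleq _ _)).
have := leq_add (se _ j (s1 (M 0 0) (M 1 0))) (se _ m (s1 (M 0 1) (M 1 1))).
by rewrite addSn addnS /rowA /rowB; case: (_ + _)%N.
Qed.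

(** The gradient of x^(j+1) y^m is ((j+1) A^j B^m, m A^(j+1) B^(m-1)), and the first-family spinor
    of x^j y^(m-1) is (- A^j B^m, A^(j+1) B^(m-1)). Subtracting m times the latter leaves (j + m +
    1) A^j B^m in the first component alone. *)
Lemma tspan_first j m i : tspan (coef_spinor i
  (fun g => rowA (val g) ^+ j * rowB (val g) ^+ m) (fun=> 0)).
Proof.
have [im|im] := leqP i (j + m); last first.
  apply: tspan_ext tspan0 => g; apply/matrixP => k l; rewrite !mxE coef0.
  by rewrite nth_default ?if_same// (leq_trans (size_row_mono _ _ _)).
have n0 := natr_neq0 (j + m).
case: m im n0 => [|m] im n0.
  have := tspanZ (j + 0).+1%:R^-1 (@tspan_gen false (j.+1 + 0) i j.+1 (leq_addr _ _) im).
  apply: tspan_ext => g; rewrite espinor_minus_mono; apply/matrixP => k l; rewrite !mxE /=.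
  case: (k == 0); last by rewrite !mul0r coef0 mulr0.
  by rewrite -mulrA -polyC_natr coefCM addn0 mulKf// -?[j in n0]addn0.
have im' : (i < edim true (j + m))%N by rewrite /= ltnS -addnS.
have := tspanZ (j + m.+1).+1%:R^-1 (tspanD
  (@tspan_gen false (j.+1 + m.+1) i j.+1 (leq_addr _ _) im)
  (tspanZ (- m.+1%:R) (@tspan_gen true (j + m) i j (leq_addr _ _) im'))).
apply: tspan_ext => g; rewrite espinor_minus_mono espinor_plus_mono.
apply/matrixP => k l; rewrite !mxE /=.
case: (k == 0).
  apply: (canLR (mulKf n0)); rewrite -2!coefCM -coefD; apply: eq_coef.
  rewrite polyCN !polyC_natr polyC1 -[(j + m.+1).+1]addSn natrD.
  by move: (_ ^+ j) (_ ^+ m.+1) => x y; ring.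
by rewrite -(polyC_natr _ m.+1) -[_ * _ * _]mulrA coefCM mulNr subrr mulr0 coef0.
Qed.

Lemma tspan_second j m i : tspan (coef_spinor i (fun=> 0)
  (fun g => rowA (val g) ^+ j * rowB (val g) ^+ m)).
Proof.
have [im|im] := leqP i (j + m); last first.
  apply: tspan_ext tspan0 => g; apply/matrixP => k l; rewrite !mxE coef0.
  by case: (k == 0) => //; rewrite nth_default // (leq_trans (size_row_mono _ _ _)).
have n0 := natr_neq0 (j + m).
have im1 : (i < edim false (j + m.+1))%N by rewrite /= addnS.
case: j im n0 im1 => [|j] im n0 im1.
  have := tspanZ (0 + m).+1%:R^-1 (@tspan_gen false (0 + m.+1) i 0 (leq0n _) im1).
  apply: tspan_ext => g; rewrite espinor_minus_mono; apply/matrixP => k l; rewrite !mxE /=.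
  case: (k == 0); first by rewrite !mul0r coef0 mulr0.
  by rewrite -mulrA -polyC_natr coefCM mulKf.
have im' : (i < edim true (j + m))%N by rewrite /= ltnS -addSn.
have := tspanZ (j.+1 + m).+1%:R^-1 (tspanD
  (@tspan_gen false (j.+1 + m.+1) i j.+1 (leq_addr _ _) im1)
  (tspanZ (j.+1%:R) (@tspan_gen true (j + m) i j (leq_addr _ _) im'))).
apply: tspan_ext => g; rewrite espinor_minus_mono espinor_plus_mono.
apply/matrixP => k l; rewrite !mxE /=.
case: (k == 0).
  rewrite -(polyC_natr _ j.+1) -[_ * _ * _]mulrA coefCM polyC1 mulN1r coefN mulrN.
  by rewrite subrr mulr0 coef0.
apply: (canLR (mulKf n0)); rewrite -2!coefCM -coefD; apply: eq_coef.
rewrite !polyC_natr -addnS natrD.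
by move: (_ ^+ j.+1) (_ ^+ m) => x y; ring.
Qed.

Lemma spoly_tspan psi : spoly psi -> tspan psi.
Proof.
move=> h.
have t0 f : fspan f -> tspan (fun g => \col_(k < 2) if k == 0 then f g else 0).
  elim=> [|c j m i f' _ IH].
    by apply: tspan_ext tspan0 => g; apply/matrixP => k l; rewrite !mxE if_same.
  apply: tspan_ext (tspanD (tspanZ c (tspan_first j m i)) IH) => g.
  by apply/matrixP => k l; rewrite !mxE coef0; case: (k == 0); rewrite // mulr0 addr0.
have t1 f : fspan f -> tspan (fun g => \col_(k < 2) if k == 0 then 0 else f g).
  elim=> [|c j m i f' _ IH].
    by apply: tspan_ext tspan0 => g; apply/matrixP => k l; rewrite !mxE if_same.
  apply: tspan_ext (tspanD (tspanZ c (tspan_second j m i)) IH) => g.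
  by apply/matrixP => k l; rewrite !mxE coef0; case: (k == 0); rewrite // mulr0 addr0.
have := tspanD (t0 _ (cpoly_fspan (h 0))) (t1 _ (cpoly_fspan (h 1))).
apply: tspan_ext => g; apply/matrixP => k l; rewrite !mxE (ord1 l).
by have [->|->] := ord2P k; rewrite /= ?addr0 ?add0r.
Qed.

(** The second row of [g] consists, up to sign, of the conjugates of the first, so conjugates of
    entries, and with them real and imaginary parts, are again polynomials in the entries. *)
Lemma cpoly_rpoly p : rpoly p -> cpoly (fun g => (p g)%:C).
Proof.
elim=> [k|a|f h _ h1 _ h2|f h _ h1 _ h2].
- have e x y c d : cpoly x -> cpoly y -> cpoly (fun g => c * x g + d * y g).
    by move=> hx hy; apply: cpolyD; apply: cpolyM => //; exact: cpoly_cst.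
  have g11 (g : SU) : val g 1 1 = (val g 0 0)^*.
    by rewrite val_su2 quatE !mxE /=; simpc.
  have g10 (g : SU) : val g 1 0 = - (val g 0 1)^*.
    by rewrite val_su2 quatE !mxE /=; simpc.
  case: k => [|[|[|k]]].
  - apply: cpoly_ext (e _ _ 2^-1 2^-1 (cpoly_entry 0 0) (cpoly_entry 1 1)) => g.
    by rewrite g11 ReJ_add; field.
  - apply: cpoly_ext (e _ _ (- 2^-1 * 'i%C) (2^-1 * 'i%C) (cpoly_entry 0 0) (cpoly_entry 1 1)) => g.
    by rewrite g11 ImJ_sub; field.
  - apply: cpoly_ext (e _ _ 2^-1 (- 2^-1) (cpoly_entry 0 1) (cpoly_entry 1 0)) => g.
    by rewrite g10 ReJ_add; field.
  - apply: cpoly_ext (e _ _ (- 2^-1 * 'i%C) (- 2^-1 * 'i%C) (cpoly_entry 0 1) (cpoly_entry 1 0)) => g.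
    by rewrite g10 ImJ_sub; field.
- exact: cpoly_cst.
- by apply: cpoly_ext (cpolyD h1 h2) => g; rewrite rmorphD.
- by apply: cpoly_ext (cpolyM h1 h2) => g; rewrite rmorphM.
Qed.

Lemma spoly_approx psi (e : R) : scont psi -> 0 < e -> exists2 p, spoly p &
  forall g j, `|complex.Re (psi g j 0 - p g j 0)| < e /\
              `|complex.Im (psi g j 0 - p g j 0)| < e.
Proof.
move=> h e0.
have a f : ccont f -> exists2 p, cpoly p & forall g, `|complex.Re (f g - p g)| < e /\
              `|complex.Im (f g - p g)| < e.
  move=> [/stone_weierstrass/(_ _ e0)[p rp hp] /stone_weierstrass/(_ _ e0)[q rq hq]].
  exists (fun g => (p g)%:C + 'i%C * (q g)%:C).
    by apply: cpolyD; [exact: cpoly_rpoly|apply: cpolyM; [exact: cpoly_cst|exact: cpoly_rpoly]].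
  move=> g; have := hp g; have := hq g; case: (f g) => x y /=.
  by simpc.
have [p0 c0 h0] := a _ (h 0); have [p1 c1 h1] := a _ (h 1).
exists (fun g => \col_k if k == 0 then p0 g else p1 g).
  move=> j; have [->|->] := ord2P j; [apply: cpoly_ext c0|apply: cpoly_ext c1] => g;
  by rewrite mxE.
by move=> g j; have [->|->] := ord2P j; rewrite mxE /=.
Qed.

End polynomial_spinors.

(** * Binary forms under linear substitution *)

Section binary_forms.
Context {R : realType}.
Notation SU := (SU2 R).
Notation C := R[i].
Notation PC := {poly R[i]}.

Lemma size_poly_ind (K : PC -> Prop) n :
  K 0 -> (forall P Q, K P -> K Q -> K (P + Q)) ->
  (forall c j, (j <= n)%N -> K (c *: 'X^j)) ->
  forall P : PC, (size P <= n.+1)%N -> K P.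
Proof.
move=> K0 KD KX P sP.
have -> : P = \poly_(i < n.+1) P`_i.
  apply/polyP => i; rewrite coef_poly; case: ltnP => // ni.
  by rewrite nth_default// (leq_trans sP).
rewrite poly_def; elim/big_ind: _ => // i _.
by apply: KX; rewrite -ltnS ltn_ord.
Qed.

Lemma hform0 n (a b : PC) : hform n 0 a b = 0.
Proof. by rewrite /hform big1// => j _; rewrite coef0 mul0r. Qed.

Lemma hformM n m (P Q : PC) (a b : PC) : (size P <= n.+1)%N -> (size Q <= m.+1)%N ->
  hform (n + m) (P * Q) a b = hform n P a b * hform m Q a b.
Proof.
move=> sP sQ; move: P sP; apply: size_poly_ind => [|P1 P2 h1 h2|c j jn].
- by rewrite mul0r !hform0 mul0r.
- by rewrite mulrDl !hformD h1 h2 mulrDl.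
move: Q sQ; apply: size_poly_ind => [|Q1 Q2 h1 h2|d k km].
- by rewrite mulr0 !hform0 mulr0.
- by rewrite mulrDr !hformD h1 h2 mulrDr.
rewrite -scalerAl -scalerAr -exprD !hformZ !hformXn ?leq_add//.
have -> : (n + m - (j + k) = (n - j) + (m - k))%N by lia.
rewrite !exprD; move: (a ^+ j) (a ^+ k) (b ^+ (n - j)) (b ^+ (m - k)) => x y z t.
by ring.
Qed.

Lemma hform_exp n k (P : PC) (a b : PC) : (size P <= n.+1)%N ->
  hform (k * n) (P ^+ k) a b = hform n P a b ^+ k.
Proof.
move=> sP; elim: k => [|k IH].
  by rewrite mul0n !expr0 -(expr0 'X) hformXn// !expr0 mul1r.
rewrite mulSn exprS hformM// ?IH ?exprS//.
apply: (leq_trans (size_poly_exp_leq _ _)); rewrite ltnS mulnC leq_mul2l.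
by apply/orP; right; lia.
Qed.

Lemma size_hform1 (a b : C) : (size (a%:P * 'X + b%:P)%R <= 2)%N.
Proof. by rewrite size_MXaddC; case: ifP => // _; rewrite ltnS size_polyC_leq1. Qed.

Lemma hform_linear (c d : C) (a b : PC) :
  hform 1 (c%:P * 'X + d%:P) a b = c%:P * a + d%:P * b.
Proof.
have -> : c%:P * 'X + d%:P = c *: 'X^1 + d *: 'X^0 :> PC.
  by rewrite -!mul_polyC expr0 expr1 mulr1.
by rewrite hformD !hformZ !hformXn// subn0 subnn !expr0 !expr1 mulr1 mul1r.
Qed.

Lemma size_rowform n (Q : PC) M : (size Q <= n.+1)%N -> (size (rowform n Q M : PC) <= n.+1)%N.
Proof.
move=> _; rewrite /rowform /hform (leq_trans (size_sum _ _ _))//.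
apply/bigmax_leqP => j _; rewrite mul_polyC (leq_trans (size_scale_leq _ _))//.
have := size_row_mono M j (n - j); rewrite subnKC//; by rewrite -ltnS ltn_ord.
Qed.

(** Substitution is functorial: the linear forms of M N are those of N evaluated at those of M. *)
Lemma rowformM n (Q : PC) (M N : 'M[C]_2) : (size Q <= n.+1)%N ->
  rowform n Q (M *m N) = rowform n (rowform n Q N) M.
Proof.
have l1 : lift ord0 ord0 = 1 :> 'I_2 by exact/val_inj.
move=> sQ; rewrite /rowform.
have eA : rowA (M *m N) = hform 1 (rowA N) (rowA M) (rowB M).
  rewrite hform_linear /rowA /rowB !mxE !big_ord_recl !big_ord0 !addr0 l1.
  by rewrite !polyCD !polyCM; ring.
have eB : rowB (M *m N) = hform 1 (rowB N) (rowA M) (rowB M).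
  rewrite hform_linear /rowA /rowB !mxE !big_ord_recl !big_ord0 !addr0 l1.
  by rewrite !polyCD !polyCM; ring.
rewrite eA eB; move: Q sQ; apply: size_poly_ind => [|Q1 Q2 h1 h2|c j jn].
- by rewrite !hform0.
- by rewrite !(hformD n Q1 Q2) h1 h2 [RHS]hformD.
rewrite !(hformZ n c 'X^j) !(hformXn _ _ jn) [c%:P * _ in RHS]mul_polyC [RHS]hformZ.
congr (_ * _); rewrite -!hform_exp ?size_hform1// !muln1 -hformM ?subnKC//.
- by have := size_row_mono N j 0; rewrite mulr1 addn0.
- by have := size_row_mono N 0 (n - j); rewrite mul1r.
Qed.

Lemma espinorD b n i (P Q : PC) (g : SU) :
  espinor b n i (P + Q) g = espinor b n i P g + espinor b n i Q g.
Proof.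
rewrite /espinor -mulmxDr; congr (_ *m _); apply/matrixP => k l; rewrite !mxE.
rewrite /rowform hformD; case: b; case: (k == 0).
- by rewrite coefD opprD.
- by rewrite mulrDr coefD.
- by rewrite derivD coefD.
- by rewrite -coefD; apply: eq_coef; rewrite derivD; ring.
Qed.

Lemma espinorZ b n i c (Q : PC) (g : SU) :
  espinor b n i (c *: Q) g = c *: espinor b n i Q g.
Proof.
rewrite /espinor scalemxAr; congr (_ *m _); apply/matrixP => k l; rewrite !mxE.
rewrite /rowform hformZ; case: b; case: (k == 0).
- by rewrite coefCM mulrN.
- by rewrite mulrCA coefCM.
- by rewrite mul_polyC derivZ coefZ.
- by rewrite -coefCM; apply: eq_coef; rewrite [c%:P * hform _ _ _ _]mul_polyC derivZ -!mul_polyC; ring.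
Qed.

Lemma espinor0 b n i (g : SU) : espinor b n i 0 g = 0.
Proof. by rewrite -(scale0r 0) espinorZ scale0r. Qed.

Lemma espinor_sum (I : finType) b n i (c : I -> C) (Q : I -> PC) (g : SU) :
  espinor b n i (\sum_j c j *: Q j) g = \sum_j c j *: espinor b n i (Q j) g.
Proof.
elim/big_rec2: _ => [|j x y _ IH]; first by rewrite espinor0.
by rewrite espinorD espinorZ IH.
Qed.

Lemma dirac_espinor b n i (Q : PC) : (size Q <= n.+1)%N -> (i < edim b n)%N ->
  dirac_op (espinor b n i Q) = fun g : SU => (eigval b n : R)%:C *: espinor b n i Q g.
Proof.
move=> sQ ie.
move: Q sQ; apply: size_poly_ind => [|Q1 Q2 h1 h2|c j jn].
- have -> : espinor b n i 0 = (fun g : SU => 0 *: espinor b n i 0 g).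
    by apply/funext => g; rewrite scale0r espinor0.
  rewrite dirac_opZ; last exact/spoly_class1/spoly_espinor.
  by apply/funext => g; rewrite !scale0r scaler0.
- have -> : espinor b n i (Q1 + Q2) = (fun g : SU => espinor b n i Q1 g + espinor b n i Q2 g).
    by apply/funext => g; rewrite espinorD.
  rewrite dirac_opD; [|exact/spoly_class1/spoly_espinor..].
  apply/funext => g; rewrite [RHS]scalerDr.
  by congr (_ + _); [exact: (congr1 (@^~ g) h1)|exact: (congr1 (@^~ g) h2)].
have -> : espinor b n i (c *: 'X^j) = (fun g : SU => c *: espinor b n i 'X^j g).
  by apply/funext => g; rewrite espinorZ.
rewrite dirac_opZ; last exact/spoly_class1/spoly_espinor.
apply/funext => g; rewrite [RHS]scalerA mulrC -scalerA; congr (_ *: _).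
rewrite -(subnKC jn); case: b ie => ie; first exact: dirac_espinor_plus_mono.
by apply: dirac_espinor_minus_mono; rewrite subnKC//; apply: leq_ltn_trans ie.
Qed.

(** The inverse of g h supplies the factor [invmx (val h)], the one in the equivariance condition;
    the remaining column involves only q(eta), so translation becomes a substitution in [Q]. *)
Lemma espinor_mulSU b n i (Q : PC) (g h : SU) : (size Q <= n.+1)%N ->
  espinor b n i Q (mulSU g h) =
  invmx (val h) *m espinor b n i (rowform n Q (val h)) g.
Proof.
move=> sQ; rewrite /espinor -[val (mulSU g h)]/(val g *m val h) rowformM// mulmxA.
congr (_ *m _).
have ugh : val g *m val h \in unitmx by rewrite unitmx_mul !su2_unitmx.
by rewrite -[RHS]mul1mx -(mulVmx ugh) -!mulmxA [val h *m _]mulmxA mulmxV ?su2_unitmx// mul1mx mulmxV ?su2_unitmx// mulmx1.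
Qed.

Lemma is_clder_cst_eq0 k (f' : SU -> C) g : is_clder k (fun=> 0) f' -> f' g = 0.
Proof.
move=> [/(_ g)[_ hr] /(_ g)[_ hi]]; move: hr hi; rewrite /= !derive_cst => hr hi.
by apply/eqP; rewrite eq_complex -hr -hi /= !eqxx.
Qed.

(* (J + i K) / 2 = - E_21 maps A to - B and B to 0. *)
Lemma rowform_lower n (Q : PC) : (size Q <= n.+1)%N -> exists F1 F2 : SU -> PC,
  [/\ is_pder 1 (fun g => rowform n Q (val g)) F1,
      is_pder 2 (fun g => rowform n Q (val g)) F2 &
      forall g : SU, F1 g + ('i%C)%:P * F2 g = - (2 : PC) * rowform n Q^`() (val g)].
Proof.
move: Q; apply: size_poly_ind => [|Q1 Q2 [F1 [F2 [a1 a2 a3]]] [H1 [H2 [b1 b2 b3]]]|c j jn].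
- exists (fun=> 0), (fun=> 0); split=> [||g].
  + by apply: is_pder_ext (is_pder_cst 1 0) => g //; rewrite /rowform hform0.
  + by apply: is_pder_ext (is_pder_cst 2 0) => g //; rewrite /rowform hform0.
  + by rewrite mulr0 addr0 deriv0 /rowform hform0 mulr0.
- exists (fun g => F1 g + H1 g), (fun g => F2 g + H2 g); split=> [||g].
  + by apply: is_pder_ext (is_pderD a1 b1) => g //; rewrite /rowform hformD.
  + by apply: is_pder_ext (is_pderD a2 b2) => g //; rewrite /rowform hformD.
  + by rewrite mulrDr addrACA a3 b3 derivD /rowform hformD mulrDr.
have m1 := is_pderZ c%:P (@is_pder_mono R 1 j (n - j)).
have m2 := is_pderZ c%:P (@is_pder_mono R 2 j (n - j)).
do 2!eexists; split.
- by apply: is_pder_ext m1 => g //; rewrite /rowform hformZ hformXn.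
- by apply: is_pder_ext m2 => g //; rewrite /rowform hformZ hformXn.
move=> g; cbv beta zeta; move: (val g) {m1 m2} => M; rewrite !frame_entries /= !mxE /= derivZ derivXn.
have hJ := @imag_polyC_sqr R.
have -> : rowform n (c *: ('X^(j.-1) *+ j)) M =
    c%:P * (j%:R * (rowA M ^+ j.-1 * (rowB M * rowB M ^+ (n - j)))).
  rewrite /rowform -scaler_nat !hformZ polyC_natr.
  case: j jn => [|j] jn; first by rewrite !mul0r !mulr0.
  by rewrite /= hformXn ?(ltnW jn)// -exprS subnSK.
move: hJ; rewrite !(polyC0, polyCN, polyC1).
move: (rowA M ^+ _) (rowA M ^+ _) (rowB M ^+ _) (rowB M ^+ _).
move=> a' a b b'; move: (rowA M) (rowB M) (j%:R) ((n - j)%:R) ('i%C)%:P c%:P.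
by move=> A B x y J e hJ; ring: hJ.
Qed.

Lemma poly_nat_roots_eq0 (p : PC) : (forall k : nat, p.[k%:R] = 0) -> p = 0.
Proof.
move=> h; apply: (@roots_geq_poly_eq0 _ p [seq k%:R | k <- iota 0 (size p)]).
- by apply/allP => _ /mapP[k _ ->]; rewrite /root h.
- by rewrite map_inj_uniq ?iota_uniq// => x y /eqP; rewrite eqr_nat => /eqP.
- by rewrite size_map size_iota.
Qed.

Lemma coef_linear_exp (w v : C) n i : (i <= n)%N ->
  ((w%:P * 'X + v%:P) ^+ n)`_i = v ^+ (n - i) * w ^+ i *+ 'C(n, i).
Proof.
move=> i_n; rewrite addrC exprDn coef_sum (bigD1 (Ordinal (i_n : (i < n.+1)%N))) //= big1 ?addr0.
  by rewrite exprMn -!polyC_exp mulrA -polyCM -mulr_natr -polyC_natr mulrAC -polyCM coefCM coefXn eqxx mulr1 mulr_natr.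
move=> j ji; rewrite exprMn -!polyC_exp mulrA -polyCM coefMn coefCM coefXn.
case: eqP => [e|]; last by rewrite mulr0 mul0rn.
by case/eqP: ji; exact/val_inj.
Qed.

(* Lowering turns Q_i into Q_i^`(), so induction on the sizes reduces the claim to
   constants c_i, where it reads \sum_i c_i 'C(n, i) w^i v^(n - i) = 0. *)
Lemma rowform_inj n (Q : nat -> PC) : (forall i, (size (Q i) <= n.+1)%N) ->
  (forall g : SU, \sum_(i < n.+1) (rowform n (Q i) (val g))`_i = 0) ->
  forall i, (i <= n)%N -> Q i = 0.
Proof.
suff h d : (d <= n.+1)%N -> forall Q : nat -> PC, (forall i, (size (Q i) <= d)%N) ->
  (forall g : SU, \sum_(i < n.+1) (rowform n (Q i) (val g))`_i = 0) ->
  forall i, (i <= n)%N -> Q i = 0 by exact: h.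
elim: d => [|d IH] dn {}Q sQ hQ i i_n.
  by apply/eqP; rewrite -size_poly_leq0.
have sQn j : (size (Q j) <= n.+1)%N := leq_trans (sQ j) dn.
have sQ' j : (size (Q j)^`() <= d)%N.
  have [->|Q0] := eqVneq (Q j) 0; first by rewrite deriv0 size_poly0.
  by rewrite -ltnS (leq_trans (lt_size_deriv Q0)).
have Q'0 j : (j <= n)%N -> (Q j)^`() = 0.
  move: j; apply: (IH (ltnW dn)) => // g.
  have /choice[F1 /choice[F2 hF]] := fun j => rowform_lower (sQn j).
  have d1 : is_clder 1 (fun g : SU => \sum_(i < n.+1) (rowform n (Q i) (val g))`_i)
      (fun g => \sum_(i < n.+1) (F1 i g)`_i).
    exact: (@is_clder_sum R 1 n.+1 (fun j g => (rowform n (Q j) (val g))`_j)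
      (fun j g => (F1 j g)`_j) (fun j => let: And3 h _ _ := hF j in h j)).

  have d2 : is_clder 2 (fun g : SU => \sum_(i < n.+1) (rowform n (Q i) (val g))`_i)
      (fun g => \sum_(i < n.+1) (F2 i g)`_i).
    exact: (@is_clder_sum R 2 n.+1 (fun j g => (rowform n (Q j) (val g))`_j)
      (fun j g => (F2 j g)`_j) (fun j => let: And3 _ h _ := hF j in h j)).

  have e0 : (fun g : SU => \sum_(i < n.+1) (rowform n (Q i) (val g))`_i) = fun=> 0.
    exact/funext.
  rewrite e0 in d1 d2; have := is_clder_cst_eq0 g d1; have := is_clder_cst_eq0 g d2 => e2 e1.
  have : - 2%:R * \sum_(i < n.+1) (rowform n (Q i)^`() (val g))`_i =
      \sum_(i < n.+1) (F1 i g)`_i + 'i%C * \sum_(i < n.+1) (F2 i g)`_i.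
    rewrite !mulr_sumr -big_split; apply: eq_bigr => j _ /=.
    have [_ _ /(_ g)/(congr1 (fun p : PC => p`_j))] := hF j.
    by rewrite coefD coefCM -(polyC_natr _ 2) -polyCN coefCM => ->.
  rewrite e1 e2 mulr0 addr0 => /eqP; rewrite mulf_eq0 oppr_eq0 pnatr_eq0 /=.
  by move=> /eqP.
have Qc j : (j <= n)%N -> Q j = ((Q j)`_0)%:P.
  move=> jn; apply/polyP => -[|k]; rewrite coefC//=.
  have /(congr1 (fun p : PC => p`_k)) := Q'0 j jn; rewrite coef_deriv coef0 => /eqP.
  by rewrite -mulr_natr mulf_eq0 pnatr_eq0 orbF => /eqP.
suff p0 : \poly_(j < n.+1) ((Q j)`_0 *+ 'C(n, j)) = 0.
  have /(congr1 (fun p : PC => p`_i)) := p0.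
  rewrite coef_poly ltnS i_n coef0 => /eqP; rewrite -mulr_natr mulf_eq0 pnatr_eq0.
  by rewrite -leqn0 leqNgt bin_gt0 i_n orbF => /eqP q0; rewrite Qc// q0.
apply: poly_nat_roots_eq0 => k; rewrite horner_poly.
(* The normalisation of the element with g_11 = 1/r and g_01 = k/r, for which B = (k X + 1)/r: the
   relation at this element says that the polynomial vanishes at k. *)
pose r : R := Num.sqrt (1 + k%:R ^+ 2).
have r2 : r ^+ 2 = 1 + k%:R ^+ 2 by rewrite sqr_sqrtr// addr_ge0// sqr_ge0.
have r0 : r != 0.
  by apply/eqP => e; have := ltr01 (R := R); have := sqr_ge0 (k%:R : R); move: r2; rewrite e; lra.
have h1 : r^-1 ^+ 2 + 0 ^+ 2 + (k%:R / r) ^+ 2 + 0 ^+ 2 = 1.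
  by rewrite expr0n /= !addr0 exprMn exprVn -[X in X + _]mul1r -mulrDl -r2 divff// expf_neq0.
pose g : SU := Sub (quat r^-1 0 (k%:R / r) 0) (is_su2_quat h1).
have g01 : val g 0 1 = (r^-1)%:C * k%:R.
  by rewrite -(rmorph_nat (real_complex R)) -rmorphM mulrC /= quatE !mxE.
have g11 : val g 1 1 = (r^-1)%:C by rewrite /= quatE !mxE /= oppr0.
have gB : rowB (val g) = ((r^-1)%:C * k%:R)%:P * 'X + ((r^-1)%:C)%:P.
  by rewrite /rowB g01 g11.
have rn0 : (r^-1)%:C ^+ n != 0 :> C by rewrite expf_neq0// -(rmorph0 (real_complex R)) (inj_eq (@complexI R)) invr_eq0.
apply: (mulfI rn0); rewrite [RHS]mulr0 -[RHS](hQ g) mulr_sumr; apply: eq_bigr => j _.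
have jn : (j <= n)%N by rewrite -ltnS.
rewrite [in RHS](Qc j jn) -[in RHS](mulr1 ((Q j)`_0)%:P) -(expr0 'X) mul_polyC /rowform hformZ hformXn//.
rewrite expr0 mul1r subn0 coefCM gB coef_linear_exp// exprMn.
have -> : (r^-1)%:C ^+ n = (r^-1)%:C ^+ (n - j) * (r^-1)%:C ^+ j by rewrite -exprD subnK.
by rewrite -mulr_natr -[in RHS]mulr_natr; ring.
Qed.
End binary_forms.

(** * Spectral decomposition *)

Section spectral_theory.
Context {R : realType}.
Notation SU := (SU2 R).
Notation C := R[i].
Notation PC := {poly R[i]}.

(** After multiplication by [g], the first family has components - G_i, which settles the indices up
    to n, and G_(i-1), which settles those from 1 on. In the second family the component (G')_i = (i
    + 1) G_(i+1) suffices. *)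
Lemma espinor_inj b n (Q : nat -> PC) : (forall i, (size (Q i) <= n.+1)%N) ->
  (forall g : SU, \sum_(i < edim b n) espinor b n i (Q i) g = 0) ->
  forall i, (i < edim b n)%N -> Q i = 0.
Proof.
move=> sQ hQ.
have {}hQ k (g : SU) : \sum_(i < edim b n) (let G := rowform n (Q i) (val g) in
    if b then (if k == 0 :> 'I_2 then - G`_i else ('X * G)`_i)
    else (if k == 0 then (G^`())`_i else (n%:R%:P * G - 'X * G^`())`_i)) = 0.
  have := hQ g; rewrite /espinor -mulmx_sumr => /(congr1 (mulmx (val g))).
  rewrite mulmx0 mulKVmx ?su2_unitmx// => /matrixP/(_ k 0); rewrite summxE mxE => e.
  rewrite -[RHS]e; by apply: eq_bigr => i _; rewrite !mxE.
case: b hQ => hQ.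
  have Qn : forall i, (i <= n)%N -> Q i = 0.
    apply: rowform_inj => // g; have := hQ 0 g; rewrite big_ord_recr /=.
    rewrite [X in _ - X]nth_default ?size_rowform// subr0 => /eqP.
    by rewrite sumrN oppr_eq0 => /eqP.
  have QS : forall i, (i <= n)%N -> Q i.+1 = 0.
    apply: (@rowform_inj _ _ (fun i => Q i.+1)) => // g.
    have := hQ 1 g; rewrite big_ord_recl /= coefXM /= add0r => e; rewrite -[RHS]e.
    by apply: eq_bigr => i _; rewrite coefXM.
  by case=> [_|i]; [exact: Qn|rewrite !ltnS => ?; exact: QS].
(* Shifting the index turns (i + 1) G_(i+1) into a sum over all coefficients, with the form 0 at
   index 0. *)
move=> i ie; pose Q' j := if j is k.+1 then k.+1%:R *: Q k else 0.
suff : Q' i.+1 = 0.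
  by move=> /eqP; rewrite scaler_eq0 pnatr_eq0 /= => /eqP.
move: i.+1 ie; apply: rowform_inj => [[|j]|g] /=; first by rewrite size_poly0.
  by rewrite (leq_trans (size_scale_leq _ _)).
rewrite big_ord_recl /= {1}/rowform hform0 coef0 add0r -[RHS](hQ 0 g); apply: eq_bigr => j _.
by rewrite /= coef_deriv /rowform hformZ coefCM mulr_natl.
Qed.

Lemma rdot_ge0 (v : 'cV[C]_2) : 0 <= rdot v v.
Proof. by rewrite rdotvv; exact: normsq_ge0. Qed.

Lemma scontB (psi phi : spinor_fun R) : scont psi -> scont phi -> scont (fun g => psi g - phi g).
Proof.
move=> h1 h2; have := scontD h1 (scontZ (-1) h2); congr scont.
by apply/funext => g; rewrite scaleN1r.
Qed.

Lemma class1B (psi phi : spinor_fun R) : class1 psi -> class1 phi -> class1 (fun g => psi g - phi g).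
Proof.
move=> h1 h2; have := class1D h1 (class1Z (-1) h2); congr class1.
by apply/funext => g; rewrite scaleN1r.
Qed.

Lemma spinor_dotDr (psi phi1 phi2 : spinor_fun R) : scont psi -> scont phi1 -> scont phi2 ->
  spinor_dot psi (fun g => phi1 g + phi2 g) = spinor_dot psi phi1 + spinor_dot psi phi2.
Proof. by move=> h h1 h2; rewrite spinor_dotC spinor_dotDl// !(spinor_dotC psi). Qed.

Lemma spinor_dotZr (a : R) (psi phi : spinor_fun R) : scont psi -> scont phi ->
  spinor_dot psi (fun g => a%:C *: phi g) = a * spinor_dot psi phi.
Proof. by move=> h h1; rewrite spinor_dotC spinor_dotZl// spinor_dotC. Qed.

Lemma spinor_subE (psi phi : spinor_fun R) :
  (fun g => psi g - phi g) = (fun g => psi g + (-1)%:C *: phi g).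
Proof. by apply/funext => g; rewrite rmorphN rmorph1 scaleN1r. Qed.

Lemma spinor_scale0E (phi : spinor_fun R) : (fun=> 0) = (fun g => 0%:C *: phi g).
Proof. by apply/funext => g; rewrite rmorph0 scale0r. Qed.

Lemma spinor_dotBl (psi1 psi2 phi : spinor_fun R) : scont psi1 -> scont psi2 -> scont phi ->
  spinor_dot (fun g => psi1 g - psi2 g) phi = spinor_dot psi1 phi - spinor_dot psi2 phi.
Proof.
move=> h1 h2 h; have h3 : scont (fun g => (-1)%:C *: psi2 g) by exact: scontZ.
by rewrite spinor_subE spinor_dotDl// spinor_dotZl// mulN1r.
Qed.

Lemma spinor_dotBr (psi phi1 phi2 : spinor_fun R) : scont psi -> scont phi1 -> scont phi2 ->
  spinor_dot psi (fun g => phi1 g - phi2 g) = spinor_dot psi phi1 - spinor_dot psi phi2.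
Proof. by move=> h h1 h2; rewrite spinor_dotC spinor_dotBl// !(spinor_dotC psi). Qed.

Lemma spinor_dot0l (phi : spinor_fun R) : scont phi -> spinor_dot (fun=> 0) phi = 0.
Proof.
by move=> h; rewrite (spinor_scale0E phi) spinor_dotZl// mul0r.
Qed.

Lemma spinor_dot_ge0 (psi : spinor_fun R) : 0 <= spinor_dot psi psi.
Proof. by apply: su2_int_ge0 => g; exact: rdot_ge0. Qed.

Lemma sum_sqr_eq0 (a b c d : R) : a ^+ 2 + b ^+ 2 + (c ^+ 2 + d ^+ 2) = 0 ->
  [/\ a = 0, b = 0, c = 0 & d = 0].
Proof.
have := sqr_ge0 a; have := sqr_ge0 b; have := sqr_ge0 c; have := sqr_ge0 d => *.
by split; apply/eqP; rewrite -sqrf_eq0; apply/eqP; lra.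
Qed.

Lemma normsq_eq0 (v : 'cV[C]_2) : normsq v = 0 -> v = 0.
Proof.
rewrite /normsq !big_ord_recl big_ord0 addr0.
have -> : lift ord0 ord0 = 1 :> 'I_2 by exact/val_inj.
move=> /sum_sqr_eq0[a b c d]; apply/matrixP => i j; rewrite (ord1 j) mxE.
by have [->|->] := ord2P i; apply/eqP; rewrite eq_complex; apply/andP; split; apply/eqP.
Qed.

Lemma spinor_dot_eq0 (psi : spinor_fun R) : scont psi -> spinor_dot psi psi = 0 ->
  forall g, psi g = 0.
Proof.
move=> h e g; apply: normsq_eq0; rewrite -rdotvv.
exact: (su2_int_eq0 (continuous_rdot h h) (fun g => rdot_ge0 (psi g)) e).
Qed.

Lemma spinor_dot_amgm (psi phi : spinor_fun R) : scont psi -> scont phi ->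
  2 * spinor_dot psi phi <= spinor_dot psi psi + spinor_dot phi phi.
Proof.
move=> h1 h2; have := spinor_dot_ge0 (fun g => psi g - phi g).
have h := scontB h1 h2; rewrite spinor_dotBl// !spinor_dotBr// (spinor_dotC phi psi).
by lra.
Qed.

Lemma spinor_dotDD (psi phi : spinor_fun R) : scont psi -> scont phi ->
  spinor_dot (fun g => psi g + phi g) (fun g => psi g + phi g) =
  spinor_dot psi psi + 2 * spinor_dot psi phi + spinor_dot phi phi.
Proof.
move=> c1 c2; have c := scontD c1 c2.
rewrite (spinor_dotDl c1 c2 c) (spinor_dotDr c1 c1 c2) (spinor_dotDr c2 c1 c2).
by rewrite (spinor_dotC phi psi); ring.
Qed.

Lemma spinor_dotZDD (a : R) (psi phi : spinor_fun R) : scont psi -> scont phi ->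
  spinor_dot (fun g => a%:C *: psi g + phi g) (fun g => a%:C *: psi g + phi g) =
  a ^+ 2 * spinor_dot psi psi + 2 * a * spinor_dot psi phi + spinor_dot phi phi.
Proof.
move=> c1 c2; have c : scont (fun g => a%:C *: psi g) by exact: scontZ.
rewrite (spinor_dotDD c c2) (spinor_dotZl a c1 c) (spinor_dotZr a c1 c1).
by rewrite (spinor_dotZl a c1 c2); ring.
Qed.

Lemma spoly_scont (psi : spinor_fun R) : spoly psi -> scont psi.
Proof. by move=> /spoly_class1/class1_cont. Qed.

Lemma spoly_approx_normsq (psi : spinor_fun R) (e : R) : scont psi -> 0 < e ->
  exists2 p, spoly p & forall g, normsq (psi g - p g) <= e.
Proof.
move=> h e0; pose d : R := Num.min 1 (e / 4).
have d0 : 0 < d by rewrite lt_min ltr01 divr_gt0.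
have d1 : d <= 1 by rewrite ge_min lexx.
have de : d <= e / 4 by rewrite ge_min lexx orbT.
have [p sp hp] := spoly_approx h d0; exists p => // g.
have b (x : R) : `|x| < d -> x ^+ 2 <= e / 4.
  move=> xd; rewrite -real_normK ?num_real//; apply: le_trans de; rewrite expr2.
  by apply: le_trans (ltW xd); rewrite ler_piMl// (le_trans (ltW xd)).
have b2 j : complex.Re ((psi g - p g) j 0) ^+ 2 + complex.Im ((psi g - p g) j 0) ^+ 2 <= e / 2.
  rewrite !mxE; have [/b h1 /b h2] := hp g j; apply: (le_trans (lerD h1 h2)).
  by clear; lra.
rewrite /normsq !big_ord_recl big_ord0 addr0.
by rewrite (le_trans (lerD (b2 0) (b2 (lift ord0 ord0))))//; clear; lra.
Qed.

Lemma spinor_dot_le_sup (psi : spinor_fun R) (e : R) : scont psi ->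
  (forall g, normsq (psi g) <= e) -> spinor_dot psi psi <= e * su2_int (fun _ : SU => 1).
Proof.
move=> h he; rewrite -su2_intZ; last exact: continuous_csts.
apply: su2_int_le => [||g]; first exact: continuous_rdot.
  exact: continuous_csts.
by rewrite rdotvv mulr1.
Qed.

Lemma le_of_approx (x y V : R) : 0 <= V -> (forall e, 0 < e -> x <= y + e * V) -> x <= y.
Proof.
move=> V0 h; apply/ler_addgt0Pr => e e0.
have V1 : 0 < V + 1 by lra.
apply: (le_trans (h (e / (V + 1)) (divr_gt0 e0 V1))); rewrite lerD2l.
by rewrite mulrAC ler_pdivrMr// ler_wpM2l ?ltW//; lra.
Qed.

(** When psi is orthogonal to p, the inequality 2 <psi, psi - p> <= |psi|^2 + |psi - p|^2 reads
    |psi|^2 <= |psi - p|^2, which is arbitrarily small. *)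
Lemma spoly_dense (psi : spinor_fun R) : scont psi ->
  (forall p, spoly p -> spinor_dot psi p = 0) -> forall g, psi g = 0.
Proof.
move=> h hp; apply: spinor_dot_eq0 => //; apply/eqP.
rewrite eq_le spinor_dot_ge0 andbT.
have V0 : 0 <= su2_int (fun _ : SU => 1 : R) by apply: su2_int_ge0 => _; exact: ler01.
apply: (le_of_approx V0) => e e0; rewrite add0r.
have [p sp hpe] := spoly_approx_normsq h e0; have cp := spoly_scont sp.
have := spinor_dot_amgm h (scontB h cp); rewrite (spinor_dotBr h h cp) (hp _ sp) subr0.
by have := spinor_dot_le_sup (scontB h cp) hpe; lra.
Qed.

(** Gram-Schmidt, adding one vector at a time. The third conclusion, that whatever is orthogonal to
    the family is orthogonal to p, stands for membership in the span and carries the induction. If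
    the new component f has norm zero, the projection does not change. *)
Lemma ortho_proj (T : eqType) (e : T -> spinor_fun R) (S : spinor_fun R -> Prop) :
  (forall psi, S psi -> scont psi) -> S (fun=> 0) ->
  (forall psi phi, S psi -> S phi -> S (fun g => psi g + phi g)) ->
  (forall (a : R) psi, S psi -> S (fun g => a%:C *: psi g)) ->
  (forall x, S (e x)) ->
  forall (s : seq T) psi, scont psi -> exists p, [/\ S p,
    forall x, x \in s -> spinor_dot (fun g => psi g - p g) (e x) = 0 &
    forall phi, scont phi -> (forall x, x \in s -> spinor_dot phi (e x) = 0) ->
      spinor_dot phi p = 0].
Proof.
move=> Sc S0 SD SZ Se; elim=> [|x s IH] psi cpsi.
  exists (fun=> 0); split=> // phi cphi _; rewrite spinor_dotC spinor_dot0l//.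
have ce := Sc _ (Se x).
have [q [Sq sq oq]] := IH _ ce; have [p [Sp sp op]] := IH _ cpsi.
have cq := Sc _ Sq; have cp := Sc _ Sp.
have cr := scontB cpsi cp; have cf := scontB ce cq.
have Sf : S (fun g => e x g - q g).
  have := SD _ _ (Se x) (SZ (-1) _ Sq); congr S.
  by apply/funext => g; rewrite rmorphN rmorph1 scaleN1r.
set f := fun g => e x g - q g in sq cf Sf.
have dx phi : scont phi -> (forall y, y \in s -> spinor_dot phi (e y) = 0) ->
    spinor_dot phi (e x) = spinor_dot phi f.
  by move=> c h; rewrite /f spinor_dotBr// (oq _ c h) subr0.
have [f0|f0] := eqVneq (spinor_dot f f) 0.
  exists p; split=> // [y|phi c h].
    rewrite inE => /orP[/eqP ->|]; last exact: sp.
    rewrite dx//.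
    have -> : f = fun=> 0 by apply/funext => g; exact: spinor_dot_eq0.
    by rewrite spinor_dotC spinor_dot0l.
  by apply: op => // y ys; apply: h; rewrite inE ys orbT.
pose a := spinor_dot (fun g => psi g - p g) f / spinor_dot f f.
have caf : scont (fun g => a%:C *: f g) by exact: scontZ.
have er : (fun g => psi g - (p g + a%:C *: f g)) =
    (fun g => (psi g - p g) - a%:C *: f g) by apply/funext => g; rewrite opprD addrA.
exists (fun g => p g + a%:C *: f g); split; first by apply: SD => //; exact: SZ.
  have o y : y \in s -> spinor_dot (fun g => psi g - (p g + a%:C *: f g)) (e y) = 0.
    move=> ys; have cy := Sc _ (Se y).
    by rewrite er spinor_dotBl// spinor_dotZl// sp// sq// mulr0 subr0.
  move=> y; rewrite inE => /orP[/eqP ->|]; last exact: o.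
  rewrite dx//; last by rewrite er; exact: scontB.
  by rewrite er spinor_dotBl// spinor_dotZl// /a divfK// subrr.
move=> phi c h.
have hs y : y \in s -> spinor_dot phi (e y) = 0 by move=> ys; apply: h; rewrite inE ys orbT.
rewrite spinor_dotDr// spinor_dotZr// (op _ c hs) add0r -(dx _ c hs) h ?mulr0//.
by rewrite inE eqxx.
Qed.

Definition espan b n (psi : spinor_fun R) := exists Q : nat -> PC,
  (forall i, (size (Q i) <= n.+1)%N) /\
  psi = (fun g => \sum_(i < edim b n) espinor b n i (Q i) g).

Lemma espanD b n psi phi : espan b n psi -> espan b n phi -> espan b n (fun g => psi g + phi g).
Proof.
move=> [P [sP ->]] [Q [sQ ->]]; exists (fun i => P i + Q i); split=> [i|].
  by rewrite (leq_trans (size_polyD _ _))// geq_max sP sQ.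
by apply/funext => g; rewrite -big_split; apply: eq_bigr => i _; rewrite espinorD.
Qed.

Lemma espanZ b n c psi : espan b n psi -> espan b n (fun g => c *: psi g).
Proof.
move=> [P [sP ->]]; exists (fun i => c *: P i); split=> [i|].
  by rewrite (leq_trans (size_scale_leq _ _)).
by apply/funext => g; rewrite scaler_sumr; apply: eq_bigr => i _; rewrite espinorZ.
Qed.

Lemma espan0 b n : espan b n (fun=> 0).
Proof.
exists (fun=> 0); split=> [i|]; first by rewrite size_poly0.
by apply/funext => g; rewrite big1// => i _; rewrite espinor0.
Qed.

Lemma espan_gen b n i (Q : PC) : (size Q <= n.+1)%N -> (i < edim b n)%N ->
  espan b n (espinor b n i Q).
Proof.
move=> sQ ie; exists (fun j => if j == i then Q else 0); split=> [j|].
  by case: ifP => // _; rewrite size_poly0.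
apply/funext => g; rewrite (bigD1 (Ordinal ie)) //= eqxx big1 ?addr0// => j ji.
case: eqP => [e|_]; last by rewrite espinor0.
by case/eqP: ji; exact/val_inj.
Qed.

Lemma spoly_sum n (F : nat -> spinor_fun R) : (forall i, spoly (F i)) ->
  spoly (fun g => \sum_(i < n) F i g).
Proof.
move=> h j; have := @cpoly_sum R n _ (fun i => h i j).
by apply: cpoly_ext => g; rewrite summxE.
Qed.

Lemma spolyD (psi phi : spinor_fun R) : spoly psi -> spoly phi -> spoly (fun g => psi g + phi g).
Proof. by move=> h1 h2 j; apply: cpoly_ext (cpolyD (h1 j) (h2 j)) => g; rewrite mxE. Qed.

Lemma spolyZ c (psi : spinor_fun R) : spoly psi -> spoly (fun g => c *: psi g).
Proof. by move=> h j; apply: cpoly_ext (cpolyM (cpoly_cst c) (h j)) => g; rewrite mxE. Qed.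

Lemma spoly0 : spoly (fun _ : SU => 0).
Proof. by move=> j; apply: cpoly_ext (cpoly_cst 0) => g; rewrite mxE. Qed.

Lemma espan_spoly b n psi : espan b n psi -> spoly psi.
Proof. by move=> [Q [_ ->]]; exact: (@spoly_sum _ (fun i => espinor b n i (Q i)) (fun i => @spoly_espinor R b n i (Q i))). Qed.

Lemma dirac_op0 : dirac_op (fun _ : SU => 0) = fun=> 0.
Proof.
rewrite [X in dirac_op X](_ : _ = fun g : SU => 0 *: (fun _ : SU => 0) g).
  by rewrite (dirac_opZ 0 (spoly_class1 spoly0)); apply/funext => g; rewrite scale0r.
by apply/funext => g; rewrite scaler0.
Qed.

Lemma dirac_espan b n psi : espan b n psi ->
  dirac_op psi = fun g => (eigval b n : R)%:C *: psi g.
Proof.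
move=> [Q [sQ ->]].
suff h m : (m <= edim b n)%N -> dirac_op (fun g => \sum_(i < m) espinor b n i (Q i) g) =
    fun g => (eigval b n : R)%:C *: \sum_(i < m) espinor b n i (Q i) g by exact: h.
elim: m => [_|m IH mn].
  have -> : (fun g : SU => \sum_(i < 0) espinor b n i (Q i) g) = fun=> 0.
    by apply/funext => g; rewrite big_ord0.
  by rewrite dirac_op0; apply/funext => g; rewrite big_ord0 scaler0.
have -> : (fun g : SU => \sum_(i < m.+1) espinor b n i (Q i) g) =
    fun g => \sum_(i < m) espinor b n i (Q i) g + espinor b n m (Q m) g.
  by apply/funext => g; rewrite big_ord_recr.
rewrite dirac_opD; last first.
- exact/spoly_class1/spoly_espinor.
- exact/spoly_class1/(@spoly_sum _ (fun i => espinor b n i (Q i)) (fun i => @spoly_espinor R b n i (Q i))).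
apply/funext => g; rewrite [in RHS]big_ord_recr /= scalerDr; congr (_ + _).
  exact: (congr1 (@^~ g) (IH (ltnW mn))).
exact: (congr1 (@^~ g) (dirac_espinor (sQ m) mn)).
Qed.

Lemma eigenspinor_orthogonal (psi phi : spinor_fun R) (l m : R) : class1 psi -> class1 phi ->
  dirac_op psi = (fun g => l%:C *: psi g) -> dirac_op phi = (fun g => m%:C *: phi g) ->
  l * spinor_dot psi phi = m * spinor_dot psi phi.
Proof.
move=> h1 h2 e1 e2; have := dirac_symmetric h1 h2; rewrite e1 e2.
have c1 := class1_cont h1; have c2 := class1_cont h2.
by rewrite spinor_dotZl// spinor_dotZr.
Qed.

(** Subtract the projection onto the finite family. The remainder is an eigenspinor for l,
    orthogonal to the other families by symmetry of D and to this one by construction, hence to all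
    polynomial spinors. The last hypothesis is conditional so that an empty family, with l not an
    eigenvalue, is allowed. *)
Lemma eigenspinor_espan (psi : spinor_fun R) (l : R) b n : class1 psi ->
  dirac_op psi = (fun g => l%:C *: psi g) ->
  (forall b' n', (0 < edim b' n')%N -> eigval b' n' = l -> b' = b /\ n' = n) ->
  ((0 < edim b n)%N -> eigval b n = l) -> espan b n psi.
Proof.
move=> h e uniq_l el; have c := class1_cont h.
(* The boolean selects the factor 1 or i: the projection is onto a real span, as [spinor_dot] is
   only real bilinear. *)
pose T : finType := ('I_(edim b n) * 'I_n.+1 * bool)%type.
pose f (x : T) : spinor_fun R := fun g =>
  (if x.2 then 'i%C else 1) *: espinor b n x.1.1 'X^(x.1.2) g.
have sX (j : 'I_n.+1) : (size ('X^j : PC) <= n.+1)%N by rewrite size_polyXn ltn_ord.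
have Sf x : espan b n (f x) by apply/espanZ/espan_gen.
have Sc psi' : espan b n psi' -> scont psi' by move=> /espan_spoly/spoly_scont.
have [p [Sp hp _]] := ortho_proj Sc (espan0 b n) (@espanD b n)
  (fun a psi' => @espanZ b n a%:C psi') Sf (enum T) c.
have cp := Sc _ Sp; have c1p := spoly_class1 (espan_spoly Sp).
have ep : dirac_op p = fun g => l%:C *: p g.
  have [e0|] := posnP (edim b n); last by move=> /el <-; exact: dirac_espan.
  have -> : p = fun=> 0.
    by have [Q [_ ->]] := Sp; apply/funext => g; rewrite e0 big_ord0.
  by rewrite dirac_op0; apply/funext => g; rewrite scaler0.
pose r : spinor_fun R := fun g => psi g - p g.
have c1r : class1 r by exact: class1B.
have er : dirac_op r = fun g => l%:C *: r g.
  have -> : r = fun g => psi g + (-1) *: p g by apply/funext => g; rewrite scaleN1r.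
  rewrite dirac_opD//; last exact: class1Z.
  rewrite dirac_opZ// e ep; apply/funext => g.
  by rewrite scalerDr !scalerA [-1 * _]mulrC.
have cr := class1_cont c1r.
suff r0 : forall g, r g = 0.
  suff -> : psi = p by [].
  by apply/funext => g; apply/eqP; rewrite -subr_eq0; apply/eqP; exact: r0.
apply: spoly_dense => // q /spoly_tspan; elim=> [|a b' n' i j phi jn ie tphi IH].
  by rewrite spinor_dotC spinor_dot0l.
have cphi : scont phi.
  elim: tphi => [|*]; first exact: (spoly_scont spoly0).
  by apply: scontD => //; apply: scontZ; exact/spoly_scont/spoly_espinor.
have cE : scont (espinor b' n' i 'X^j : spinor_fun R) by exact/spoly_scont/spoly_espinor.
rewrite spinor_dotDr//; last exact: scontZ.
rewrite IH addr0.
have [l'|l'] := eqVneq (eigval b' n') l; last first.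
  have s : espan b' n' (fun g => a *: espinor b' n' i 'X^j g).
    by apply/espanZ/espan_gen; rewrite // size_polyXn.
  have /eqP := eigenspinor_orthogonal c1r (spoly_class1 (espan_spoly s)) er (dirac_espan s).
  by rewrite -subr_eq0 -mulrBl mulf_eq0 subr_eq0 eq_sym (negPf l') => /eqP.
have [eb en] := uniq_l _ _ (leq_ltn_trans (leq0n _) ie) l'; subst b' n'.
have jn' : (j < n.+1)%N by [].
have e1 : spinor_dot r (fun g => 'i%C *: espinor b n i 'X^j g) = 0.
  exact: hp (Ordinal ie, Ordinal jn', true) (mem_enum _ _).
have e2 : spinor_dot r (fun g => 1 *: espinor b n i 'X^j g) = 0.
  exact: hp (Ordinal ie, Ordinal jn', false) (mem_enum _ _).
have -> : (fun g : SU => a *: espinor b n i 'X^j g) =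
    fun g => (complex.Re a)%:C *: (1 *: espinor b n i 'X^j g) +
      (complex.Im a)%:C *: ('i%C *: espinor b n i 'X^j g).
  apply/funext => g; rewrite !scalerA -scalerDl; congr (_ *: _).
  by case: (a) => x y; simpc.
rewrite spinor_dotDr//; [|exact/scontZ/scontZ..].
have z1 := spinor_dotZr (complex.Re a) cr (scontZ 1 cE).
have z2 := spinor_dotZr (complex.Im a) cr (scontZ 'i%C cE).
by rewrite e2 mulr0 in z1; rewrite e1 mulr0 in z2; rewrite z1 z2 addr0.
Qed.

(** Pairs (r, D r) built one eigenspinor at a time, so that functions of D can be applied by
    induction on the construction. *)
Inductive dspan : spinor_fun R -> spinor_fun R -> Prop :=
| dspan0 : dspan (fun=> 0) (fun=> 0)
| dspan_add b n i (Q : PC) r u : (size Q <= n.+1)%N -> (i < edim b n)%N -> dspan r u ->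
    dspan (fun g => espinor b n i Q g + r g)
          (fun g => (eigval b n)%:C *: espinor b n i Q g + u g).

Lemma dspan_ext r u r' u' : r =1 r' -> u =1 u' -> dspan r u -> dspan r' u'.
Proof. by move=> /funext -> /funext ->. Qed.

Lemma dspanD r u r' u' : dspan r u -> dspan r' u' ->
  dspan (fun g => r g + r' g) (fun g => u g + u' g).
Proof.
move=> h h'; elim: h => [|b n i Q {}r {}u sQ ie _ IH].
  by apply: dspan_ext h' => g; rewrite add0r.
by apply: dspan_ext (dspan_add sQ ie IH) => g; rewrite addrA.
Qed.

Lemma dspanZ c r u : dspan r u -> dspan (fun g => c *: r g) (fun g => c *: u g).
Proof.
elim=> [|b n i Q {}r {}u sQ ie _ IH].
  by apply: dspan_ext dspan0 => g; rewrite scaler0.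
have sQ' : (size (c *: Q) <= n.+1)%N by rewrite (leq_trans (size_scale_leq _ _)).
apply: dspan_ext (dspan_add sQ' ie IH) => g; rewrite (espinorZ b n i c Q g).
  by move: (espinor b n i Q g) (r g) => x y; rewrite scalerDr.
by move: (espinor b n i Q g) (u g) => x y; rewrite scalerDr !scalerA mulrC.
Qed.

Lemma dspan_spoly r u : dspan r u -> spoly r /\ spoly u.
Proof.
elim=> [|b n i Q {}r {}u sQ ie _ [h1 h2]]; first by split; exact: spoly0.
have s := @spoly_espinor R b n i Q.
by split; apply: spolyD => //; exact: spolyZ.
Qed.

Lemma dspan_dirac r u : dspan r u -> dirac_op r = u.
Proof.
elim=> [|b n i Q {}r {}u sQ ie h IH]; first exact: dirac_op0.
rewrite dirac_opD; last 2 first.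
- exact/spoly_class1/spoly_espinor.
- by have [s _] := dspan_spoly h; exact: spoly_class1.
apply/funext => g; congr (_ + _); last exact: (congr1 (@^~ g) IH).
exact: (congr1 (@^~ g) (dirac_espinor sQ ie)).
Qed.

(** Each eigenspinor summand is divided by its eigenvalue minus lambda, which gives p = (D - lambda)
    r. *)
Lemma spoly_resolvent (lambda : C) (p : spinor_fun R) :
  (forall b n, (0 < edim b n)%N -> (eigval b n)%:C != lambda) -> spoly p ->
  exists r u, dspan r u /\ p = (fun g => u g - lambda *: r g).
Proof.
move=> hl /spoly_tspan; elim=> [|c b n i j psi jn ie _ [r [u [d e]]]].
  exists (fun=> 0), (fun=> 0); split; first exact: dspan0.
  by apply/funext => g; rewrite scaler0 subr0.
have m0 : (eigval b n)%:C - lambda != 0.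
  by rewrite subr_eq0; apply: hl; exact: leq_ltn_trans ie.
pose k := c / ((eigval b n)%:C - lambda).
have sQ : (size (k *: 'X^j : PC) <= n.+1)%N.
  by rewrite (leq_trans (size_scale_leq _ _))// size_polyXn.
do 2!eexists; split; first exact: (dspan_add sQ ie d).
apply/funext => g; rewrite e (espinorZ b n i k 'X^j g).
move: (espinor b n i 'X^j g) (u g) (r g) => x y z.
by rewrite scalerDr opprD addrACA !scalerA -scalerBl -mulrBl mulrC /k divfK.
Qed.

Definition shift (a : R) (psi : spinor_fun R) : spinor_fun R :=
  fun g => dirac_op psi g - a%:C *: psi g.

Lemma scont_shift a psi : class1 psi -> scont (shift a psi).
Proof.
move=> h; apply: scontB; first exact: scont_dirac.
by apply: scontZ; exact: class1_cont.
Qed.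

Lemma shift_symmetric a (psi phi : spinor_fun R) : class1 psi -> class1 phi ->
  spinor_dot (shift a psi) phi = spinor_dot psi (shift a phi).
Proof.
move=> h1 h2; have c1 := class1_cont h1; have c2 := class1_cont h2.
have c3 := scont_dirac h1; have c4 := scont_dirac h2.
have c5 : scont (fun g => a%:C *: psi g) by exact: scontZ.
have c6 : scont (fun g => a%:C *: phi g) by exact: scontZ.
rewrite (spinor_dotBl c3 c5 c2) (spinor_dotBr c1 c4 c6).
by rewrite (spinor_dotZl a c1 c2) (spinor_dotZr a c1 c2) (dirac_symmetric h1 h2).
Qed.

(* With c(m) = sqrt((m - a)^2 - d^2), the function w = c(D) r of D makes the
   inequality an equality. *)
Lemma dspan_gap (a d : R) r u : 0 <= d ->
  (forall b n, (0 < edim b n)%N -> d <= `|eigval b n - a|) -> dspan r u ->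
  d ^+ 2 * spinor_dot r r <= spinor_dot (shift a r) (shift a r).
Proof.
move=> d0 hd dru; pose c (m : R) := Num.sqrt ((m - a) ^+ 2 - d ^+ 2).
suff [w [_ _ ->]] : exists w, [/\ scont w,
    forall (E : spinor_fun R) (m : R), class1 E -> dirac_op E = (fun g => m%:C *: E g) ->
      spinor_dot E w = c m * spinor_dot E r &
    spinor_dot (shift a r) (shift a r) = d ^+ 2 * spinor_dot r r + spinor_dot w w].
  by rewrite lerDl spinor_dot_ge0.
elim: dru => [|b n i Q {}r {}u sQ ie dru [w [cw ew IH]]].
  have c0 := spoly_scont spoly0; exists (fun=> 0); split=> // [E m h _|].
    have cE := class1_cont h.
    by rewrite spinor_dotC spinor_dot0l// mulr0.
  have -> : shift a (fun=> 0) = (fun=> 0).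
    by apply/funext => g; rewrite /shift dirac_op0 scaler0 subr0.
  by rewrite spinor_dot0l// mulr0 addr0.
set f := espinor b n i Q; set m := eigval b n : R.
have ef : dirac_op f = fun g => m%:C *: f g by exact: dirac_espinor.
have c1f : class1 f by exact/spoly_class1/spoly_espinor.
have c1r : class1 r by have [s _] := dspan_spoly dru; exact: spoly_class1.
have cf := class1_cont c1f; have cr := class1_cont c1r.
have cs := scont_shift a c1r.
have cwf : scont (fun g => (c m)%:C *: f g) by exact: scontZ.
exists (fun g => (c m)%:C *: f g + w g); split=> [|E l hE eE|]; first exact: scontD.
  have cE := class1_cont hE; rewrite !spinor_dotDr// spinor_dotZr// (ew _ l)// mulrDr.
  congr (_ + _); have := eigenspinor_orthogonal hE c1f eE ef.
  move=> /eqP; rewrite -subr_eq0 -mulrBl mulf_eq0 subr_eq0 => /orP[/eqP ->//|/eqP ->].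
  by rewrite !mulr0.
have sf : shift a f = fun g => (m - a)%:C *: f g.
  by apply/funext => g; rewrite /shift ef rmorphB scalerBl.
have e : shift a (fun g => f g + r g) = fun g => (m - a)%:C *: f g + shift a r g.
  apply/funext => g; rewrite -(congr1 (@^~ g) sf) /shift (congr1 (@^~ g) (dirac_opD c1f c1r)).
  by rewrite scalerDr opprD addrACA.
have cmf : scont (fun g => (m - a)%:C *: f g) by exact: scontZ.
have fs : spinor_dot f (shift a r) = (m - a) * spinor_dot f r.
  by rewrite -shift_symmetric// sf spinor_dotZl.
rewrite e (spinor_dotZDD (m - a) cf cs) (spinor_dotZDD (c m) cf cw) (spinor_dotDD cf cr).
rewrite fs (ew f m c1f ef) IH.
have cm2 : c m ^+ 2 = (m - a) ^+ 2 - d ^+ 2.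
  rewrite sqr_sqrtr// subr_ge0 -[leRHS]real_normK ?num_real// ler_sqr ?nnegrE//.
  by apply: hd; exact: leq_ltn_trans ie.
move: (spinor_dot f f) (spinor_dot f r) (spinor_dot r r) (spinor_dot w w) (c m) cm2.
by move=> x y z t k hk; ring: hk.
Qed.

(* Duality: a polynomial p is (D - a) r with d |r| <= |p|, so that
   2 <psi, p> - |p|^2 <= |(D - a) psi|^2 / d^2; now let p tend to psi. *)
Lemma shift_lower_bound (a d : R) (psi : spinor_fun R) : 0 <= d ->
  (forall b n, (0 < edim b n)%N -> d <= `|eigval b n - a|) -> class1 psi ->
  d ^+ 2 * spinor_dot psi psi <= spinor_dot (shift a psi) (shift a psi).
Proof.
rewrite le_eqVlt => /orP[/eqP <- _ _|d0 hd h].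
  by rewrite expr0n mul0r spinor_dot_ge0.
have V0 : 0 <= su2_int (fun _ : SU => 1 : R) by apply: su2_int_ge0 => _; exact: ler01.
have c := class1_cont h; have cs := scont_shift a h.
have ha b n : (0 < edim b n)%N -> (eigval b n)%:C != a%:C.
  move=> e0; rewrite (inj_eq (@complexI R)); apply/eqP => e.
  by have := hd b n e0; rewrite e subrr normr0 leNgt d0.
rewrite mulrC -ler_pdivlMr ?exprn_gt0//; apply: (le_of_approx V0) => e e0.
have [p sp hp] := spoly_approx_normsq c e0; have cp := spoly_scont sp.
have [r [u [dru ep]]] := spoly_resolvent ha sp.
have er : p = shift a r by rewrite ep /shift (dspan_dirac dru).
have c1r : class1 r by have [s _] := dspan_spoly dru; exact: spoly_class1.
have cr := class1_cont c1r.
have gr := dspan_gap (ltW d0) hd dru; rewrite -er in gr.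
have pp : spinor_dot psi p = spinor_dot (shift a psi) r by rewrite er shift_symmetric.
have c1 : scont (fun g => (d^-1)%:C *: shift a psi g) by exact: scontZ.
have c2 : scont (fun g => d%:C *: r g) by exact: scontZ.
(* Applied to d^(-1) (D - a) psi and d r, whose product is <(D - a) psi, r> = <psi, p>. *)
have := spinor_dot_amgm c1 c2.
rewrite (spinor_dotZl d^-1 cs c2) (spinor_dotZr d cs cr) (spinor_dotZl d^-1 cs c1).
rewrite (spinor_dotZr d^-1 cs cs) (spinor_dotZl d cr c2) (spinor_dotZr d cr cr).
have := spinor_dot_le_sup (scontB c cp) hp.
rewrite (spinor_dotBl c cp (scontB c cp)) (spinor_dotBr c c cp) (spinor_dotBr cp c cp).
rewrite (spinor_dotC p psi) pp.
rewrite (mulrA d^-1 d) mulVf ?gt_eqF// mul1r (mulrA d d) -(expr2 d).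
rewrite (mulrA d^-1 d^-1) -expr2 exprVn (mulrC (_ ^-1)).
move: gr; move: (d ^+ 2 * _) (_ / _) (_ * su2_int _) (spinor_dot psi psi) (spinor_dot p p).
by move: (spinor_dot (shift a psi) r) => x y z t k l; lra.
Qed.

(** The cross term <(D - a) psi, i psi> vanishes: D - a is symmetric and commutes with i, while i is
    skew for the real product. *)
Lemma dirac_shift_normsq (a b : R) (psi : spinor_fun R) : class1 psi ->
  spinor_dot (dirac_shift (a +i* b) psi) (dirac_shift (a +i* b) psi) =
  spinor_dot (shift a psi) (shift a psi) + b ^+ 2 * spinor_dot psi psi.
Proof.
move=> h; have c := class1_cont h; have cs := scont_shift a h.
have c1i : class1 (fun g => 'i%C *: psi g) by exact: class1Z.
have ci := class1_cont c1i.
have ii (x y : spinor_fun R) : scont x -> scont y ->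
    spinor_dot (fun g => 'i%C *: x g) y = - spinor_dot x (fun g => 'i%C *: y g).
  move=> cx cy; rewrite spinor_dotZ_conj -mulN1r.
  rewrite -(spinor_dotZr (-1) cx (scontZ 'i%C cy)); congr spinor_dot.
  by apply/funext => g; move: (y g) => v; rewrite scalerA; congr (_ *: _); simpc.
have cb : scont (fun g => b%:C *: ('i%C *: psi g)) by exact: scontZ.
have -> : dirac_shift (a +i* b) psi = fun g => shift a psi g - b%:C *: ('i%C *: psi g).
  apply/funext => g; rewrite /dirac_shift /shift; move: (dirac_op psi g) (psi g) => x y.
  by rewrite -addrA -opprD scalerA -scalerDl; congr (_ - _ *: _); simpc.
have si : shift a (fun g => 'i%C *: psi g) = fun g => 'i%C *: shift a psi g.
  apply/funext => g; rewrite /shift (dirac_opZ 'i%C h).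
  by move: (dirac_op psi g) (psi g) => x y; rewrite scalerBr !scalerA [_ * 'i%C]mulrC.
have z : spinor_dot (shift a psi) (fun g => 'i%C *: psi g) = 0.
  have e := shift_symmetric a h c1i; have := ii _ _ c cs.
  by rewrite (spinor_dotC _ (shift a psi)) e si; lra.
have n1 : spinor_dot (fun g => 'i%C *: psi g) (fun g => 'i%C *: psi g) = spinor_dot psi psi.
  rewrite (ii _ _ c ci) (_ : (fun g => _) = fun g => (-1)%:C *: psi g).
    by rewrite (spinor_dotZr _ c c) mulN1r opprK.
  by apply/funext => g; move: (psi g) => v; rewrite scalerA; congr (_ *: _); simpc.
rewrite (spinor_dotBl cs cb (scontB cs cb)) (spinor_dotBr cs cs cb) (spinor_dotBr cb cs cb).
rewrite (spinor_dotZr b cs ci) (spinor_dotC _ (shift a psi)) (spinor_dotZr b cs ci).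
by rewrite (spinor_dotZl b ci cb) (spinor_dotZr b ci ci) z n1; ring.
Qed.
End spectral_theory.

(** * Invariants of the binary tetrahedral group *)

Section tetrahedral_invariants.
Context {R : realType}.
Notation SU := (SU2 R).
Notation C := R[i].
Notation PC := {poly R[i]}.

Lemma quatM (a b c d a' b' c' d' : R) : quat a b c d *m quat a' b' c' d' =
  quat (a * a' - b * b' - c * c' - d * d') (a * b' + b * a' + c * d' - d * c')
       (a * c' - b * d' + c * a' + d * b') (a * d' + b * c' - c * b' + d * a').
Proof.
by rewrite !quatE mx22M; congr mx22; simpc; apply/eqP; rewrite eq_complex /=;
  apply/andP; split; apply/eqP; ring.
Qed.

Lemma unit_quatI : 0 ^+ 2 + 1 ^+ 2 + 0 ^+ 2 + 0 ^+ 2 = 1 :> R.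
Proof. by ring. Qed.
Lemma unit_quatJ : 0 ^+ 2 + 0 ^+ 2 + 1 ^+ 2 + 0 ^+ 2 = 1 :> R.
Proof. by ring. Qed.
Lemma unit_quatT : 2^-1 ^+ 2 + 2^-1 ^+ 2 + 2^-1 ^+ 2 + 2^-1 ^+ 2 = 1 :> R.
Proof. by field. Qed.

Definition suI : SU := Sub (quat 0 1 0 0) (is_su2_quat unit_quatI).
Definition suJ : SU := Sub (quat 0 0 1 0) (is_su2_quat unit_quatJ).
Definition suT : SU := Sub (quat 2^-1 2^-1 2^-1 2^-1) (is_su2_quat unit_quatT).

Lemma signed_quat (s0 s1 s2 s3 : bool) :
  2^-1 *: ((-1) ^+ s0 *: 1%:M + (-1) ^+ s1 *: qI R + (-1) ^+ s2 *: qJ R + (-1) ^+ s3 *: qK R)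
  = quat ((-1) ^+ s0 / 2) ((-1) ^+ s1 / 2) ((-1) ^+ s2 / 2) ((-1) ^+ s3 / 2).
Proof.
have e (s : bool) : 2^-1 * (-1) ^+ s = ((-1) ^+ s / 2)%:C :> C.
  by rewrite mulrC rmorphM fmorphV rmorph_sign rmorph_nat.
by rewrite /quat; move: (qI R) (qJ R) (qK R) => I J K; rewrite !scalerDr !scalerA !e.
Qed.

Lemma binary_tetrahedral_gen g : g = suI \/ g = suJ \/ g = suT -> binary_tetrahedral g.
Proof.
case=> [->|[->|->]].
- left; exists false; rewrite /= expr0 !scale1r !inE; apply/orP; right; apply/orP; left.
  by apply/eqP; rewrite /quat !scale0r add0r !addr0 scale1r.
- left; exists false; rewrite /= expr0 !scale1r !inE; do 2!(apply/orP; right); apply/orP; left.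
  by apply/eqP; rewrite /quat !scale0r !add0r addr0 scale1r.
- right; exists false, false, false, false; rewrite signed_quat /=.
  by rewrite !expr0 !mul1r.
Qed.

(** The generators yield the quaternion group and T^2 = T - 1, and the left translates of T and T^2
    by its eight elements are the sixteen elements with coordinates 1/2 or -1/2. [L] records
    coordinates, which makes the enumeration a matter of signs. *)
Lemma binary_tetrahedral_ind (K : SU -> Prop) :
  (forall x y, K x -> K y -> K (mulSU x y)) -> K suI -> K suJ -> K suT ->
  forall g, binary_tetrahedral g -> K g.
Proof.
move=> KM KI KJ KT g.
pose L a b c d := exists2 h, K h & val h = quat a b c d.
have LM a b c d a' b' c' d' : L a b c d -> L a' b' c' d' ->
  L (a * a' - b * b' - c * c' - d * d') (a * b' + b * a' + c * d' - d * c')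
    (a * c' - b * d' + c * a' + d * b') (a * d' + b * c' - c * b' + d * a').
  move=> [x Kx ex] [y Ky ey]; exists (mulSU x y); first exact: KM.
  by rewrite -quatM -ex -ey.
have LK a b c d : val g = quat a b c d -> L a b c d -> K g.
  by move=> e [h Kh eh]; have -> : g = h by apply: val_inj; rewrite e eh.
have LE a b c d a' b' c' d' : a = a' -> b = b' -> c = c' -> d = d' ->
  L a b c d -> L a' b' c' d' by move=> -> -> -> ->.
have I0 : L 0 1 0 0 by exists suI.
have J0 : L 0 0 1 0 by exists suJ.
have T0 : L 2^-1 2^-1 2^-1 2^-1 by exists suT.
clearbody L.
have LI a b c d : L a b c d -> L (- b) a (- d) c.
  by move=> h; apply: LE (LM _ _ _ _ _ _ _ _ I0 h); ring.
have LJ a b c d : L a b c d -> L (- c) d a (- b).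
  by move=> h; apply: LE (LM _ _ _ _ _ _ _ _ J0 h); ring.
have LN a b c d : L a b c d -> L (- a) (- b) (- c) (- d).
  by move=> /LI/LI.
have T2 : L (- 2^-1) 2^-1 2^-1 2^-1.
  by apply: LE (LM _ _ _ _ _ _ _ _ T0 T0); field.
have LQ a b c d : L a b c d -> [/\ L (- b) a (- d) c, L (- c) d a (- b) & L (- d) (- c) b a].
  move=> h; split; [exact: LI|exact: LJ|].
  by have := LI _ _ _ _ (LJ _ _ _ _ h); rewrite opprK.
have LQN a b c d : L a b c d -> [/\ L (- a) (- b) (- c) (- d), L b (- a) d (- c),
    L c (- d) (- a) b & L d c (- b) (- a)].
  move=> h; have [h1 h2 h3] := LQ _ _ _ _ h.
  split; [exact: LN|have := LN _ _ _ _ h1|have := LN _ _ _ _ h2|have := LN _ _ _ _ h3];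
  by rewrite !opprK.
have [Q1 Q2 Q3] := LQ _ _ _ _ I0; have [Q4 Q5 Q6 Q7] := LQN _ _ _ _ I0.
have [T3 T4 T5] := LQ _ _ _ _ T0; have [T6 T7 T8 T9] := LQN _ _ _ _ T0.
have [S3 S4 S5] := LQ _ _ _ _ T2; have [S6 S7 S8 S9] := LQN _ _ _ _ T2.
rewrite ?opprK ?oppr0 in Q1 Q2 Q3 Q4 Q5 Q6 Q7 T3 T4 T5 T6 T7 T8 T9 S3 S4 S5 S6 S7 S8 S9.
case=> [[s]|[s0 [s1 [s2 [s3]]]]].
  have eq0 (u : 'M[C]_2) a b c d : (-1) ^+ s *: u = quat a b c d -> val g = (-1) ^+ s *: u ->
      L a b c d -> K g by move=> e eg; apply: LK; rewrite eg.
  have sg : (-1) ^+ s = ((-1) ^+ s)%:C :> C by rewrite rmorph_sign.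
  rewrite /= !inE => /orP[/eqP|/orP[/eqP|/orP[/eqP|/eqP]]] eg.
  - apply: (eq0 _ ((-1) ^+ s) 0 0 0 _ eg); first by rewrite /quat !scale0r !addr0 sg.
    by case: s {eq0 sg eg}; rewrite ?expr0 ?expr1; [exact: Q1|exact: Q5].
  - apply: (eq0 _ 0 ((-1) ^+ s) 0 0 _ eg); first by rewrite /quat !scale0r !addr0 add0r sg.
    by case: s {eq0 sg eg}; rewrite ?expr0 ?expr1; [exact: Q4|exact: I0].
  - apply: (eq0 _ 0 0 ((-1) ^+ s) 0 _ eg); first by rewrite /quat !scale0r addr0 !add0r sg.
    by case: s {eq0 sg eg}; rewrite ?expr0 ?expr1; [exact: Q7|exact: J0].
  - apply: (eq0 _ 0 0 0 ((-1) ^+ s) _ eg); first by rewrite /quat !scale0r !add0r sg.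
    by case: s {eq0 sg eg}; rewrite ?expr0 ?expr1; [exact: Q2|exact: Q6].
rewrite signed_quat => /LK; apply.
by case: s0; case: s1; case: s2; case: s3; rewrite !(expr0, expr1, mulN1r, mul1r).
Qed.

Lemma val_suI : val suI = quat 0 1 0 0 :> 'M[C]_2. Proof. by []. Qed.
Lemma val_suJ : val suJ = quat 0 0 1 0 :> 'M[C]_2. Proof. by []. Qed.
Lemma val_suT : val suT = quat 2^-1 2^-1 2^-1 2^-1 :> 'M[C]_2. Proof. by []. Qed.

Local Opaque suI suJ suT.

Lemma rowformD n (P Q : PC) M : rowform n (P + Q) M = rowform n P M + rowform n Q M.
Proof. exact: hformD. Qed.

Lemma rowformZ n c (P : PC) M : rowform n (c *: P) M = c *: rowform n P M.
Proof. by rewrite -[RHS]mul_polyC; exact: hformZ. Qed.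

Lemma rowform_mul n m (P Q : PC) M : (size P <= n.+1)%N -> (size Q <= m.+1)%N ->
  rowform (n + m) (P * Q) M = rowform n P M * rowform m Q M.
Proof. exact: hformM. Qed.

Definition tetra_invariant n (Q : PC) := (size Q <= n.+1)%N /\
  [/\ rowform n Q (val suI) = Q, rowform n Q (val suJ) = Q & rowform n Q (val suT) = Q].

Lemma tetra_invariant_tetrahedral n Q : tetra_invariant n Q ->
  forall g : SU, binary_tetrahedral g -> rowform n Q (val g) = Q.
Proof.
move=> [sQ [hI hJ hT]]; apply: binary_tetrahedral_ind => // x y hx hy.
by rewrite -[val (mulSU x y)]/(val x *m val y) rowformM// hy hx.
Qed.

Lemma tetra_invariantD n P Q : tetra_invariant n P -> tetra_invariant n Q -> tetra_invariant n (P + Q).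
Proof.
move=> [sP [p1 p2 p3]] [sQ [q1 q2 q3]]; split.
  by rewrite (leq_trans (size_polyD _ _))// geq_max sP sQ.
by split; rewrite rowformD; [rewrite p1 q1|rewrite p2 q2|rewrite p3 q3].
Qed.

Lemma tetra_invariantZ n c P : tetra_invariant n P -> tetra_invariant n (c *: P).
Proof.
move=> [sP [p1 p2 p3]]; split; first by rewrite (leq_trans (size_scale_leq _ _)).
by split; rewrite rowformZ; [rewrite p1|rewrite p2|rewrite p3].
Qed.

Lemma tetra_invariantM n m P Q : tetra_invariant n P -> tetra_invariant m Q -> tetra_invariant (n + m) (P * Q).
Proof.
move=> [sP [p1 p2 p3]] [sQ [q1 q2 q3]]; split.
  by rewrite (leq_trans (size_polyMleq _ _))//; move: (size P) (size Q) sP sQ => x y; lia.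
by split; rewrite rowform_mul//; [rewrite p1 q1|rewrite p2 q2|rewrite p3 q3].
Qed.

Lemma tetra_invariant_div n (P Q : PC) : P != 0 -> (size Q <= n.+1)%N ->
  tetra_invariant 6 P -> tetra_invariant (6 + n) (P * Q) -> tetra_invariant n Q.
Proof.
move=> P0 sQ [sP [p1 p2 p3]] [_ [q1 q2 q3]]; split=> //.
split; apply: (mulfI P0).
- by rewrite -[RHS]q1 rowform_mul// p1.
- by rewrite -[RHS]q2 rowform_mul// p2.
- by rewrite -[RHS]q3 rowform_mul// p3.
Qed.

Lemma tetra_invariant1 : tetra_invariant 0 1.
Proof.
split; first by rewrite size_poly1.
by split; rewrite /rowform /hform big_ord1 coefC /= !expr0 !mulr1.
Qed.

Lemma tetra_invariantX n k P : tetra_invariant n P -> tetra_invariant (k * n) (P ^+ k).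
Proof.
move=> h; elim: k => [|k IH]; first by rewrite mul0n expr0; exact: tetra_invariant1.
by rewrite mulSn exprS; exact: tetra_invariantM.
Qed.

(* Klein's forms x y (x^4 - y^4), x^8 + 14 x^4 y^4 + y^8 and
   x^12 - 33 x^8 y^4 - 33 x^4 y^8 + y^12. *)
Definition form6 : PC := 'X^5 + (- 1) *: 'X^1.
Definition form8 : PC := 'X^8 + 14%:R *: 'X^4 + 'X^0.
Definition form12 : PC := 'X^12 + (- 33%:R) *: 'X^8 + (- 33%:R) *: 'X^4 + 'X^0.

Lemma form6E : form6 = 'X^5 - 'X.
Proof. by rewrite /form6 scaleN1r expr1. Qed.

Lemma form8E : form8 = 'X^8 + 14 * 'X^4 + 1.
Proof. by rewrite /form8 -mul_polyC polyC_natr expr0. Qed.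

Lemma form12E : form12 = 'X^12 - 33 * 'X^8 - 33 * 'X^4 + 1.
Proof. by rewrite /form12 -!mul_polyC polyCN polyC_natr expr0 !mulNr. Qed.

Lemma hform6E (a b : PC) : hform 6 form6 a b = a * b * (a ^+ 4 - b ^+ 4).
Proof.
by rewrite /form6 hformD hformZ !hformXn// !subSS !subn0 polyCN polyC1; ring.
Qed.

Lemma hform8E (a b : PC) : hform 8 form8 a b =
  (a ^+ 4) ^+ 2 + 14 * (a ^+ 4 * b ^+ 4) + (b ^+ 4) ^+ 2.
Proof.
by rewrite /form8 !hformD hformZ !hformXn// !subSS !subn0 polyC_natr; ring.
Qed.

Lemma hform12E (a b : PC) : hform 12 form12 a b =
  (a ^+ 4) ^+ 3 - 33 * ((a ^+ 4) ^+ 2 * b ^+ 4) - 33 * (a ^+ 4 * (b ^+ 4) ^+ 2) + (b ^+ 4) ^+ 3.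
Proof.
by rewrite /form12 !hformD !hformZ !hformXn// !subSS !subn0 polyCN polyC_natr; ring.
Qed.

Lemma size_form6 : (size form6 <= 7)%N.
Proof.
apply: (leq_trans (size_polyD _ _)); rewrite geq_max size_polyXn /=.
by apply: (leq_trans (size_scale_leq _ _)); rewrite size_polyXn.
Qed.

Lemma size_form8 : (size form8 <= 9)%N.
Proof.
apply: (leq_trans (size_polyD _ _)); rewrite geq_max size_polyXn andbT.
apply: (leq_trans (size_polyD _ _)); rewrite geq_max size_polyXn /=.
by apply: (leq_trans (size_scale_leq _ _)); rewrite size_polyXn.
Qed.

Lemma size_form12 : (size form12 <= 13)%N.
Proof.
apply: (leq_trans (size_polyD _ _)); rewrite geq_max size_polyXn andbT.
apply: (leq_trans (size_polyD _ _)); rewrite geq_max; apply/andP; split; last first.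
  by apply: (leq_trans (size_scale_leq _ _)); rewrite size_polyXn.
apply: (leq_trans (size_polyD _ _)); rewrite geq_max size_polyXn /=.
by apply: (leq_trans (size_scale_leq _ _)); rewrite size_polyXn.
Qed.

Lemma rowA_quat (a b c d : R) :
  rowA (quat a b c d) = (a +i* b)%:P * 'X + (- c +i* d)%:P :> PC.
Proof. by rewrite /rowA quatE !mxE. Qed.

Lemma rowB_quat (a b c d : R) :
  rowB (quat a b c d) = (c +i* d)%:P * 'X + (a -i* b)%:P :> PC.
Proof. by rewrite /rowB quatE !mxE. Qed.

Lemma rowI : rowA (val suI) = ('i%C)%:P * 'X :> PC /\ rowB (val suI) = - ('i%C)%:P :> PC.
Proof.
have -> : - ('i%C)%:P = (0 +i* (-1))%:P :> PC by rewrite -polyCN; congr polyC; simpc.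
rewrite val_suI rowA_quat rowB_quat oppr0 -[0 +i* 0]/(0 : C) polyC0 mul0r add0r addr0.
by [].
Qed.

Lemma rowJ : rowA (val suJ) = -1 :> PC /\ rowB (val suJ) = 'X :> PC.
Proof.
have -> : -1 = (-1 +i* 0)%:P :> PC by rewrite -polyC1 -polyCN; congr polyC; simpc.
rewrite val_suJ rowA_quat rowB_quat oppr0 -[0 +i* 0]/(0 : C) -[1 +i* 0]/(1 : C).
by rewrite polyC0 mul0r add0r addr0 polyC1 mul1r.
Qed.

Lemma rowT : rowA (val suT) = (2^-1)%:P * (1 + ('i%C)%:P) * ('X + ('i%C)%:P) :> PC /\
  rowB (val suT) = (2^-1)%:P * (1 + ('i%C)%:P) * ('X - ('i%C)%:P) :> PC.
Proof.
have e (x y : R) : (x +i* y)%:P = (x%:C)%:P + ('i%C)%:P * (y%:C)%:P :> PC.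
  by rewrite -polyCM -polyCD; congr polyC; simpc.
have eN (x : R) : ((- x)%:C)%:P = - (x%:C)%:P :> PC by rewrite -polyCN; congr polyC; exact: rmorphN.
have h : ((2^-1)%:C)%:P = (2^-1)%:P :> PC by rewrite fmorphV rmorph_nat.
have hJ := @imag_polyC_sqr R.
rewrite val_suT rowA_quat rowB_quat (e 2^-1 2^-1) (e (- 2^-1) 2^-1) (e 2^-1 (- 2^-1)) eN h.
by move: ('i%C)%:P (2^-1)%:P hJ => J k hJ; split; ring: hJ.
Qed.

Lemma rowT4 : let I := ('i%C)%:P in let q := (4^-1)%:P in
  let a := 'X^4 - 6 * 'X^2 + 1 in let b := 4 * ('X^3 - 'X) in
  rowA (val suT) ^+ 4 = - q * (a + I * b) :> PC /\ rowB (val suT) ^+ 4 = - q * (a - I * b) :> PC.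
Proof.
have [-> ->] := rowT; have hJ := @imag_polyC_sqr R.
have hq : (2^-1)%:P * (2^-1)%:P = (4^-1)%:P :> PC by rewrite -polyCM; congr polyC; field.
have h4 : 4 * (4^-1)%:P = 1 :> PC by rewrite -(polyC_natr _ 4) -polyCM divff// pnatr_eq0.
move: ('i%C)%:P (2^-1)%:P (4^-1)%:P hJ hq h4 => I h q hJ hq h4 /=.
have e : (h * (1 + I)) ^+ 4 = - q.
  transitivity (- (4 * q) * q); last by rewrite h4 mulN1r.
  by transitivity ((h * h) * (h * h) * (1 + I) ^+ 4); [ring|rewrite hq; ring: hJ].
by split; rewrite exprMn e; ring: hJ.
Qed.

Lemma tetra_invariant_form6 : tetra_invariant 6 form6.
Proof.
split; first exact: size_form6.
have hJ := @imag_polyC_sqr R.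
have [i1 i2] := rowI; have [j1 j2] := rowJ; have [t1 t2] := rowT; have [t3 t4] := rowT4.
split; rewrite /rowform hform6E.
- rewrite i1 i2 form6E; move: ('i%C)%:P hJ => I hJ; by ring: hJ.
- by rewrite j1 j2 form6E; ring.
rewrite t3 t4 t1 t2 form6E /=.
have hq : (2^-1)%:P * (2^-1)%:P = (4^-1)%:P :> PC by rewrite -polyCM; congr polyC; field.
have h4 : 4 * (4^-1)%:P = 1 :> PC by rewrite -(polyC_natr _ 4) -polyCM divff// pnatr_eq0.
move: ('i%C)%:P (2^-1)%:P (4^-1)%:P hJ hq h4 => I h q hJ hq h4.
transitivity ((4 * q) * (4 * q) * ('X^5 - 'X)); last by rewrite h4 !mul1r.
transitivity ((h * h) * (1 + I) ^+ 2 * (('X + I) * ('X - I)) * (- q * (2 * I * (4 * ('X^3 - 'X))))).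
  by ring.
by rewrite hq; ring: hJ.
Qed.

Lemma rowI4 : rowA (val suI) ^+ 4 = 'X^4 :> PC /\ rowB (val suI) ^+ 4 = 1 :> PC.
Proof.
have [-> ->] := rowI; have hJ := @imag_polyC_sqr R.
by move: ('i%C)%:P hJ => I hJ; split; ring: hJ.
Qed.

Lemma rowJ4 : rowA (val suJ) ^+ 4 = 1 :> PC /\ rowB (val suJ) ^+ 4 = 'X^4 :> PC.
Proof. by have [-> ->] := rowJ; split; [ring|]. Qed.

Lemma tetra_invariant_form8 : tetra_invariant 8 form8.
Proof.
split; first exact: size_form8.
have hJ := @imag_polyC_sqr R.
have [i1 i2] := rowI4; have [j1 j2] := rowJ4; have [t3 t4] := rowT4.
split; rewrite /rowform hform8E form8E.
- by rewrite i1 i2; ring.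
- by rewrite j1 j2; ring.
rewrite t3 t4 /=.
have h4 : 4 * (4^-1)%:P = 1 :> PC by rewrite -(polyC_natr _ 4) -polyCM divff// pnatr_eq0.
move: ('i%C)%:P (4^-1)%:P hJ h4 => I q hJ h4.
transitivity ((4 * q) * (4 * q) * ('X^8 + 14 * 'X^4 + 1)); last by rewrite h4 !mul1r.
by ring: hJ.
Qed.

Lemma tetra_invariant_form12 : tetra_invariant 12 form12.
Proof.
split; first exact: size_form12.
have hJ := @imag_polyC_sqr R.
have [i1 i2] := rowI4; have [j1 j2] := rowJ4; have [t3 t4] := rowT4.
split; rewrite /rowform hform12E form12E.
- by rewrite i1 i2; ring.
- by rewrite j1 j2; ring.
rewrite t3 t4 /=.
have h4 : 4 * (4^-1)%:P = 1 :> PC by rewrite -(polyC_natr _ 4) -polyCM divff// pnatr_eq0.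
move: ('i%C)%:P (4^-1)%:P hJ h4 => I q hJ h4.
transitivity ((4 * q) * (4 * q) * (4 * q) * ('X^12 - 33 * 'X^8 - 33 * 'X^4 + 1)).
  by ring: hJ.
by rewrite h4 !mul1r.
Qed.
End tetrahedral_invariants.

(** * Dimension of the spaces of invariant forms *)

Section basis_of_invariants.
Context {R : realType}.
Notation SU := (SU2 R).
Notation C := R[i].
Notation PC := {poly R[i]}.

Lemma horner_rowform n (Q : PC) M x : (rowform n Q M).[x] =
  \sum_(j < n.+1) Q`_j * ((rowA M).[x] ^+ j * (rowB M).[x] ^+ (n - j)).
Proof.
rewrite /rowform /hform horner_sum; apply: eq_bigr => j _.
by rewrite hornerM hornerC hornerM !horner_exp.
Qed.

(** Read on the projective line: [M] acts by the homography x -> A(x)/B(x), and an invariant form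
    vanishes at x when it vanishes at the image. [horner_rowform_inf] is the case of an image at
    infinity. *)
Lemma horner_rowform_ratio n (Q : PC) M x y : (size Q <= n.+1)%N ->
  (rowA M).[x] = y * (rowB M).[x] -> (rowform n Q M).[x] = (rowB M).[x] ^+ n * Q.[y].
Proof.
move=> sQ e; rewrite horner_rowform (horner_coef_wide _ sQ) mulr_sumr.
apply: eq_bigr => j _; rewrite e exprMn.
have -> : (rowB M).[x] ^+ n = (rowB M).[x] ^+ j * (rowB M).[x] ^+ (n - j).
  by rewrite -exprD subnKC// -ltnS.
by ring.
Qed.

Lemma horner_rowform_inf n (Q : PC) M x : (rowB M).[x] = 0 ->
  (rowform n Q M).[x] = Q`_n * (rowA M).[x] ^+ n.
Proof.
move=> e; rewrite horner_rowform big_ord_recr /= subnn expr0 mulr1 big1 ?add0r// => j _.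
by rewrite e expr0n subn_eq0 leqNgt ltn_ord !mulr0.
Qed.

Lemma sqr_im : 'i%C * 'i%C = -1 :> C.
Proof. by rewrite -expr2 sqr_i. Qed.

Lemma hornerT (x : C) : (rowA (val suT)).[x] = 2^-1 * (1 + 'i%C) * (x + 'i%C) /\
  (rowB (val suT)).[x] = 2^-1 * (1 + 'i%C) * (x - 'i%C).
Proof.
have [-> ->] := @rowT R.
by split; rewrite !hornerM hornerC !hornerD ?hornerN hornerX !hornerC.
Qed.

(** A zero coefficient of X^n is a zero at infinity, and zeros propagate along the orbit of
    infinity, the vertices of the octahedron. J maps 0 to infinity; T maps i to infinity, -i to 0, 1
    to i and -1 to -i. *)
Lemma tetra_invariant_root n (Q : PC) : tetra_invariant n Q -> Q`_n = 0 ->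
  forall x : C, x \in [:: 0; 1; -1; 'i%C; - 'i%C] -> Q.[x] = 0.
Proof.
move=> [sQ [hI hJ hT]] Qn.
have hi := sqr_im.
have [jA jB] := @rowJ R.
have Q0 : Q.[0] = 0 by rewrite -hJ horner_rowform_inf ?Qn ?mul0r// jB hornerX.
have Qi : Q.['i%C] = 0.
  by rewrite -hT horner_rowform_inf ?Qn ?mul0r// (hornerT _).2 subrr mulr0.
have QNi : Q.[- 'i%C] = 0.
  rewrite -hT (@horner_rowform_ratio _ _ _ _ 0)// ?Q0 ?mulr0// (hornerT _).1.
  by rewrite addNr mulr0 mul0r.
have Q1 : Q.[1] = 0.
  rewrite -hT (@horner_rowform_ratio _ _ _ _ 'i%C)// ?Qi ?mulr0//.
  by rewrite (hornerT _).1 (hornerT _).2; move: 'i%C hi (2^-1) => I hi h; ring: hi.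
have QN1 : Q.[-1] = 0.
  rewrite -hT (@horner_rowform_ratio _ _ _ _ (- 'i%C))// ?QNi ?mulr0//.
  by rewrite (hornerT _).1 (hornerT _).2; move: 'i%C hi (2^-1) => I hi h; ring: hi.
by move=> x; rewrite !inE => /orP[/eqP ->|/orP[/eqP ->|/orP[/eqP ->|/orP[/eqP ->|/eqP ->]]]].
Qed.

Lemma im_neq : [/\ 'i%C != 0 :> C, 'i%C != 1 :> C, 'i%C != -1 :> C & 'i%C != - 'i%C :> C].
Proof.
split; rewrite eq_complex /= ?oner_eq0 ?andbF//.
  by rewrite eq_sym oppr_eq0 oner_eq0.
by rewrite oppr0 eqxx /= -subr_eq0 opprK -(natrD _ 1 1) pnatr_eq0.
Qed.

Lemma form6_dvd n (Q : PC) : tetra_invariant n Q -> Q`_n = 0 -> exists q, Q = form6 * q.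
Proof.
move=> h Qn; have r := tetra_invariant_root h Qn.
have two0 : 1 != -1 :> C by rewrite -subr_eq0 opprK -(natrD _ 1 1) pnatr_eq0.
have [i0 i1 iN1 iNi] := im_neq.
have u : uniq_roots [:: 0; 1; -1; 'i%C; - 'i%C : C].
  rewrite uniq_rootsE /= !inE !negb_or /=.
  rewrite ![0 == _]eq_sym oner_eq0 !oppr_eq0 oner_eq0 i0 two0 !(eq_sym 1) i1 eqr_oppLR iN1.
  by rewrite !(eq_sym (-1)) iN1 eqr_opp i1 iNi.
have a : all (root Q) [:: 0; 1; -1; 'i%C; - 'i%C : C].
  by apply/allP => x /r; rewrite /root => ->.
have [q eq] := uniq_roots_prod_XsubC a u; exists q; rewrite eq mulrC; congr (_ * _).
rewrite form6E !big_cons big_nil !polyCN polyC0 polyC1.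
by have := @imag_polyC_sqr R; move: ('i%C)%:P => I hI; ring: hI.
Qed.

Lemma form6_neq0 : form6 != 0 :> PC.
Proof.
apply/eqP => /(congr1 (fun p : PC => p`_5)) /eqP.
by rewrite /form6 coefD coefZ !coefXn /= mulr0 addr0 coef0 oner_eq0.
Qed.

Lemma size_form6E : size (form6 : PC) = 6.
Proof.
by rewrite /form6 size_polyDl size_polyXn// (leq_ltn_trans (size_scale_leq _ _))// size_polyXn.
Qed.

(** [form6] has degree 6 as a form but 5 as a polynomial, its sixth zero being at infinity; the
    vanishing coefficient of X^n supplies the missing unit in the degree of the quotient. *)
Lemma form6_factor n (Q : PC) : tetra_invariant n Q -> Q`_n = 0 ->
  (n < 6)%N /\ Q = 0 \/ exists m q, [/\ n = (6 + m)%N, tetra_invariant m q & Q = form6 * q].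
Proof.
move=> h Qn; have [q e] := form6_dvd h Qn; have [sQ _] := h.
have [q0|q0] := eqVneq q 0.
  have [n6|n6] := ltnP n 6; [left|right]; first by rewrite e q0 mulr0.
  exists (n - 6)%N, 0; rewrite subnKC// mulr0 e q0 mulr0; split=> //.
  split; first by rewrite size_poly0.
  by split; rewrite /rowform hform0.
have sQn : (size Q <= n)%N.
  have := sQ; rewrite leq_eqVlt => /orP[/eqP s|//].
  have : lead_coef Q = 0 by rewrite /lead_coef s.
  by move=> /eqP; rewrite lead_coef_eq0 => /eqP ->; rewrite size_poly0.
have se : size Q = (5 + size q)%N.
  by rewrite e size_mul ?form6_neq0// size_form6E.
have sq : (0 < size q)%N by rewrite size_poly_gt0.
have n6 : (6 <= n)%N by lia.
right; exists (n - 6)%N, q; rewrite subnKC//; split=> //.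
apply: (@tetra_invariant_div _ _ form6); [exact: form6_neq0|by lia|exact: tetra_invariant_form6|].
by rewrite subnKC// -e.
Qed.

Lemma hform_top n (P : PC) : hform n P 1 0 = (P`_n)%:P.
Proof.
rewrite /hform big_ord_recr /= subnn !expr0 expr1n !mulr1 big1 ?add0r// => j _.
by rewrite expr0n subn_eq0 leqNgt ltn_ord !mulr0.
Qed.

(** The degrees 8 a + 12 b, those in which a product of powers of [form8] and [form12] has top
    coefficient 1. *)
Definition has_top n := (4 %| n)%N && (n != 4)%N.

Lemma tetra_invariant_with_top n : has_top n -> exists2 w : PC, tetra_invariant n w & w`_n = 1.
Proof.
move=> /andP[/dvdnP[m ->] m4].
have [a [b e]] : exists a b, (m * 4 = a * 8 + b * 12)%N.
  (* An odd m takes one [form12], which accounts for 3 of the m, and the rest is even; m = 1 is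
     excluded by the hypothesis. *)
  exists ((m - 3 * odd m)./2)%N, (odd m : nat).
  have := odd_double_half m; case: (odd m) => /= om.
    have : (3 <= m)%N by case: m m4 om => [|[|[|]]].
    move=> m3; have := odd_double_half (m - 3); rewrite oddB// -om oddD /= odd_double /=.
    by lia.
  by rewrite muln0 subn0; lia.
exists (form8 ^+ a * form12 ^+ b).
  by rewrite e; apply: tetra_invariantM; apply: tetra_invariantX; [exact: tetra_invariant_form8|exact: tetra_invariant_form12].
have s8 := (@tetra_invariantX R 8 a form8 (@tetra_invariant_form8 R)).1.
have s12 := (@tetra_invariantX R 12 b form12 (@tetra_invariant_form12 R)).1.
apply: (@polyC_inj C); rewrite -hform_top e hformM// !hform_exp ?size_form8 ?size_form12//.
have -> : hform 8 form8 1 0 = 1 :> PC by rewrite hform8E; ring.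
have -> : hform 12 form12 1 0 = 1 :> PC by rewrite hform12E; ring.
by rewrite !expr1n mulr1 polyC1.
Qed.

Lemma coef_rowI n (Q : PC) j : (j <= n)%N ->
  (rowform n Q (val suI))`_j = Q`_j * ('i%C ^+ j * (- 'i%C) ^+ (n - j)).
Proof.
move=> jn; have [iA iB] := @rowI R; rewrite /rowform /hform coef_sum.
rewrite (bigD1 (Ordinal (jn : (j < n.+1)%N))) //= big1 ?addr0 => [|k kj].
  rewrite iA iB exprMn -polyCN -!polyC_exp mulrAC -polyCM mulrA -polyCM coefCM coefXn eqxx.
  by rewrite mulr1.
rewrite iA iB exprMn -polyCN -!polyC_exp mulrAC -polyCM mulrA -polyCM coefCM coefXn.
by case: eqP => [e|]; [case/eqP: kj; exact/val_inj|rewrite mulr0].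
Qed.

Lemma coef_rowJ n (Q : PC) j : (j <= n)%N ->
  (rowform n Q (val suJ))`_(n - j) = Q`_j * (-1) ^+ j.
Proof.
move=> jn; have [iA iB] := @rowJ R; rewrite /rowform /hform coef_sum.
have e1 k : (-1 : PC) ^+ k = ((-1) ^+ k)%:P by rewrite -polyC1 -polyCN polyC_exp.
rewrite (bigD1 (Ordinal (jn : (j < n.+1)%N))) //= big1 ?addr0 => [|k kj].
  by rewrite iA iB e1 mulrA -polyCM coefCM coefXn eqxx mulr1.
rewrite iA iB e1 mulrA -polyCM coefCM coefXn.
case: eqP => [e|]; last by rewrite mulr0.
by case/eqP: kj; apply/val_inj => /=; have := ltn_ord k; lia.
Qed.

(** I multiplies the coefficient of X^n by i^n, so 4 divides n unless that coefficient is 0. For n =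
    4, I and J leave x (X^4 + 1) + y X^2; T relates the values at 1 and i, which gives y = 0, and
    those at 0 and -1, which gives x = 0. The forms with (y/x)^2 = -12 are invariant only up to a
    cube root of unity. *)
Lemma tetra_invariant_top0 n (Q : PC) : tetra_invariant n Q -> ~~ has_top n -> Q`_n = 0 :> C.
Proof.
move=> [sQ [hI hJ hT]]; have hi := sqr_im.
have eI j : (j <= n)%N -> Q`_j = Q`_j * ('i%C ^+ j * (- 'i%C) ^+ (n - j)).
  by move=> jn; rewrite -coef_rowI// hI.
have eI0 j (c : C) : (j <= n)%N -> 'i%C ^+ j * (- 'i%C) ^+ (n - j) = c -> c != 1 -> Q`_j = 0.
  move=> /eI + ec c1; rewrite ec => /eqP; rewrite -subr_eq0 -{1}[Q`_j]mulr1 -mulrBr mulf_eq0.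
  by rewrite subr_eq0 [1 == c]eq_sym (negPf c1) orbF => /eqP.
have [i0 i1 iN1 iNi] := im_neq.
have N11 : -1 != 1 :> C by rewrite -subr_eq0 -opprD oppr_eq0 -(natrD _ 1 1) pnatr_eq0.
rewrite negb_and negbK => /orP[n4|/eqP n4]; last first.
  subst n.
  have Q1 : Q`_1 = 0.
    by apply: (eI0 1%N (-1)) => //=; move: 'i%C hi => I hi; ring: hi.
  have Q3 : Q`_3 = 0.
    by apply: (eI0 3%N (-1)) => //=; move: 'i%C hi => I hi; ring: hi.
  have Q04 : Q`_4 = Q`_0.
    by have := @coef_rowJ 4 Q 0 isT; rewrite hJ subn0 expr0 mulr1.
  have ev (x : C) : Q.[x] = Q`_4 + Q`_2 * x ^+ 2 + Q`_4 * x ^+ 4.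
    rewrite (horner_coef_wide _ sQ) !big_ord_recr big_ord0 /= Q1 Q3 -Q04.
    by rewrite !mul0r add0r addr0 addr0 expr0 mulr1.
  have r1 : Q.[1] = Q.['i%C].
    rewrite -{1}hT (@horner_rowform_ratio _ _ _ _ 'i%C)//.
      rewrite (hornerT _).2 (_ : _ * _ * _ = 1) ?expr1n ?mul1r//.
      move: 'i%C hi => I hi; transitivity (2^-1 * (1 - I * I)); first by ring.
      by rewrite hi; field.
    by rewrite (hornerT _).1 (hornerT _).2; move: 'i%C hi (2^-1) => I hi h; ring: hi.
  have r0 : Q.[0] = - 4^-1 * Q.[-1].
    rewrite -{1}hT (@horner_rowform_ratio _ _ _ _ (-1))//.
      rewrite (hornerT _).2; congr (_ * _); move: 'i%C hi => I hi.
      transitivity (2^-1 ^+ 4 * (I * I * (1 + I)) ^+ 4 * (I * I) ^+ 2); first by rewrite hi; ring: hi.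
      transitivity (2^-1 ^+ 4 * (- 4) : C); last by field.
      by ring: hi.
    by rewrite (hornerT _).1 (hornerT _).2; move: 'i%C hi (2^-1) => I hi h; ring: hi.
  move: r1 r0; rewrite !ev.
  have -> : 'i%C ^+ 2 = -1 :> C by rewrite expr2.
  have -> : 'i%C ^+ 4 = 1 :> C by rewrite (exprM _ 2 2) (expr2 'i%C) hi expr2 mulrNN mulr1.
  move: (Q`_4) (Q`_2) => x y r1 r0.
  have y0 : y = 0.
    have : 2%:R * y = 0.
      by transitivity ((x + y * 1 ^+ 2 + x * 1 ^+ 4) - (x + y * -1 + x * 1)); [ring|rewrite r1 subrr].
    by move=> /eqP; rewrite mulf_eq0 pnatr_eq0 /= => /eqP.
  have : 3%:R * x = 0.
    transitivity (2 * ((x + y * 0 ^+ 2 + x * 0 ^+ 4) - - 4^-1 * (x + y * (-1) ^+ 2 + x * (-1) ^+ 4))).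
      by rewrite y0; field.
    by rewrite r0 subrr mulr0.
  by move=> /eqP; rewrite mulf_eq0 pnatr_eq0 /= => /eqP.
have i4 : 'i%C ^+ 4 = 1 :> C by rewrite (exprM _ 2 2) (expr2 'i%C) hi expr2 mulrNN mulr1.
apply: (eI0 n ('i%C ^+ (n %% 4))) => //.
  by rewrite subnn expr0 mulr1 {1}(divn_eq n 4) exprD mulnC exprM i4 expr1n mul1r.
have : (n %% 4 < 4)%N by rewrite ltn_mod.
move: n4; rewrite /dvdn; case: (n %% 4)%N => [|[|[|[|//]]]] // _ _.
  by rewrite exprS expr1 hi.
rewrite exprS exprS expr1 hi mulrN1; apply/eqP => /eqP; rewrite eqr_oppLR => /eqP e.
by move: iN1; rewrite e eqxx.
Qed.

(* Multiplication by form6 identifies the invariants of degree n - 6 with those of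
   degree n whose coefficient of X^n vanishes. *)
Fixpoint mdim n := ((if n is m.+1.+1.+1.+1.+1.+1 then mdim m else 0) + has_top n)%N.

Definition invariant_basis n (q : seq PC) := [/\
  forall r, (r < size q)%N -> tetra_invariant n q`_r,
  forall Q : PC, tetra_invariant n Q -> exists c : nat -> C, Q = \sum_(r < size q) c r *: q`_r &
  forall c : nat -> C, \sum_(r < size q) c r *: q`_r = 0 ->
    forall r, (r < size q)%N -> c r = 0].

(** Where a form with top coefficient 1 exists, subtracting a multiple of it brings every invariant
    into the span of [q]; where none exists, the top coefficient is always 0. *)
Lemma invariant_basis_top n (q : seq PC) :
  (forall r, (r < size q)%N -> tetra_invariant n q`_r) ->
  (forall r, (r < size q)%N -> (q`_r)`_n = 0) ->
  (forall Q : PC, tetra_invariant n Q -> Q`_n = 0 -> exists c : nat -> C, Q = \sum_(r < size q) c r *: q`_r) ->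
  (forall c : nat -> C, \sum_(r < size q) c r *: q`_r = 0 ->
    forall r, (r < size q)%N -> c r = 0) ->
  exists q', size q' = (size q + has_top n)%N /\ invariant_basis n q'.
Proof.
move=> q1 q2 q3 q4; case: (boolP (has_top n)) => [t|t]; last first.
  exists q; rewrite addn0; split=> //; split=> // Q hQ; apply: q3 => //.
  exact: tetra_invariant_top0 t.
have [w hw wn] := tetra_invariant_with_top t.
exists (w :: q); rewrite addn1; split=> //; split.
- by move=> [|r] //= rq; exact: q1.
- move=> Q hQ.
  have h : tetra_invariant n (Q + - Q`_n *: w) by apply: tetra_invariantD => //; exact: tetra_invariantZ.
  have [|c e] := q3 _ h; first by rewrite coefD coefZ wn mulr1 subrr.
  exists (fun r => if r is r'.+1 then c r' else Q`_n).
  by rewrite /= big_ord_recl /= -e scaleNr addrC subrK.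
move=> c; rewrite /= big_ord_recl /= => e.
have c0 : c 0%N = 0.
  have := congr1 (fun p : PC => p`_n) e.
  rewrite coefD coefZ wn mulr1 coef_sum coef0 big1 ?addr0// => r _.
  by rewrite add0n coefZ q2 ?mulr0.
move: e; rewrite c0 scale0r add0r => /(q4 (fun r => c r.+1)) h.
by case=> [//|r]; exact: h.
Qed.

Lemma exists_invariant_basis n : exists q, size q = mdim n /\ invariant_basis n q.
Proof.
elim/ltn_ind: n => n IH.
have [n6|n6] := ltnP n 6.
  have -> : mdim n = (size ([::] : seq PC) + has_top n)%N.
    by case: n n6 {IH} => [|[|[|[|[|[|]]]]]].
  apply: invariant_basis_top => // Q hQ Qn.
  exists (fun=> 0); rewrite big_ord0.
  have [[_ //]|[m [q [e _ _]]]] := form6_factor hQ Qn.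
  by rewrite e in n6.
have [m en] : exists m, n = (6 + m)%N by exists (n - 6)%N; rewrite subnKC.
have [|q [sq [b1 b2 b3]]] := IH m; first by rewrite en; lia.
pose q' := [seq form6 * p | p <- q].
have sq' : size q' = size q by rewrite size_map.
have q'E r : (r < size q)%N -> q'`_r = form6 * q`_r by move=> rq; rewrite (nth_map 0).
have sumE (c : nat -> C) : \sum_(r < size q) c r *: q'`_r = form6 * \sum_(r < size q) c r *: q`_r.
  by rewrite mulr_sumr; apply: eq_bigr => r _; rewrite q'E// -scalerAr.
have -> : mdim n = (size q' + has_top n)%N by rewrite sq' sq en.
apply: invariant_basis_top; rewrite ?sq'.
- by move=> r rq; rewrite q'E// en; apply: tetra_invariantM; [exact: tetra_invariant_form6|exact: b1].
- move=> r rq; rewrite q'E//; have [s _] := b1 _ rq.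
  apply: (@polyC_inj C); rewrite -hform_top en hformM ?size_form6// hform6E.
  by rewrite mulr0 mul0r mul0r.
- move=> Q hQ Qn; have [[]|[m' [p [e hp eQ]]]] := form6_factor hQ Qn; first by rewrite ltnNge n6.
  have em : m' = m by apply/eqP; rewrite -(eqn_add2l 6) -e en.
  rewrite em in hp; have [c ec] := b2 _ hp; exists c.
  by rewrite sumE -ec.
move=> c; rewrite sumE => /eqP; rewrite mulf_eq0 (negPf form6_neq0) /= => /eqP.
exact: b3.
Qed.
End basis_of_invariants.

(** * Equivariant spinors *)

Section equivariant_spinors.
Context {R : realType}.
Notation SU := (SU2 R).
Notation C := R[i].
Notation PC := {poly R[i]}.

Local Opaque suI suJ suT espinor.

Definition act (h : SU) (psi : spinor_fun R) : spinor_fun R :=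
  fun g => val h *m psi (mulSU g h).

Lemma mulSUA : associative (@mulSU R).
Proof. by move=> x y z; apply: val_inj; rewrite /= mulmxA. Qed.

Lemma actM x y psi : act (mulSU x y) psi = act x (act y psi).
Proof. by apply/funext => g; rewrite /act mulSUA mulmxA. Qed.

Lemma act_fixP (h : SU) psi :
  act h psi = psi <-> forall g, psi (mulSU g h) = invmx (val h) *m psi g.
Proof.
split=> [e g|e]; first by rewrite -[in RHS]e /act mulKmx// su2_unitmx.
by apply/funext => g; rewrite /act e mulKVmx// su2_unitmx.
Qed.

Lemma act_lin (h : SU) (a b : C) psi phi : act h (fun g => a *: psi g + b *: phi g) =
  fun g => a *: act h psi g + b *: act h phi g.
Proof.
apply/funext => g; rewrite /act; move: (psi _) (phi _) => x y.
by rewrite mulmxDr !scalemxAr.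
Qed.

Lemma quat_eq (a b c d a' b' c' d' : R) : a = a' -> b = b' -> c = c' -> d = d' ->
  quat a b c d = quat a' b' c' d'.
Proof. by move=> -> -> -> ->. Qed.

Lemma su2_eq (x y : SU) (a b c d a' b' c' d' : R) : val x = quat a b c d ->
  val y = quat a' b' c' d' -> [/\ a = a', b = b', c = c' & d = d'] -> x = y.
Proof.
move=> ex ey [e1 e2 e3 e4]; apply: val_inj; rewrite ex ey.
exact: (quat_eq e1 e2 e3 e4).
Qed.

Lemma val_mulSU (x y : SU) (a b c d a' b' c' d' : R) : val x = quat a b c d ->
  val y = quat a' b' c' d' -> val (mulSU x y) =
  quat (a * a' - b * b' - c * c' - d * d') (a * b' + b * a' + c * d' - d * c')
       (a * c' - b * d' + c * a' + d * b') (a * d' + b * c' - c * b' + d * a').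
Proof. by move=> ex ey; rewrite -quatM -ex -ey. Qed.

(** The element -1, written as I^2 so that its action is that of I applied twice. *)
Definition suN : SU := mulSU suI suI.
Definition suK : SU := mulSU suI suJ.

Lemma tetrahedral_relations :
  [/\ mulSU suJ suJ = suN :> SU, mulSU (mulSU suT suT) suT = suN :> SU,
      mulSU suI suJ = mulSU suJ (mulSU suI suN) :> SU,
      mulSU suI suT = mulSU suT suK :> SU & mulSU suJ suT = mulSU suT suI :> SU] /\
  [/\ mulSU suK suT = mulSU suT suJ :> SU, forall g : SU, mulSU suN g = mulSU g suN &
      forall g : SU, mulSU suN (mulSU suN g) = g].
Proof.
have vN := val_mulSU (@val_suI R) (@val_suI R); have vK := val_mulSU (@val_suI R) (@val_suJ R).
have vT2 := val_mulSU (@val_suT R) (@val_suT R).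
have vN' : val suN = quat (-1) 0 0 0 :> 'M[C]_2.
  by rewrite vN; apply: quat_eq; ring.
split; split.
- by apply: su2_eq (val_mulSU (@val_suJ R) (@val_suJ R)) vN' _; split; ring.
- by apply: su2_eq (val_mulSU vT2 (@val_suT R)) vN' _; split; field.
- apply: su2_eq vK (val_mulSU (@val_suJ R) (val_mulSU (@val_suI R) vN')) _.
  by split; ring.
- by apply: su2_eq (val_mulSU (@val_suI R) (@val_suT R)) (val_mulSU (@val_suT R) vK) _; split; ring.
- by apply: su2_eq (val_mulSU (@val_suJ R) (@val_suT R)) (val_mulSU (@val_suT R) (@val_suI R)) _; split; ring.
- by apply: su2_eq (val_mulSU vK (@val_suT R)) (val_mulSU (@val_suT R) (@val_suJ R)) _; split; ring.
- move=> g; have [a [b [c [d e]]]] : exists a b c d, val g = quat a b c d.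
    by do 4!eexists; exact: val_su2.
  by apply: su2_eq (val_mulSU vN' e) (val_mulSU e vN') _; split; ring.
- move=> g; have [a [b [c [d e]]]] : exists a b c d, val g = quat a b c d.
    by do 4!eexists; exact: val_su2.
  by apply: su2_eq (val_mulSU vN' (val_mulSU vN' e)) e _; split; ring.
Qed.

Definition mix (t : R) (psi phi : spinor_fun R) : spinor_fun R :=
  fun g => t%:C *: psi g + (1 - t)%:C *: phi g.

Lemma act_mix h t psi phi : act h (mix t psi phi) = mix t (act h psi) (act h phi).
Proof. exact: act_lin. Qed.

Lemma mix_halfC psi phi : mix 2^-1 psi phi = mix 2^-1 phi psi.
Proof.
have e : 1 - 2^-1 = 2^-1 :> R by field.
by apply/funext => g; rewrite /mix e; move: (psi g) (phi g) => x y; rewrite addrC.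
Qed.

Lemma mix_thirdC p q r :
  mix 3^-1 p (mix 2^-1 q r) = mix 3^-1 r (mix 2^-1 p q).
Proof.
have ht : 1 - 2^-1 = 2^-1 :> R by field.
have h3 : (1 - 3^-1)%:C * (2^-1)%:C = (3^-1)%:C :> C by rewrite -rmorphM; congr (_%:C); field.
apply/funext => g; rewrite /mix ht; move: (p g) (q g) (r g) => a b c.
by rewrite !scalerDr !scalerA h3 addrA addrC addrA.
Qed.

Local Opaque act mix mulSU suN suK.

(* Averaging over the successive quotients of 1 < {1,-1} < <I> < Q_8 < 2T. *)
Lemma average (G : spinor_fun R -> Prop) :
  (forall h psi, binary_tetrahedral h -> G psi -> G (act h psi)) ->
  (forall t psi phi, 0 <= t <= 1 -> G psi -> G phi -> G (mix t psi phi)) ->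
  forall psi, G psi -> exists2 phi, G phi & forall h, binary_tetrahedral h -> act h phi = phi.
Proof.
move=> Gact Gmix psi Gpsi.
have [[rJJ rTTT rIJ rIT rJT] [rKT rNc rNN]] := tetrahedral_relations.
have tI : binary_tetrahedral (suI : SU) by apply: binary_tetrahedral_gen; left.
have tJ : binary_tetrahedral (suJ : SU) by apply: binary_tetrahedral_gen; right; left.
have tT : binary_tetrahedral (suT : SU) by apply: binary_tetrahedral_gen; right; right.
have half01 : is_true ((0 <= (2^-1 : R)) && ((2^-1 : R) <= 1)) by clear; apply/andP; split; lra.
have third01 : is_true ((0 <= (3^-1 : R)) && ((3^-1 : R) <= 1)) by clear; apply/andP; split; lra.
have Ghalf x y : G x -> G y -> G (mix 2^-1 x y) := Gmix _ _ _ half01.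
have Gthird x y : G x -> G y -> G (mix 3^-1 x y) := Gmix _ _ _ third01.
have actN x : act suN x = act suI (act suI x) by exact: actM.
have actK x : act suK x = act suI (act suJ x) by exact: actM.
have NN x : act suN (act suN x) = x.
  rewrite -actM; have -> : mulSU suN suN = oneSU R.
    have e g : mulSU g (oneSU R) = g by apply: val_inj; exact: mulmx1.
    by rewrite -[RHS]rNN e.
  apply/act_fixP => g; have -> : mulSU g (oneSU R) = g by apply: val_inj; exact: mulmx1.
  by rewrite [val _]/(1%:M) invmx1 mul1mx.
have [p0 G0 f0N] : exists2 p0, G p0 & act suN p0 = p0.
  exists (mix 2^-1 psi (act suN psi)); last by rewrite act_mix NN mix_halfC.
  by have := Gact _ _ tI (Gact _ _ tI Gpsi); rewrite -(actN psi); exact: Ghalf Gpsi.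
have [p1 G1 f1I] : exists2 p1, G p1 & act suI p1 = p1.
  exists (mix 2^-1 p0 (act suI p0)); first exact: Ghalf G0 (Gact _ _ tI G0).
  by rewrite act_mix -actN f0N mix_halfC.
have f1N : act suN p1 = p1 by rewrite actN !f1I.
have [p2 G2 [f2I f2J]] : exists2 p2, G p2 & act suI p2 = p2 /\ act suJ p2 = p2.
  exists (mix 2^-1 p1 (act suJ p1)); first exact: Ghalf G1 (Gact _ _ tJ G1).
  split; last by rewrite act_mix -actM rJJ f1N mix_halfC.
  by rewrite act_mix f1I -actM rIJ (actM suJ) (actM suI suN) f1N f1I.
have f2N : act suN p2 = p2 by rewrite actN !f2I.
have f2K : act suK p2 = p2 by rewrite actK f2J f2I.
have Gq := Gact _ _ tT G2; have Gq' := Gact _ _ tT Gq.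
(* T permutes I, J, K by conjugation, so it carries spinors fixed by the quaternion group to such
   spinors. *)
have qI : act suI (act suT p2) = act suT p2 by rewrite -actM rIT (actM suT suK) f2K.
have qJ : act suJ (act suT p2) = act suT p2 by rewrite -actM rJT (actM suT suI) f2I.
have qK : act suK (act suT p2) = act suT p2 by rewrite -actM rKT (actM suT suJ) f2J.
have qT : act suT (act suT (act suT p2)) = p2 by rewrite -!actM rTTT f2N.
move eq: (act suT p2) Gq Gq' qI qJ qK qT => q Gq Gq' qI qJ qK qT.
have q'I : act suI (act suT q) = act suT q by rewrite -actM rIT (actM suT suK) qK.
have q'J : act suJ (act suT q) = act suT q by rewrite -actM rJT (actM suT suI) qI.
exists (mix 3^-1 p2 (mix 2^-1 q (act suT q))); first exact: Gthird G2 (Ghalf _ _ Gq Gq').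
apply: binary_tetrahedral_ind => [x y hx hy| | |].
- by rewrite actM hy hx.
- by rewrite !act_mix f2I qI q'I.
- by rewrite !act_mix f2J qJ q'J.
by rewrite !act_mix eq qT; exact: mix_thirdC.
Qed.

Local Transparent act mix mulSU suN suK.

Lemma act_espinor (h : SU) b n i (Q : PC) : (size Q <= n.+1)%N ->
  act h (espinor b n i Q) = espinor b n i (rowform n Q (val h)).
Proof.
by move=> sQ; apply/funext => g; rewrite /act espinor_mulSU// mulKVmx// su2_unitmx.
Qed.

Lemma dspan_act (h : SU) r u : dspan r u -> dspan (act h r) (act h u).
Proof.
elim=> [|b n i Q {}r {}u sQ ie _ IH].
  by apply: dspan_ext dspan0 => g; rewrite /act mulmx0.
apply: dspan_ext (dspan_add (size_rowform (val h) sQ) ie IH) => g.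
  by rewrite -(act_espinor _ _ _ sQ) /act mulmxDr.
by rewrite -(act_espinor _ _ _ sQ) /act mulmxDr scalemxAr.
Qed.

Lemma normsq_su2 (h : SU) (v : 'cV[C]_2) : normsq (val h *m v) = normsq v.
Proof.
move: (qcoord_sum_sqr h) (val_su2 h).
move: (qcoord 0 h) (qcoord 1 h) (qcoord 2 h) (qcoord 3 h) => a b c d e.
rewrite quatE => ->; rewrite mx22_col /normsq !big_ord_recl !big_ord0 !addr0 !mxE /=.
have -> : lift ord0 ord0 = 1 :> 'I_2 by exact/val_inj.
move: (v ord0 0) (v 1 0) => [x y] [z t] /=.
transitivity ((a ^+ 2 + b ^+ 2 + c ^+ 2 + d ^+ 2) * (x ^+ 2 + y ^+ 2 + (z ^+ 2 + t ^+ 2))).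
  by ring.
by rewrite e mul1r.
Qed.

Lemma normsqN (v : 'cV[C]_2) : normsq (- v) = normsq v.
Proof. by rewrite -!rdotvv rdotNl rdotC rdotNl opprK. Qed.

(** The difference t e + (1 - t) e - |t v + (1 - t) w|^2 is at least t (1 - t) |v - w|^2. *)
Lemma normsq_convex (t e : R) (v w : 'cV[C]_2) : 0 <= t <= 1 -> normsq v <= e ->
  normsq w <= e -> normsq (t%:C *: v + (1 - t)%:C *: w) <= e.
Proof.
move=> /andP[t0 t1] hv hw.
have d0 := normsq_ge0 (v - w).
rewrite -!rdotvv in hv hw d0 *.
rewrite rdotDl !rdotDr !rdotZl !rdotZr (rdotC w v).
rewrite rdotDl !rdotDr rdotNl -mulN1r in d0.
have eN : rdot v (- w) = - rdot v w by rewrite rdotC rdotNl rdotC.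
have eNN : rdot w (- w) = - rdot w w by rewrite rdotC rdotNl.
rewrite rdotNl eN eNN (rdotC w v) in d0.
move: (rdot v v) (rdot w w) (rdot v w) hv hw d0 => a b c hv hw d0.
have h1 : t * a <= t * e by exact: ler_wpM2l.
have h2 : (1 - t) * b <= (1 - t) * e by apply: ler_wpM2l => //; rewrite subr_ge0.
have h3 : 0 <= t * (1 - t) * (a - c + -1 * (c - b)).
  by rewrite !mulr_ge0 ?subr_ge0//; move: d0; lra.
nra.
Qed.

Lemma spinor_field_scont Gamma (psi : spinor_fun R) : spinor_field Gamma psi -> scont psi.
Proof. by move=> [/smooth_class1/class1_cont]. Qed.

Lemma L2normsq_dot (psi : spinor_fun R) : scont psi ->
  L2normsq psi = (4 * spinor_dot psi psi)%:E.
Proof.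
move=> h; rewrite L2normsqE; last exact/spinor_continuousP.
by congr ((4 * _)%:E); congr su2_int; apply/funext => g; rewrite rdotvv.
Qed.

Lemma scont_dirac_shift (lambda : C) psi : class1 psi -> scont (dirac_shift lambda psi).
Proof.
by move=> h; apply: scontB; [exact: scont_dirac|exact/scontZ/class1_cont].
Qed.

(** [G] asks that (D - lambda) psi be uniformly close to phi. Polynomials provide a member without
    equivariance. As phi is equivariant and 2T acts by isometries, [G] is stable under the action
    and under convex combinations, so averaging gives an equivariant member. *)
Lemma dirac_shift_dense (lambda : C) :
  (forall b n, (0 < edim b n)%N -> (eigval b n)%:C != lambda) ->
  forall phi, spinor_field (binary_tetrahedral (R:=R)) phi -> forall eps : R, 0 < eps ->
  exists2 psi, spinor_field (binary_tetrahedral (R:=R)) psi &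
    (L2normsq (fun g => dirac_shift lambda psi g - phi g)%R < eps%:E)%E.
Proof.
move=> hl phi hphi eps eps0; have cphi := spinor_field_scont hphi.
have V0 : 0 <= su2_int (fun _ : SU => 1 : R) by apply: su2_int_ge0 => _; exact: ler01.
set V := su2_int _ in V0.
(* If the pointwise squared norm is at most d, then [L2normsq] is at most 4 d V, which this choice
   keeps below eps. *)
pose d := eps / (8 * (V + 1)).
have V1 : 0 < V + 1 by lra.
have d0 : 0 < d by rewrite divr_gt0// mulr_gt0.
have [p sp hp] := spoly_approx_normsq cphi d0.
have [r [u [dru ep]]] := spoly_resolvent hl sp.
pose G (psi : spinor_fun R) := exists u, dspan psi u /\
  forall g, normsq (u g - lambda *: psi g - phi g) <= d.
have Gr : G r.
  exists u; split=> // g; rewrite -(congr1 (@^~ g) ep) /=.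
  rewrite -opprB normsqN; exact: hp.
have [| |psi [v [dv hv]] fpsi] := average _ _ Gr.
- move=> h psi hh [v [dv hv]]; exists (act h v); split; first exact: dspan_act.
  move=> g; have -> : phi g = act h phi g.
    by rewrite /act hphi.2// mulKVmx// su2_unitmx.
  rewrite /act scalemxAr -!mulmxBr normsq_su2; exact: hv.
- move=> t x y t01 [v [dv hv]] [w [dw hw]].
  exists (mix t v w); split; first exact: dspanD (dspanZ _ dv) (dspanZ _ dw).
  move=> g; have := normsq_convex t01 (hv g) (hw g); rewrite /mix.
  congr (normsq _ <= _).
  move: (v g) (w g) (x g) (y g) (phi g) => v' w' x' y' z.
  have e1 : (1 - t)%:C = 1 - t%:C :> C by rewrite rmorphB rmorph1.
  rewrite e1; apply/matrixP => i j; rewrite !mxE; ring.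
have [sv su] := dspan_spoly dv; have c1 := spoly_class1 sv.
exists psi; first by split; [exact: spoly_smooth|move=> g h /fpsi/act_fixP].
have cs : scont (fun g => dirac_shift lambda psi g - phi g).
  by apply: scontB => //; exact: scont_dirac_shift.
rewrite (L2normsq_dot cs) lte_fin.
have := spinor_dot_le_sup cs (e := d).
rewrite /dirac_shift (dspan_dirac dv) -/V => /(_ hv) h.
have : d * V < eps / 4.
  rewrite /d mulrAC ltr_pdivrMr ?mulr_gt0// mulrCA mulrC.
  have : 0 <= eps * V by rewrite mulr_ge0// ltW.
  have -> : 8 * (eps / 4 * (V + 1)) = 2 * (eps * V) + 2 * eps by field.
  by rewrite (mulrC V); move: (eps * V) => x; move: eps0; clear; lra.
by move: h; move: (spinor_dot _ _) (d * V) => x y; lra.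
Qed.

(** Used with d = 0 off the real axis, and with b = 0 at real points at distance at least d from the
    eigenvalues. *)
Lemma regular_of_gap (a b d : R) : 0 <= d -> 0 < d ^+ 2 + b ^+ 2 ->
  (forall s n, (0 < edim s n)%N -> d <= `|eigval s n - a|) ->
  regular_value (binary_tetrahedral (R:=R)) (a +i* b).
Proof.
move=> d0 db hd; split.
  exists (d ^+ 2 + b ^+ 2) => // psi [/smooth_class1 h _].
  rewrite (L2normsq_dot (class1_cont h)) (L2normsq_dot (scont_dirac_shift _ h)).
  rewrite -EFinM lee_fin mulrCA ler_pM2l ?ltr0n// dirac_shift_normsq// mulrDl lerD2r.
  exact: shift_lower_bound.
apply: dirac_shift_dense => s n e0; apply/eqP => -[e1 e2].
have := hd s n e0; rewrite e1 subrr normr0 => dle.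
have {dle}dz : d = 0 by apply/eqP; rewrite eq_le dle.
by move: db; rewrite dz -e2 expr0n addr0 ltxx.
Qed.

(** Beyond |x| + 1 every k is at distance at least 1, so the minimum is over finitely many k. *)
Lemma dist_nat (x : R) : (forall k : nat, k%:R != x) ->
  exists2 d : R, 0 < d & forall k : nat, d <= `|k%:R - x|.
Proof.
move=> hx.
have [d d0 hd] : exists2 d : R, 0 < d & forall k : nat, (k < (Num.trunc `|x|).+2)%N -> d <= `|k%:R - x|.
  elim: (Num.trunc _).+2 => [|N [d d0 hd]]; first by exists 1.
  exists (Num.min d `|N%:R - x|); first by rewrite lt_min d0 normr_gt0 subr_eq0 hx.
  move=> k; rewrite ltnS leq_eqVlt => /orP[/eqP ->|/hd h]; rewrite ge_min ?lexx ?orbT//.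
  by rewrite h.
exists (Num.min d 1); first by rewrite lt_min d0 ltr01.
move=> k; rewrite ge_min; have [/hd ->//|kN] := ltnP k (Num.trunc `|x|).+2.
apply/orP; right; have := real_truncnS_gt (num_real `|x|).
move=> hN; have : (Num.trunc `|x|).+2%:R <= k%:R :> R by rewrite ler_nat.
rewrite -natr1 => h; apply: le_trans (ler_norm _).
by have := ler_norm x; move: h hN; lra.
Qed.

Lemma regular_off_spectrum (lambda : C) :
  (forall k : nat, lambda <> (3 / 2 + k%:R)%:C /\ lambda <> (- (3 / 2 + k%:R))%:C) ->
  regular_value (binary_tetrahedral (R:=R)) lambda.
Proof.
case: lambda => a b hl; have [b0|b0] := eqVneq b 0; last first.
  apply: (@regular_of_gap _ _ 0) => // ; first by rewrite expr0n add0r exprn_even_gt0.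
subst b.
have [|d1 d10 h1] := @dist_nat (a - 3 / 2).
  by move=> k; apply/eqP => e; have [h _] := hl k; apply: h; rewrite e addrC subrK.
have [|d2 d20 h2] := @dist_nat (- a - 3 / 2).
  by move=> k; apply/eqP => e; have [_ h] := hl k; apply: h; rewrite e addrC subrK opprK.
apply: (@regular_of_gap _ _ (Num.min d1 d2)).
- by rewrite le_min !ltW.
- by rewrite expr0n addr0 exprn_gt0// lt_min d10.
move=> [] n; rewrite /edim /eigval => n0.
  by rewrite ge_min (le_trans (h1 n))// -[X in X <= _]/`|_| opprB addrA [n%:R + _]addrC.
(* For n >= 1 the eigenvalue of the second family is -(3/2 + (n - 1)). *)
rewrite ge_min (le_trans (h2 n.-1)) ?orbT//.
case: n n0 => // n _; rewrite -[X in _ <= X]normrN.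
have -> : - (- (1 / 2 + n.+1%:R) - a) = n%:R - (- a - 3 / 2) by rewrite -natr1; field.
by [].
Qed.

End equivariant_spinors.

(** * Multiplicities on the quotient *)

Section multiplicities.
Context {R : realType}.
Notation SU := (SU2 R).
Notation C := R[i].
Notation PC := {poly R[i]}.

Local Opaque espinor dirac_op suI suJ suT.

Definition extend_ord (T : Type) m (x0 : T) (f : 'I_m -> T) (i : nat) : T :=
  if insub i is Some j then f j else x0.

Lemma extend_ordE (T : Type) m (x0 : T) (f : 'I_m -> T) (i : 'I_m) :
  extend_ord x0 f i = f i.
Proof. by rewrite /extend_ord valK. Qed.

Section form_span.
Context (b : bool) (n : nat) (q : seq PC) (hq : invariant_basis n q).

Definition form_comb m (X : 'M[C]_(m, size q)) : nat -> PC :=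
  extend_ord 0 (fun i => \sum_r X i r *: q`_r).

(** Rows index the coefficients and columns the basis of invariants, so the dimension is the number
    of matrix entries. *)
Definition form_spinor (X : 'M[C]_(edim b n, size q)) : spinor_fun R :=
  fun g => \sum_(i < edim b n) espinor b n i (form_comb X i) g.

Lemma form_comb_invariant m (X : 'M[C]_(m, size q)) i : tetra_invariant n (form_comb X i).
Proof.
have [q1 _ _] := hq.
have h0 : tetra_invariant n (0 : PC).
  by split; [rewrite size_poly0|split; rewrite /rowform hform0].
rewrite /form_comb /extend_ord; case: insubP => [j _ _|_]; last exact: h0.
elim/big_ind: _ => [|x y|r _]; [exact: h0|exact: tetra_invariantD|].
by apply: tetra_invariantZ; exact: q1.
Qed.

Lemma form_spinorE X g : form_spinor X g =
  \sum_i \sum_r X i r *: espinor b n i q`_r g.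
Proof.
apply: eq_bigr => i _; rewrite /form_comb extend_ordE.
exact: espinor_sum.
Qed.

Lemma form_spinor_lin m (c : 'I_m -> C) (X : 'I_m -> 'M[C]_(edim b n, size q)) g :
  form_spinor (\sum_k c k *: X k) g = \sum_k c k *: form_spinor (X k) g.
Proof.
rewrite form_spinorE; under [RHS]eq_bigr do rewrite form_spinorE scaler_sumr.
rewrite [RHS]exchange_big; apply: eq_bigr => i _ /=.
under [RHS]eq_bigr do rewrite scaler_sumr.
rewrite [RHS]exchange_big; apply: eq_bigr => r _ /=.
rewrite summxE scaler_suml; apply: eq_bigr => k _.
by rewrite mxE scalerA.
Qed.

Lemma form_spinorB X Y g : form_spinor (X - Y) g = form_spinor X g - form_spinor Y g.
Proof.
rewrite !form_spinorE -sumrB; apply: eq_bigr => i _.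
rewrite -sumrB; apply: eq_bigr => r _; rewrite [(X - Y) i r]mxE [(- Y) i r]mxE.
by move: (espinor _ _ _ _ _) => v; rewrite scalerBl.
Qed.

Lemma form_spinor_inj X : (forall g, form_spinor X g = 0) -> X = 0.
Proof.
move=> h; have [_ _ q3] := hq.
have sQ i : (size (form_comb X i) <= n.+1)%N by have [] := form_comb_invariant X i.
have Q0 := espinor_inj sQ h.
apply/matrixP => i r; rewrite [RHS]mxE.
have := Q0 i (ltn_ord i); rewrite /form_comb extend_ordE => e.
have := q3 (extend_ord 0 (X i)) _ r (ltn_ord r); rewrite extend_ordE; apply.
by rewrite -[RHS]e; apply: eq_bigr => k _; rewrite extend_ordE.
Qed.

Lemma form_spinor_espan X : espan b n (form_spinor X).
Proof.
exists (form_comb X); split=> // i; by have [] := form_comb_invariant X i.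
Qed.

Lemma form_spinor_field X : spinor_field (binary_tetrahedral (R:=R)) (form_spinor X).
Proof.
split; first exact/spoly_smooth/espan_spoly/form_spinor_espan.
move=> g h hh; rewrite /form_spinor mulmx_sumr; apply: eq_bigr => i _.
have hi := form_comb_invariant X i; have [si _] := hi.
move: (form_comb X i) hi si => Q hi si.
have e := espinor_mulSU b i g h si.
by rewrite (tetra_invariant_tetrahedral hi hh) in e; rewrite e.
Qed.

(** Translation by h replaces each form Q_i by its transform; the independence of the family forces
    each Q_i to be invariant, hence a combination of the basis. *)
Lemma equivariant_espan (psi : spinor_fun R) : espan b n psi ->
  (forall g h, binary_tetrahedral h -> psi (mulSU g h) = invmx (val h) *m psi g) ->
  exists X, psi = form_spinor X.
Proof.
move=> [Q [sQ e]] eqv; have [_ q2 _] := hq.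
have rQ (h : SU) i : binary_tetrahedral h -> (i < edim b n)%N -> rowform n (Q i) (val h) = Q i.
  move=> hh ie; apply/eqP; rewrite -subr_eq0; apply/eqP.
  have sD j : (size (rowform n (Q j) (val h) - Q j)%R <= n.+1)%N.
    by rewrite (leq_trans (size_polyD _ _))// size_polyN geq_max size_rowform// sQ.
  apply: (espinor_inj sD) ie => g.
  under eq_bigr => j _.
    rewrite espinorD -scaleN1r espinorZ scaleN1r; over.
  rewrite big_split sumrN /=; apply/eqP; rewrite subr_eq0; apply/eqP.
  have e1 : val h *m psi (mulSU g h) = psi g by rewrite (eqv g h hh) (mulKVmx (su2_unitmx h)).
  rewrite e in e1; rewrite -[RHS]e1 mulmx_sumr; apply: eq_bigr => j _.
  by rewrite (espinor_mulSU b j g h (sQ j)) (mulKVmx (su2_unitmx h)).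
have inv i : (i < edim b n)%N -> tetra_invariant n (Q i).
  by move=> ie; split=> //; split; apply: rQ => //; apply: binary_tetrahedral_gen;
    [left|right; left|right; right].
have /choice[c hc] : forall i : 'I_(edim b n), exists c : nat -> C,
    Q i = \sum_(r < size q) c r *: q`_r.
  by move=> i; apply: q2; exact: inv.
exists (\matrix_(i, r) c i r); rewrite e; apply/funext => g.
apply: eq_bigr => i _; congr (espinor b n i _ g); rewrite /form_comb extend_ordE hc.
by apply: eq_bigr => r _; rewrite mxE.
Qed.
End form_span.

(** When [edim b n] is 0 the second hypothesis is vacuous and the statement says that l is not an
    eigenvalue. *)
Lemma multiplicity_eigval b n (l : R) :
  (forall b' n', (0 < edim b' n')%N -> eigval b' n' = l -> b' = b /\ n' = n) ->
  ((0 < edim b n)%N -> eigval b n = l) ->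
  multiplicity_is (binary_tetrahedral (R:=R)) l%:C (edim b n * mdim n).
Proof.
move=> hu hl; have [q [<- hq]] := @exists_invariant_basis R n.
have vE (c : 'rV[C]_(edim b n * size q)) g :
    \sum_k c 0 k *: form_spinor (vec_mx (delta_mx 0 k)) g = @form_spinor b n q (vec_mx c) g.
  rewrite -form_spinor_lin [in RHS](row_sum_delta c) linear_sum.
  by congr (form_spinor _ g); apply: eq_bigr => k _; rewrite linearZ.
exists (fun k => @form_spinor b n q (vec_mx (delta_mx 0 k))); split=> [k|psi [psi_field De]].
  split; first exact: form_spinor_field.
  move=> g; have e0 : (0 < edim b n)%N.
    by have := leq_ltn_trans (leq0n _) (ltn_ord k); rewrite muln_gt0 => /andP[].
  by rewrite (dirac_espan (form_spinor_espan hq _)) (hl e0).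
have c1 := smooth_class1 psi_field.1.
have sp : espan b n psi.
  by apply: eigenspinor_espan hu hl => //; apply/funext => g; exact: De.
have [X eX] := equivariant_espan hq sp psi_field.2.
exists (mxvec X); split=> [g|c hc]; first by rewrite vE mxvecK eX.
apply: (canLR vec_mxK); apply/eqP; rewrite -subr_eq0; apply/eqP.
apply: (form_spinor_inj hq) => g.
by rewrite form_spinorB -vE -hc eX subrr.
Qed.

Lemma mdim_add6 n : mdim (n + 6) = (mdim n + has_top (n + 6))%N.
Proof. by rewrite addnC. Qed.

(** Of n + 6 and n + 12 exactly one is divisible by 4 when n is even and none when n is odd; neither
    equals 4. *)
Lemma mdim_add12 n : mdim (n + 12) = (mdim n + ~~ odd n)%N.
Proof.
rewrite -[12%N]/(6 + 6)%N addnA !mdim_add6 -addnA; congr (_ + _)%N.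
rewrite /has_top.
have := divn_eq n 4; have := ltn_mod n 4; rewrite /= => h e.
have -> : odd n = odd (n %% 4) by rewrite {1}e oddD oddM andbF.
have -> : (4 %| n + 6)%N = ((n %% 4) == 2)%N.
  by rewrite /dvdn -(modnDml n); case: (n %% 4)%N h => [|[|[|[|//]]]].
have -> : (4 %| n + 6 + 6)%N = ((n %% 4) == 0)%N.
  by rewrite -addnA /dvdn -(modnDml n); case: (n %% 4)%N h => [|[|[|[|//]]]].
have -> : (n + 6 != 4)%N by lia.
have -> : (n + 6 + 6 != 4)%N by lia.
by case: (n %% 4)%N h => [|[|[|[|//]]]].
Qed.

Lemma mdim_period s k : mdim (k + s * 12) = (mdim k + s * ~~ odd k)%N.
Proof.
elim: s => [|s IH]; first by rewrite !mul0n !addn0.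
have -> : (k + s.+1 * 12 = k + s * 12 + 12)%N by lia.
by rewrite mdim_add12 IH oddD oddM andbF addbF mulSn -addnA [(s * _ + _)%N]addnC.
Qed.
End multiplicities.

(** * Multiplicities along the progressions modulo 12 *)

Section spectrum.
Context {R : realType}.

Lemma eigval_inj (b b' : bool) n n' : eigval b' n' = eigval b n :> R -> b' = b /\ n' = n.
Proof.
have p m : 0 <= m%:R :> R := ler0n _ _.
case: b b' => [] []; rewrite /eigval => e; have := p n; have := p n'.
- by move=> _ _; split=> //; apply/eqP; rewrite -(eqr_nat R); apply/eqP; move: e; lra.
- by move=> p1 p2; exfalso; lra.
- by move=> p1 p2; exfalso; lra.
- by move=> _ _; split=> //; apply/eqP; rewrite -(eqr_nat R); apply/eqP; move: e; lra.
Qed.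

Lemma eigval_neq_half b n : (0 < edim b n)%N -> eigval b n != 1 / 2 :> R.
Proof.
have p : 0 <= n%:R :> R := ler0n _ _.
by case: b => _; apply/eqP; rewrite /eigval; lra.
Qed.

Lemma multiplicity_of_eigval b n :
  multiplicity_is (binary_tetrahedral (R:=R)) (eigval b n)%:C (edim b n * mdim n).
Proof. by apply: multiplicity_eigval => // b' n' _ /eigval_inj. Qed.

(** The value of the progression at k = 11, t = -1. No eigenvalue equals 1/2, and the empty second
    family of degree 0 serves as its eigenspace. *)
Lemma multiplicity_half : multiplicity_is (binary_tetrahedral (R:=R)) (1 / 2)%:C 0.
Proof.
by apply: (@multiplicity_eigval _ false 0) => // b n /eigval_neq_half/eqP.
Qed.

Lemma multiplicity_exact b n (u x : R) : u = eigval b n -> (edim b n * mdim n)%:R = x ->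
  exists2 m : nat, multiplicity_is (binary_tetrahedral (R:=R)) u%:C m & m%:R = x.
Proof.
by move=> -> e; exists (edim b n * mdim n)%N => //; exact: multiplicity_of_eigval.
Qed.

(** Here n = k + 12 s, so n + 2 = u + 1/2, and for even k one has m_n = m_k + s with s = (u - 3/2 -
    k)/12; the product (n + 2) m_n is the quadratic [P2T k]. *)
Lemma multiplicity_nonneg k s : (k < 12)%N -> let u : R := 3 / 2 + k%:R + 12 * s%:R in
  exists2 n : nat, multiplicity_is (binary_tetrahedral (R:=R)) u%:C n & n%:R = P2T k u.
Proof.
move=> k12 u; apply: (@multiplicity_exact true (k + s * 12)).
  by rewrite /eigval /u natrD natrM; ring.
rewrite mdim_period [edim _ _]/= /u.
case: k k12 {u} => [|[|[|[|[|[|[|[|[|[|[|[|//]]]]]]]]]]]] _.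
all: rewrite [mdim _]/= ?addn0 ?add0n ?muln1 ?muln0 /P2T //.
all: by rewrite natrM -addn2 !natrD ?natrM; field.
Qed.

(** For k <= 10, n = -(u + 1/2) is 10 - k + 12 s, and n m_n is the same quadratic in u as for
    positive u because m_k + m_(10-k) = 1 for even k. For k = 11 the degree n is odd, except that u
    = 1/2 belongs to neither family. *)
Lemma multiplicity_neg k s : (k < 12)%N -> let u : R := 3 / 2 + k%:R - 12 * s.+1%:R in
  exists2 n : nat, multiplicity_is (binary_tetrahedral (R:=R)) u%:C n & n%:R = P2T k u.
Proof.
rewrite ltnS leq_eqVlt => /orP[/eqP ->|k10] u.
  case: s @u => [|s] u.
    exists 0%N => //; have -> : u = 1 / 2 by rewrite /u; field.
    exact: multiplicity_half.
  apply: (@multiplicity_exact false (11 + s * 12)).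
    by rewrite /eigval /u -addn2 !natrD natrM; field.
  by rewrite mdim_period [mdim _]/= !muln0.
(* For k = 10 and s = 0 the value is -1/2, with an empty family and multiplicity 0. *)
apply: (@multiplicity_exact false ((10 - k) + s * 12)).
  by rewrite /eigval /u natrD natrM natrB// -natr1; field.
rewrite mdim_period [edim _ _]/= /u.
case: k k10 {u} => [|[|[|[|[|[|[|[|[|[|[|//]]]]]]]]]]] _.
all: rewrite /subn /= ?addn0 ?add0n ?muln1 ?muln0 /P2T //.
all: by rewrite natrM !natrD ?natrM -natr1; field.
Qed.
End spectrum.

Theorem proposition9p1 (R : realType) :
  (forall lambda : R[i],
     dirac_spectrum (binary_tetrahedral (R:=R)) lambda ->
     exists k : nat, lambda = (3 / 2 + k%:R)%:C \/
                     lambda = (- (3 / 2 + k%:R))%:C) /\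
  (forall (k : nat) (t : int), (k < 12)%N ->
     let u : R := 3 / 2 + k%:R + 12 * t%:~R in
     exists2 n : nat,
       multiplicity_is (binary_tetrahedral (R:=R)) u%:C n &
       n%:R = P2T k u).
Proof.
split=> [lambda hl|k [s|s] k12]; last 2 first.
- exact: multiplicity_nonneg.
- rewrite NegzE mulrNz mulrN; exact: multiplicity_neg.
apply: contrapT => h; apply: hl; apply: regular_off_spectrum => k.
by split=> e; apply: h; exists k; [left|right].
Qed.
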